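(* Let $\alpha\in(0,1)$. Let $K$ satisfy: $K\in L^1(\mathbb R)$ is bounded and continuous, $K\ge 0$, $K(0)>0$, and $K(x)=K(-x)$ for all $x\in\mathbb R$. Put $\kappa=\int_{\mathbb R}K(y)\,dy$ and let $u_T\in(0,\kappa)$. For $z,c\in\mathbb R$ define $$\phi(z;c)=\int_0^{+\infty}g_\alpha(r)\,\mathcal K(z+cr)\,dr ,$$ and let $c^*\in\mathbb R$ be the unique solution $c$ of $u_T=\int_0^{+\infty}g_\alpha(r)\mathcal K(cr)\,dr$. Then: (1) $(c^*,\phi(\cdot\,;c^* ))$ is an asymptotic traveling wave, its profile $z\mapsto\phi(z;c^* )$ is non-increasing, and it satisfies $\lim_{z\to-\infty}\phi(z;c^* )=\kappa$ and $\lim_{z\to+\infty}\phi(z;c^* )=0$. (2) Suppose in addition that $\kappa\ne 2u_T$. If $(c,\psi)$ is an asymptotic traveling wave with $\lim_{z\to-\infty}\psi(z)=\kappa$ and $\lim_{z\to+\infty}\psi(z)=0$, then $c=c^*$ and there is $z_0\in\mathbb R$ such that $\psi(z)=\phi(z-z_0;c^* )$ for all $z\in\mathbb R$.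
   Context: Notation: $\mathcal K(x)=\int_x^{+\infty}K(y)\,dy$; $E_{\alpha,\beta}(z)=\sum_{n=0}^\infty \frac{z^n}{\Gamma(\alpha n+\beta)}$; $g_\alpha(t)=t^{\alpha-1}E_{\alpha,\alpha}(-t^\alpha)$ for $t>0$. $H$ is the Heaviside function: $H(v)=1$ for $v>0$, $H(v)=0$ for $v<0$, with $H(0)$ any fixed value in $[0,1]$. $BC^1(\mathbb R)$ is the space of $C^1$ functions that are bounded together with their derivative. For $\phi\in BC^1(\mathbb R)$ define $$D_c^\alpha\phi(z)=-\frac{c^\alpha}{\Gamma(1-\alpha)}\int_0^{+\infty}\frac{\phi'(z+s)}{s^\alpha}\,ds\ (c>0),\qquad D_c^\alpha\phi(z)=\frac{|c|^\alpha}{\Gamma(1-\alpha)}\int_0^{+\infty}\frac{\phi'(z-s)}{s^\alpha}\,ds\ (c<0),$$ and $D_0^\alpha\phi\equiv0$; the integrals are understood as convergent improper integrals at $+\infty$. An asymptotic traveling wave is a pair $(c,\phi)\in\mathbb R\times BC^1(\mathbb R)$ such that for all $z\in\mathbb R$ $$D_c^\alpha\phi(z)=\int_{\mathbb R}K(z-y)H(\phi(y)-u_T)\,dy-\phi(z).$$ *)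

(* Defs.v *)
From HB Require Import structures.
From mathcomp Require Import all_boot all_order all_algebra.
From mathcomp Require Import all_classical all_reals all_analysis.

Set Implicit Arguments.
Unset Strict Implicit.
Unset Printing Implicit Defensive.

Import Order.TTheory GRing.Theory Num.Theory.
Import numFieldNormedType.Exports.

Local Open Scope classical_set_scope.
Local Open Scope ring_scope.

Section Definitions.
Context {R : realType}.

Local Notation mu := (@lebesgue_measure R).

(* Euler's integral; it is only meaningful for 0 < x. *)
Definition Gamma (x : R) : R :=
  \int[mu]_(t in `]0, +oo[) (t `^ (x - 1) * expR (- t)).

Definition mittag_leffler (alpha beta z : R) : R :=
  limn (series (fun n : nat => z ^+ n / Gamma (alpha * n%:R + beta))).

Definition g (alpha t : R) : R :=
  t `^ (alpha - 1) * mittag_leffler alpha alpha (- (t `^ alpha)).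

Definition kappa (K : R -> R) : R := \int[mu]_y K y.

Definition tail (K : R -> R) (x : R) : R := \int[mu]_(y in `[x, +oo[) K y.

(* h is the value chosen at 0. *)
Definition Heaviside (h v : R) : R :=
  if 0 < v then 1 else if v < 0 then 0 else h.

Definition BC1 (phi : R -> R) : Prop :=
  [/\ forall x, derivable phi x 1,
      continuous (derive1 phi),
      exists M : R, forall x, `|phi x| <= M
    & exists M : R, forall x, `|derive1 phi x| <= M].

(* Integrals over (0, +oo) that are improper at +oo only.  The integrands below
   are O(s^-alpha) on each (0, b] when phi is BC1 and 0 < alpha < 1, so the
   inner Lebesgue integral always exists; the limit in b need not come from an
   absolutely convergent integral. *)
Definition improper_integral (f : R -> R) : R :=
  lim ((\int[mu]_(s in `]0, b]) f s) @[b --> +oo]).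

Definition improper_cvg (f : R -> R) : Prop :=
  cvg ((\int[mu]_(s in `]0, b]) f s) @[b --> +oo]).

Definition frac_deriv (alpha c : R) (phi : R -> R) (z : R) : R :=
  if 0 < c then
    - (c `^ alpha / Gamma (1 - alpha)) *
      improper_integral (fun s => derive1 phi (z + s) / s `^ alpha)
  else if c < 0 then
    `|c| `^ alpha / Gamma (1 - alpha) *
      improper_integral (fun s => derive1 phi (z - s) / s `^ alpha)
  else 0.

Definition frac_deriv_exists (alpha c : R) (phi : R -> R) (z : R) : Prop :=
  (0 < c -> improper_cvg (fun s => derive1 phi (z + s) / s `^ alpha)) /\
  (c < 0 -> improper_cvg (fun s => derive1 phi (z - s) / s `^ alpha)).

Definition asymptotic_traveling_wave
    (alpha : R) (K : R -> R) (uT h c : R) (phi : R -> R) : Prop :=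
  BC1 phi /\
  forall z, frac_deriv_exists alpha c phi z /\
    frac_deriv alpha c phi z =
      \int[mu]_y (K (z - y) * Heaviside h (phi y - uT)) - phi z.

Definition profile (alpha : R) (K : R -> R) (c z : R) : R :=
  \int[mu]_(r in `]0, +oo[) (g alpha r * tail K (z + c * r)).

Definition speed_equation (alpha : R) (K : R -> R) (uT c : R) : Prop :=
  uT = \int[mu]_(r in `]0, +oo[) (g alpha r * tail K (c * r)).

End Definitions.

(* Main.v *)
Require Import Defs.
From mathcomp Require Import all_boot all_order all_algebra.
From mathcomp Require Import all_classical all_reals all_analysis.
From mathcomp Require Import measurable_realfun ring lra.

Import Order.TTheory GRing.Theory Num.Theory.
Import numFieldNormedType.Exports.

Local Open Scope classical_set_scope.
Local Open Scope ring_scope.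

Set Implicit Arguments.
Unset Strict Implicit.

(** Write g for g_alpha and, for 0 < c, read the equation along the ray
    t |-> z + c t as a relaxation equation in reversed time.  There g is the
    resolvent of the fractional integral of order alpha, so inverting
    1 + D turns the equation

      D psi = f - psi,  f z = \int K (z - y) H (psi y - u_T) dy

    into the representation psi z = \int_0^oo g r * f (z + c r) dr: the wave at z
    is an average of its input at the later points of the ray.  Two facts about
    g make this work.

    - g is a probability density.  Its Mittag-Leffler series satisfies
      g = a - a * g for the Riemann-Liouville kernel a of order alpha
      ([ml_kernel_convolution], [ml_kernel_rec]); since a is decreasing and
      logarithmically convex, g is positive ([resolvent_gt0], [ml_kernel_gt0]),
      and the relaxation function E_alpha (- t^alpha), which is one minus the
      distribution function of g, decreases to 0 ([relaxation_cvg0],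
      [ml_kernel_mass]).
    - The representation holds for every bounded solution ([wave_average]).  The
      improper integral in D psi need not converge absolutely, so the equation is
      only integrated against g up to a horizon T, which leaves an error of the
      order of the relaxation function at T ([wave_local], [horizon_balance]).

    Existence.  The profile is by definition the average of tail K along the
    delays.  It decreases strictly through u_T at the origin when c = c*, so its
    firing pattern H (phi - u_T) is a step and its input is tail K; convolving the
    derivative of the profile with the Riemann-Liouville kernel of order
    1 - alpha gives D phi = tail K - phi ([profile_input],
    [profile_frac_deriv], [profile_wave]).  The speed exists and is unique because
    the average of tail K (c r) is continuous and strictly decreasing in c, with
    limits kappa and 0 ([speed_exists], [speed_unique]).

    Uniqueness.  A wave psi with the given limits has a first and a last point
    a <= b where it equals u_T, and its input lies between those of the steps at a
    and at b.  Averaging these bounds along the rays from a and from b yields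
    u_T >= phi (0; c) and u_T <= phi (0; c), so c = c*.  If a < b, equality in the
    first average determines f almost everywhere to the right of a, hence psi b,
    which comes out strictly below u_T.  So a = b, the firing pattern is a step,
    and psi is a translate of the profile ([wave_rigidity]).  When c = 0 the
    equality reads u_T = kappa / 2, the excluded case.

    Negative speeds reduce to positive ones: as K is even, replacing psi by
    kappa - psi (- z) and u_T by kappa - u_T reverses the speed
    ([traveling_wave_reflect], [profile_opp]). *)

(** * Affine substitutions and convolutions *)

Section ChangeOfVariables.
Context {R : realType}.
Local Notation mu := (@lebesgue_measure R).
Implicit Types (a b : R) (f : R -> \bar R).

Lemma measurable_affine a b : measurable_fun setT (fun x : R => a * x + b).
Proof.
by apply: measurable_funD => //; apply: measurable_funM.
Qed.

Lemma lebesgue_measure_affine a b (A : set R) : a != 0 -> measurable A ->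
  mu A = (`|a|%:E * mu ((fun x => a * x + b)%R @^-1` A))%E.
Proof.
move=> a0 mA.
pose f : measurableTypeR R -> measurableTypeR R := fun x => a * x + b.
have mf : measurable_fun setT f by exact: measurable_affine.
pose nn := NngNum (normr_ge0 a).
pose pf := @measure_function_pushforward__canonical__measure_function_Measure
  _ _ _ _ _ mu f mf.
apply: (@lebesgue_measure_unique R (mscale nn pf)) => // X [[u v] _ <-] /=.
  rewrite /mscale /= /pushforward.
  case: (ltgtP a 0) a0 => // [aneg|apos] _.
  - have -> : f @^-1` `]u, v] = [set` `[(v - b) / a, (u - b) / a[ ].
      apply/seteqP; split => x /=; rewrite /f !in_itv /= => /andP[h1 h2]; apply/andP; split.
      + by rewrite ler_ndivrMr //; lra.
      + by rewrite ltr_ndivlMr //; lra.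
      + by move: h2; rewrite ltr_ndivlMr //; lra.
      + by move: h1; rewrite ler_ndivrMr //; lra.
    rewrite !lebesgue_measure_itv /= !lte_fin.
    rewrite ltr_ndivlMr // divfK ?lt_eqF // ltrD2r.
    case: ifPn => uv; last by rewrite mule0.
    rewrite -!EFinB -EFinM ltr0_norm //; congr EFin; field; exact: lt0r_neq0 || by rewrite lt_eqF.
  - have -> : f @^-1` `]u, v] = [set` `](u - b) / a, (v - b) / a] ].
      apply/seteqP; split => x /=; rewrite /f !in_itv /= => /andP[h1 h2]; apply/andP; split.
      + by rewrite ltr_pdivrMr //; lra.
      + by rewrite ler_pdivlMr //; lra.
      + by move: h1; rewrite ltr_pdivrMr //; lra.
      + by move: h2; rewrite ler_pdivlMr //; lra.
    rewrite !lebesgue_measure_itv /= !lte_fin.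
    rewrite ltr_pdivlMr // divfK ?gt_eqF // ltrD2r.
    case: ifPn => uv; last by rewrite mule0.
    rewrite -!EFinB -EFinM gtr0_norm //; congr EFin; field; by rewrite gt_eqF.
Qed.

Lemma ge0_integral_affine a b f : a != 0 -> measurable_fun setT f ->
  (forall x, 0 <= f x)%E ->
  (\int[mu]_x f x = `|a|%:E * \int[mu]_x f (a * x + b)%R)%E.
Proof.
move=> a0 mf f0.
have mg : measurable_fun setT (fun x : R => a * x + b) by exact: measurable_affine.
pose nn := NngNum (normr_ge0 a).
pose pf := @measure_function_pushforward__canonical__measure_function_Measure
  _ _ _ (measurableTypeR R) _ mu (fun x : R => a * x + b)%R mg.
rewrite (@eq_measure_integral _ _ _ setT (mscale nn pf)); last first.
  by move=> A mA _; exact: (lebesgue_measure_affine b a0 mA).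
rewrite ge0_integral_mscale //=.
by rewrite ge0_integral_pushforward.
Qed.

Lemma ge0_integral_shift b f : measurable_fun setT f ->
  (forall x, 0 <= f x)%E -> (\int[mu]_x f x = \int[mu]_x f (x + b)%R)%E.
Proof.
move=> mf f0; rewrite (@ge0_integral_affine 1 b) ?oner_eq0 //.
by rewrite normr1 mul1e; under eq_integral do rewrite mul1r.
Qed.

Lemma ge0_integral_reflect b f : measurable_fun setT f ->
  (forall x, 0 <= f x)%E -> (\int[mu]_x f x = \int[mu]_x f (b - x)%R)%E.
Proof.
move=> mf f0; rewrite (@ge0_integral_affine (-1) b) ?oppr_eq0 ?oner_eq0 //.
rewrite normrN normr1 mul1e; apply: eq_integral => x _.
by rewrite mulN1r addrC.
Qed.

Lemma ge0_integral_EFinZl (k : R) (f : R -> R) : measurable_fun setT f ->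
  (forall x, 0 <= f x) -> 0 <= k ->
  (\int[mu]_x (k * f x)%:E = k%:E * \int[mu]_x (f x)%:E)%E.
Proof.
move=> mf f0 k0; under eq_integral do rewrite EFinM.
by rewrite ge0_integralZl// => [|x _]; [exact/measurable_EFinP|rewrite lee_fin].
Qed.

(** The substitution t = r + s for fixed r, followed by an exchange of the order
    of integration: integrating against a function of the sum is integrating
    against the convolution.  When p and q vanish on the negative half-line this
    is Fubini's theorem on a triangle. *)
Lemma tonelli_convolution (p q chi : R -> R) :
  measurable_fun setT p -> measurable_fun setT q -> measurable_fun setT chi ->
  (forall x, 0 <= p x) -> (forall x, 0 <= q x) -> (forall x, 0 <= chi x) ->
  (\int[mu]_r ((p r)%:E * \int[mu]_s (q s * chi (r + s)%R)%:E) =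
   \int[mu]_t ((chi t)%:E * \int[mu]_r (p r * q (t - r)%R)%:E))%E.
Proof.
move=> mp mq mchi p0 q0 chi0.
have mr : measurable_fun setT (fun z : R * R => z.1) by exact: measurable_fst.
have mF : measurable_fun setT (fun z : R * R => (p z.1 * q (z.2 - z.1) * chi z.2)%:E).
  apply/measurable_EFinP; apply: measurable_funM; last exact: measurableT_comp.
  apply: measurable_funM; first exact: measurableT_comp.
  apply: measurableT_comp => //; exact: measurable_funB.
transitivity (\int[mu]_r \int[mu]_t (p r * q (t - r)%R * chi t)%:E)%E.
  apply: eq_integral => r _.
  rewrite -ge0_integralZl//; last 3 first.
  - apply/measurable_EFinP; apply: measurable_funM => //.
    apply: measurableT_comp => //; exact: measurable_funD.
  - by move=> s _; rewrite lee_fin mulr_ge0.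
  - by rewrite lee_fin.
  rewrite [RHS](ge0_integral_shift r); last 2 first.
  - apply/measurable_EFinP; apply: measurable_funM => //.
    apply: measurable_funM => //.
    apply: measurableT_comp => //; exact: measurable_funB.
  - by move=> x; rewrite lee_fin !mulr_ge0.
  by apply: eq_integral => s _; rewrite -EFinM addrK mulrA [r + s]addrC.
transitivity (\int[mu]_t \int[mu]_r (p r * q (t - r)%R * chi t)%:E)%E.
  by apply: (fubini_tonelli (m1 := mu) (m2 := mu) _ mF) => z;
    rewrite lee_fin !mulr_ge0.
apply: eq_integral => t _.
rewrite -ge0_integralZl//; last 3 first.
- apply/measurable_EFinP; apply: measurable_funM => //.
  apply: measurableT_comp => //; exact: measurable_funB.
- by move=> s _; rewrite lee_fin mulr_ge0.
- by rewrite lee_fin.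
by apply: eq_integral => r _; rewrite -EFinM mulrC.
Qed.

End ChangeOfVariables.

(** * Euler's integral *)

Section HalfLine.
Context {R : realType}.
Local Notation mu := (@lebesgue_measure R).

Lemma integral_half_line (f : R -> \bar R) :
  (\int[mu]_(x in `]0%R, +oo[) f x = \int[mu]_x (if (0 < x)%R then f x else 0))%E.
Proof.
rewrite integral_mkcond; apply: eq_integral => x _.
rewrite patchE; case: ifPn => [|/negP]; rewrite inE/= in_itv/= andbT.
  by move=> ->.
by move=> /negP/negbTE ->.
Qed.

Lemma measurable_half_line (f : R -> R) :
  measurable_fun setT f -> measurable_fun setT (fun t : R => if 0 < t then f t else 0).
Proof. by move=> mf; apply: measurable_fun_ifT => //; exact: measurable_fun_ltr. Qed.

(** An antiderivative of bounded increase gives integrability at both ends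
    of the half-line, including where the integrand is singular. *)
Lemma ge0_integral_half_line_le (f F : R -> R) (B : R) :
  measurable_fun setT f -> (forall x : R, 0 < x -> 0 <= f x) ->
  (forall x : R, 0 < x -> {for x, continuous f}) ->
  (forall x : R, 0 < x -> is_derive x 1 F (f x)) ->
  (forall a b : R, 0 < a -> a < b -> F b - F a <= B) ->
  (\int[mu]_t (if (0 < t)%R then f t else 0%R)%:E <= B%:E)%E.
Proof.
move=> mf f0 cf dF FB.
pose I (n : nat) : set R := `[n.+1%:R^-1, n.+2%:R]%classic.
have Ipos n x : I n x -> 0 < x.
  by rewrite /I /= in_itv /= => /andP[+ _]; apply: lt_le_trans; rewrite invr_gt0.
have ndI : nondecreasing_seq I.
  apply/nondecreasing_seqP => n; rewrite subsetEset => x; rewrite /I /= !in_itv /=.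
  move=> /andP[h1 h2]; apply/andP; split.
    by apply: le_trans h1; rewrite lef_pV2 ?posrE// ler_nat.
  by apply: le_trans h2 _; rewrite ler_nat.
have UI : \bigcup_i I i = `]0, +oo[%classic.
  apply/seteqP; split => x /=; first by case=> n _ /Ipos; rewrite in_itv/= andbT.
  rewrite in_itv/= andbT => x0.
  exists (Num.truncn (x^-1 + x)) => //; rewrite /I /= in_itv /=.
  have xi : 0 < x^-1 by rewrite invr_gt0.
  have h := truncnS_gt (x^-1 + x).
  apply/andP; split.
    by rewrite invf_ple ?posrE//; apply: ltW; apply: le_lt_trans h; rewrite lerDl ltW.
  apply: (@le_trans _ _ ((Num.truncn (x^-1 + x)).+1)%:R); last by rewrite ler_nat.
  by apply: ltW; apply: le_lt_trans h; rewrite lerDr ltW.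
have -> : (\int[mu]_t (if (0 < t)%R then f t else 0%R)%:E = \int[mu]_(t in \bigcup_i I i) (f t)%:E)%E.
  by rewrite UI integral_half_line; apply: eq_integral => x _; case: ifP.
have H : (\int[mu]_(x in I i) (f x)%:E)%E @[i --> \oo] -->
    (\int[mu]_(x in \bigcup_i I i) (f x)%:E)%E.
  apply: ge0_nondecreasing_set_cvg_integral => //.
  - by move=> i; exact: measurable_itv.
  - by move=> i; apply/measurable_EFinP; apply: measurable_funS mf.
  - by move=> i x /Ipos x0; rewrite lee_fin f0.
rewrite -(cvg_lim _ H)//; apply: lime_le; first by apply/cvg_ex; eexists; exact: H.
apply: nearW => n.
have ab : n.+1%:R^-1 < n.+2%:R :> R.
  apply: (@le_lt_trans _ _ 1); last by rewrite ltr1n.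
  by rewrite invf_le1 // ler1n.
have a0 : 0 < n.+1%:R^-1 :> R by rewrite invr_gt0.
have dc x : 0 < x -> {for x, continuous F}.
  move=> x0; apply: differentiable_continuous; apply/derivable1_diffP.
  by have [] := dF x x0.
rewrite /I (continuous_FTC2 ab (F := F)).
- by rewrite -EFinB lee_fin FB.
- apply: continuous_in_subspaceT => x; rewrite inE => /Ipos; exact: cf.
- split.
  + move=> x; rewrite in_itv /= => /andP[h _].
    by have [] := dF x (lt_trans a0 h).
  + apply: cvg_at_right_filter; exact: dc.
  + apply: cvg_at_left_filter; apply: dc; exact: lt_trans ab.
- move=> x; rewrite in_itv /= => /andP[h _].
  rewrite derive1E; have h0 := lt_trans a0 h; by have [_ ->] := dF x h0.
Qed.

End HalfLine.

Section Gamma.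
Context {R : realType}.
Local Notation mu := (@lebesgue_measure R).

Lemma exprn_le_expR (n : nat) (x : R) : 0 <= x -> x ^+ n <= n`!%:R * expR x.
Proof.
move=> x0; case: n => [|n].
  by rewrite expr0 fact0 mul1r; rewrite -expR0 ler_expR.
have := expR_ge1Dxn n x0.
have f0 : 0 < n.+1`!%:R :> R by rewrite ltr0n fact_gt0.
move=> h; rewrite mulrC -ler_pdivrMr //; by apply: le_trans h; rewrite lerDr.
Qed.

Definition power_kernel (gam t : R) : R := if 0 < t then t `^ (gam - 1) else 0.

Lemma power_kernel_ge0 (gam t : R) : 0 <= power_kernel gam t.
Proof. by rewrite /power_kernel; case: ifP => // _; exact: powR_ge0. Qed.

Lemma measurable_power_kernel (gam : R) : measurable_fun setT (power_kernel gam).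
Proof. exact: measurable_half_line. Qed.

Lemma GammaE (gam : R) :
  Gamma gam = fine (\int[mu]_t (power_kernel gam t * expR (- t))%:E)%E.
Proof.
rewrite /Gamma /Rintegral integral_half_line; congr fine.
by apply: eq_integral => t _; rewrite /power_kernel; case: ifP => // _; rewrite mul0r.
Qed.

(** The majorant has the singularity of the integrand at 0, but up to a constant
    it is the derivative of - 1 / (1 + t^gam), which is bounded: integrability
    at both ends follows at once. *)
Lemma Gamma_integrand_ub (gam : R) : 0 < gam -> exists C : R, forall t : R, 0 < t ->
  t `^ (gam - 1) * expR (- t) <= C * (gam * t `^ (gam - 1) * (1 + t `^ gam) `^ (- 2)).
Proof.
move=> g0.
pose n := (Num.truncn gam).+1.
have gn : gam <= n%:R by apply/ltW; rewrite truncnS_gt.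
pose C1 : R := 2 + n`!%:R * 2 ^+ n.
exists (C1 ^+ 2 / gam) => t t0.
have tg : 1 + t `^ gam <= C1 * expR (t / 2).
  have e1 : 1 <= expR (t / 2) by rewrite -expR0 ler_expR divr_ge0// ltW.
  have h : t `^ gam <= 1 + t ^+ n.
    have [t1|t1] := leP t 1.
      apply: (@le_trans _ _ 1); last by rewrite lerDl exprn_ge0// ltW.
      have -> : 1 = 1 `^ gam :> R by rewrite powR1.
      by apply: ge0_ler_powR; rewrite ?nnegrE// ltW.
    rewrite -powR_mulrn; last exact: ltW.
    apply: (@le_trans _ _ (t `^ n%:R)); last by rewrite lerDr.
    by apply: ler_powR => //; exact: ltW.
  have h2 : t ^+ n <= n`!%:R * 2 ^+ n * expR (t / 2).
    have -> : t ^+ n = (t / 2) ^+ n * 2 ^+ n by rewrite -exprMn divfK.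
    rewrite -mulrA mulrCA mulrC ler_wpM2l ?exprn_ge0 //.
    by apply: exprn_le_expR; rewrite divr_ge0// ltW.
  rewrite /C1; lra.
have p0 : 0 < 1 + t `^ gam by rewrite ltr_wpDr ?powR_ge0.
have sq : (1 + t `^ gam) ^+ 2 <= C1 ^+ 2 * expR t.
  have -> : expR t = expR (t / 2) ^+ 2 by rewrite -expRM_natl; congr expR; field.
  rewrite -exprMn ler_sqr ?nnegrE//; first exact: ltW.
  exact: le_trans (ltW p0) tg.
rewrite (powR_invn 2); last exact: ltW.
have -> : C1 ^+ 2 / gam * (gam * t `^ (gam - 1) / (1 + t `^ gam) ^+ 2) =
          t `^ (gam - 1) * (C1 ^+ 2 / (1 + t `^ gam) ^+ 2).
  by field; rewrite !gt_eqF.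
apply: ler_wpM2l; first exact: powR_ge0.
rewrite ler_pdivlMr ?exprn_gt0// expRN mulrC ler_pdivrMr ?expR_gt0//.
Qed.

Lemma Gamma_integral_lty (gam : R) : 0 < gam ->
  (\int[mu]_t (power_kernel gam t * expR (- t))%:E < +oo)%E.
Proof.
move=> g0; have [C HC] := Gamma_integrand_ub g0.
pose F (t : R) : R := - C * (1 + t `^ gam) `^ (- 1).
pose f (t : R) : R := C * (gam * t `^ (gam - 1) * (1 + t `^ gam) `^ (- 2)).
have C0 : 0 <= C.
  have := HC 1 ltr01; rewrite !powR1 mul1r mulr1 => h.
  have : 0 <= C * (gam * (1 + 1) `^ (- 2)) by apply: le_trans h; exact: expR_ge0.
  by rewrite pmulr_lge0// mulr_gt0// powR_gt0.
have mf : measurable_fun setT f.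
  apply: measurable_funM => //; apply: measurable_funM.
    by apply: measurable_funM.
  apply: (measurableT_comp (f := fun t : R => t `^ (-2))) => //.
  by apply: measurable_funD.
have cont (x : R) (p : R) : 0 < x -> {for x, continuous (fun t : R => t `^ p)}.
  move=> x0; apply: differentiable_continuous; apply/derivable1_diffP.
  by apply: derivable_powR; rewrite in_itv/= andbT.
have p0 (t : R) : 0 < 1 + t `^ gam by rewrite ltr_wpDr ?powR_ge0.
apply: (@le_lt_trans _ _ C%:E); last exact: ltry.
apply: (@le_trans _ _ (\int[mu]_t (if (0 < t)%R then f t else 0%R)%:E)%E).
  apply: ge0_le_integral => //.
  - by move=> t _; rewrite lee_fin mulr_ge0 ?expR_ge0// power_kernel_ge0.
  - apply/measurable_EFinP; apply: measurable_funM; first exact: measurable_power_kernel.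
    by apply: measurableT_comp.
  - by apply/measurable_EFinP; exact: measurable_half_line.
  - move=> t _; rewrite lee_fin /power_kernel; case: ifPn => [t0|_]; last by rewrite mul0r.
    exact: HC.
apply: (@ge0_integral_half_line_le _ f F) => //.
- by move=> x x0; rewrite /f !mulr_ge0 ?powR_ge0// ltW.
- move=> x x0; rewrite /f; apply: cvgM; first exact: cvg_cst.
  apply: cvgM; first by apply: cvgM; [exact: cvg_cst|exact: cont].
  apply: (@continuous_comp _ _ _ (fun t : R => 1 + t `^ gam) (fun t => t `^ (-2))).
    by apply: cvgD; [exact: cvg_cst|exact: cont].
  exact: cont.
- move=> x x0; rewrite /F /f.
  have d1 := is_derive1_powR gam x0.
  have d2 : is_derive x 1 (fun t : R => 1 + t `^ gam) (gam * x `^ (gam - 1)).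
    by have := is_deriveD (is_derive_cst (1 : R^o) (x : R^o) 1) d1; rewrite add0r.
  have d3 := is_derive1_powR (-1) (p0 x).
  have d4 := @is_derive1_comp _ (fun t : R => t `^ (-1)) (fun t : R => 1 + t `^ gam) _ _ _ d3 d2.
  have d5 := is_deriveZ (- C) d4.
  apply: is_derive_eq d5 _.
  have -> : -1 - 1 = -2 :> R by lra.
  rewrite /GRing.scale /=; ring.
- move=> a b a0 ab; rewrite /F.
  have h1 := powR_ge0 (1 + b `^ gam) (-1).
  have h2 : (1 + a `^ gam) `^ (-1) <= 1.
    rewrite powR_inv1; last exact: ltW.
    by rewrite invf_le1// lerDl powR_ge0.
  have aux (u v : R) : 0 <= u -> v <= 1 -> - C * u - - C * v <= C.
    move=> u0 v1; rewrite !mulNr opprK addrC -mulrBr -[leRHS]mulr1; apply: (ler_wpM2l C0).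
    by apply: le_trans v1; rewrite gerBl.
  exact: aux h1 h2.
Qed.
End Gamma.

(** * The semigroup of fractional integration *)

Section RiemannLiouville.
Context {R : realType}.
Local Notation mu := (@lebesgue_measure R).
Implicit Types (gam del t : R) (p q : R -> R).

Lemma Gamma_integral gam : 0 < gam ->
  (\int[mu]_t (power_kernel gam t * expR (- t))%:E = (Gamma gam)%:E)%E.
Proof.
move=> g0; rewrite GammaE fineK// ge0_fin_numE; first exact: Gamma_integral_lty.
by apply: integral_ge0 => t _; rewrite lee_fin mulr_ge0 ?expR_ge0// power_kernel_ge0.
Qed.

(** Only the mass of Euler's integral on [M, M + 1] is kept; since M is
    arbitrary, Gamma outgrows every geometric sequence. *)
Lemma Gamma_ge gam (M : R) : 0 < gam -> 1 <= M ->
  M `^ gam * (expR (- (M + 1)) / (M + 1)) <= Gamma gam.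
Proof.
move=> g0 M1; rewrite -lee_fin -Gamma_integral//.
have M0 : 0 < M by lra.
set c := _ * _.
have c0 : 0 <= c by rewrite /c mulr_ge0 ?powR_ge0// divr_ge0 ?expR_ge0//; lra.
have mf : measurable_fun setT (fun t : R => (power_kernel gam t * expR (- t))%:E).
  apply/measurable_EFinP; apply: measurable_funM; first exact: measurable_power_kernel.
  by apply: measurableT_comp.
have -> : c%:E = (\int[mu]_(t in `[M, (M + 1)%R]) c%:E)%E.
  rewrite integral_cst//= lebesgue_measure_itv/= lte_fin ltrDl ltr01.
  by rewrite -EFinB addrAC subrr add0r mule1.
apply: (@le_trans _ _ (\int[mu]_(t in `[M, (M + 1)%R]) (power_kernel gam t * expR (- t))%:E)%E).
  apply: ge0_le_integral => //.
  - exact: measurable_funS mf.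
  - move=> t /=; rewrite in_itv/= => /andP[Mt tM].
    have t0 : 0 < t by exact: lt_le_trans M0 Mt.
    rewrite lee_fin /power_kernel t0 /c.
    have -> : t `^ (gam - 1) = t `^ gam / t.
      rewrite powRB; last by rewrite (gt_eqF t0) implybT.
      by rewrite powRr1// ltW.
    rewrite -[leRHS]mulrA ler_pM ?powR_ge0//.
    - by rewrite divr_ge0 ?expR_ge0//; lra.
    - by apply: ge0_ler_powR; rewrite ?nnegrE// ltW.
    - rewrite mulrC ler_pM ?expR_ge0 ?invr_ge0//; try lra.
      + by rewrite lef_pV2 ?posrE//; lra.
      + by rewrite ler_expR lerN2.
apply: ge0_subset_integral => //.
by move=> t _; rewrite lee_fin mulr_ge0 ?expR_ge0// power_kernel_ge0.
Qed.

Lemma Gamma_gt0 gam : 0 < gam -> 0 < Gamma gam.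
Proof.
move=> g0; apply: lt_le_trans (Gamma_ge g0 (lexx 1)).
by rewrite powR1 mul1r divr_gt0 ?expR_gt0.
Qed.

Definition convolution p q t : \bar R := (\int[mu]_r (p r * q (t - r))%:E)%E.

Lemma measurable_convolution_integrand p q t :
  measurable_fun setT p -> measurable_fun setT q ->
  measurable_fun setT (fun r => p r * q (t - r)).
Proof.
move=> mp mq; apply: measurable_funM => //; apply: measurableT_comp => //.
exact: measurable_funB.
Qed.

Lemma convolution_ge0 p q t : (forall x, 0 <= p x) -> (forall x, 0 <= q x) ->
  (0 <= convolution p q t)%E.
Proof. by move=> p0 q0; apply: integral_ge0 => r _; rewrite lee_fin mulr_ge0. Qed.

Lemma convolutionC p q t : measurable_fun setT p -> measurable_fun setT q ->
  (forall x, 0 <= p x) -> (forall x, 0 <= q x) ->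
  convolution p q t = convolution q p t.
Proof.
move=> mp mq p0 q0; rewrite /convolution (ge0_integral_reflect t).
- by apply: eq_integral => r _; rewrite subKr mulrC.
- by apply/measurable_EFinP; exact: measurable_convolution_integrand.
- by move=> r; rewrite lee_fin mulr_ge0.
Qed.

Lemma power_kernel_scale gam (s t : R) : 0 < t ->
  power_kernel gam (t * s) = t `^ (gam - 1) * power_kernel gam s.
Proof.
move=> t0; rewrite /power_kernel pmulr_rgt0//; case: ifPn => s0; last by rewrite mulr0.
by rewrite powRM// ltW.
Qed.

(** By homogeneity the convolution is determined by its value at 1, which is
    Euler's Beta integral. *)
Lemma power_kernel_convolution gam del t :
  (convolution (power_kernel gam) (power_kernel del) t =
   (power_kernel (gam + del) t)%:E * convolution (power_kernel gam) (power_kernel del) 1)%E.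
Proof.
have [t0|t0] := leP t 0.
  have -> : power_kernel (gam + del) t = 0 by rewrite /power_kernel ltNge t0.
  rewrite mul0e /convolution.
  apply: integral0_eq => r _; rewrite /power_kernel; case: ifPn => r0; last by rewrite mul0r.
  case: ifPn => [|_]; last by rewrite mulr0.
  by rewrite subr_gt0 => /(lt_trans r0)/lt_le_trans/(_ t0); rewrite ltxx.
have mc s := measurable_convolution_integrand s (measurable_power_kernel gam) (measurable_power_kernel del).
have tn0 : t != 0 by rewrite gt_eqF.
have me s : measurable_fun setT (fun r : R => (power_kernel gam r * power_kernel del (s - r))%:E).
  by apply/measurable_EFinP; exact: mc.
have p0 s r : (0 <= (power_kernel gam r * power_kernel del (s - r))%:E)%E.
  by rewrite lee_fin; apply: mulr_ge0; exact: power_kernel_ge0.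
rewrite {1}/convolution (ge0_integral_affine 0 tn0 (me t) (p0 t)) (gtr0_norm t0).
under eq_integral => r _.
  rewrite addr0 (_ : t - t * r = t * (1 - r)); last by rewrite mulrBr mulr1.
  rewrite (power_kernel_scale gam r t0) (power_kernel_scale del _ t0) mulrACA EFinM.
  over.
rewrite ge0_integralZl; last 4 first.
- exact: measurableT.
- exact: me.
- by move=> r _; exact: p0.
- by rewrite lee_fin; apply: mulr_ge0; exact: powR_ge0.
rewrite muleA -EFinM; congr (_%:E * _)%E.
rewrite /power_kernel t0 -[X in X * _]powRr1; last exact: ltW.
rewrite -!powRD ?(gt_eqF t0) ?implybT//; congr (_ `^ _); ring.
Qed.

(** The Riemann-Liouville kernel: convolution with it is fractional
    integration of order [gam]. *)
Definition rl_kernel gam t : R := power_kernel gam t / Gamma gam.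

Lemma rl_kernel_ge0 gam t : 0 < gam -> 0 <= rl_kernel gam t.
Proof. by move=> g0; rewrite divr_ge0 ?power_kernel_ge0// ltW// Gamma_gt0. Qed.

Lemma measurable_rl_kernel gam : measurable_fun setT (rl_kernel gam).
Proof. by apply: measurable_funM => //; exact: measurable_power_kernel. Qed.

Lemma rl_kernel_scale gam (s t : R) : 0 < t ->
  rl_kernel gam (t * s) = t `^ (gam - 1) * rl_kernel gam s.
Proof. by move=> t0; rewrite /rl_kernel power_kernel_scale// mulrA. Qed.

(** Euler's Beta integral, in the guise of the semigroup law of fractional
    integration.  Testing the convolution against exp(-t) gives
    Gamma gam * Gamma del on one side, and on the other Gamma (gam + del)
    times the value at 1, because the convolution is homogeneous. *)
Lemma rl_kernel_convolution gam del t : 0 < gam -> 0 < del ->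
  convolution (rl_kernel gam) (rl_kernel del) t = (rl_kernel (gam + del) t)%:E.
Proof.
move=> g0 d0.
have Gg := Gamma_gt0 g0; have Gd := Gamma_gt0 d0.
have Ggd := Gamma_gt0 (addr_gt0 g0 d0).
have me : measurable_fun setT (fun t : R => expR (- t)) by apply: measurableT_comp.
have Beta : (convolution (power_kernel gam) (power_kernel del) 1 =
    (Gamma gam * Gamma del / Gamma (gam + del))%:E)%E.
  have mpe c : measurable_fun setT (fun t : R => power_kernel c t * expR (- t)).
    by apply: measurable_funM => //; exact: measurable_power_kernel.
  have pe0 c t' : 0 <= power_kernel c t' * expR (- t') :> R.
    by rewrite mulr_ge0 ?expR_ge0// power_kernel_ge0.
  have inner r : (\int[mu]_s (power_kernel del s * expR (- (r + s)))%:E =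
      (expR (- r) * Gamma del)%:E)%E.
    rewrite EFinM -Gamma_integral// -ge0_integral_EFinZl ?expR_ge0//.
    by apply: eq_integral => s _; rewrite opprD expRD mulrCA.
  have := tonelli_convolution (measurable_power_kernel gam) (measurable_power_kernel del) me
    (power_kernel_ge0 gam) (power_kernel_ge0 del) (fun x => expR_ge0 (- x)).
  under eq_integral => r _ do rewrite inner -EFinM mulrA mulrC.
  rewrite ge0_integral_EFinZl ?(ltW Gd)// Gamma_integral//.
  under [in RHS]eq_integral => s _.
    rewrite -/(convolution _ _ _) power_kernel_convolution muleA -EFinM [_ * power_kernel _ _]mulrC.
    over.
  rewrite ge0_integralZr//; last 3 first.
  - by apply/measurable_EFinP; exact: mpe.
  - by move=> x _; rewrite lee_fin.
  - by apply: convolution_ge0; exact: power_kernel_ge0.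
  rewrite Gamma_integral ?addr_gt0// -EFinM => H.
  by rewrite mulrC [_ * Gamma del]mulrC EFinM H muleA -EFinM mulVf ?mul1e// gt_eqF.
transitivity ((((Gamma gam)^-1 * (Gamma del)^-1)%:E *
   convolution (power_kernel gam) (power_kernel del) t)%E).
  rewrite /convolution -ge0_integral_EFinZl; first last.
  - by apply: mulr_ge0; rewrite invr_ge0; [exact: ltW Gg|exact: ltW Gd].
  - by move=> x; apply: mulr_ge0; exact: power_kernel_ge0.
  - apply: measurable_convolution_integrand; exact: measurable_power_kernel.
  by apply: eq_integral => r _; rewrite /rl_kernel; congr EFin; rewrite mulrACA mulrC.
rewrite power_kernel_convolution Beta -!EFinM; congr EFin; rewrite /rl_kernel.
have aux (x y z k : R) : x != 0 -> y != 0 -> z != 0 -> x^-1 * y^-1 * (k * (x * y / z)) = k / z.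
  by move=> xn yn zn; field; rewrite xn yn zn.
exact: aux (lt0r_neq0 Gg) (lt0r_neq0 Gd) (lt0r_neq0 Ggd).
Qed.

Lemma rl_kernel_convolution_integrable gam del t : 0 < gam -> 0 < del ->
  mu.-integrable setT (fun r => (rl_kernel gam r * rl_kernel del (t - r))%:E).
Proof.
move=> g0 d0; apply/integrableP; split.
  by apply/measurable_EFinP; apply: measurable_convolution_integrand; exact: measurable_rl_kernel.
under eq_integral => r _.
  rewrite gee0_abs; last by rewrite lee_fin mulr_ge0 ?rl_kernel_ge0.
  over.
by have := rl_kernel_convolution t g0 d0; rewrite /convolution => ->; rewrite ltry.
Qed.

End RiemannLiouville.

(** * Continuity of entire series *)

Section EntireSeries.
Context {R : realType}.

(** The factor n + 1 of the differentiated series is at most 2^(n + 1), so it is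
    absorbed by evaluating the original series at 2 (K + 1). *)
Lemma pseries_diffs_cvg (c : R^nat) : (forall n, 0 <= c n) ->
  (forall K : R, 0 <= K -> cvgn (pseries c K)) ->
  forall K : R, 0 <= K -> cvgn (pseries (pseries_diffs c) K).
Proof.
move=> c0 cc K K0.
have h : cvgn (series (fun n => c n.+1 * (2 * (K + 1)) ^+ n.+1)).
  have K20 : 0 <= 2 * (K + 1) by lra.
  pose u n : R := c n * (2 * (K + 1)) ^+ n.
  have cu : series u n @[n --> \oo] --> limn (series u) := cc _ K20.
  have -> : series (fun n => c n.+1 * (2 * (K + 1)) ^+ n.+1) =
      (fun n => series u n.+1 - u 0%N).
    by apply/funext => n; rewrite [in RHS]/series /= big_nat_recl//= [u 0%N + _]addrC addrK.
  apply: is_cvgB; last exact: is_cvg_cst.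
  by apply/cvg_ex; exists (limn (series u)); move: cu; rewrite -cvg_shiftS.
apply: (series_le_cvg _ _ _ h).
- by move=> n /=; rewrite /pseries_diffs !mulr_ge0// exprn_ge0.
- by move=> n /=; rewrite !mulr_ge0// exprn_ge0//; lra.
- move=> n /=; rewrite /pseries_diffs -mulrA mulrCA ler_wpM2l//.
  rewrite exprMn; apply: ler_pM; rewrite ?exprn_ge0//.
    by rewrite -natrX ler_nat ltnW// ltn_expl.
  rewrite exprSr; apply: (@le_trans _ _ ((K + 1) ^+ n)).
    by apply: lerXn2r; rewrite ?nnegrE; lra.
  by rewrite ler_peMr ?exprn_ge0//; lra.
Qed.

Lemma pseries_continuous (c : R^nat) : (forall n, 0 <= c n) ->
  (forall K : R, 0 <= K -> cvgn (pseries c K)) ->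
  continuous (fun x => limn (pseries c x)).
Proof.
move=> c0 cc x.
have d0 n : 0 <= pseries_diffs c n by rewrite mulr_ge0.
have K0 : 0 <= `|x| + 1 :> R by rewrite addr_ge0.
have dc := pseries_diffs_cvg c0 cc.
have [] := @pseries_snd_diffs R c (`|x| + 1) x (cc _ K0) (dc _ K0) (pseries_diffs_cvg d0 dc K0).
  by rewrite [ltRHS]ger0_norm// ltrDl.
by move=> h _; apply: differentiable_continuous; apply/derivable1_diffP.
Qed.
End EntireSeries.

(** * Mittag-Leffler kernels *)

Section MittagLeffler.
Context {R : realType}.
Variable alpha : R.
Hypothesis alpha_gt0 : 0 < alpha.
Local Notation mu := (@lebesgue_measure R).
Implicit Types (beta gam t z : R) (n N : nat).

Let coef beta n : R := (Gamma (alpha * n%:R + beta))^-1.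

Let index_gt0 beta n : 0 < beta -> 0 < alpha * n%:R + beta.
Proof. by move=> b0; rewrite ltr_wpDl// mulr_ge0// ltW. Qed.

Let coef_ge0 beta n : 0 < beta -> 0 <= coef beta n.
Proof. by move=> b0; rewrite invr_ge0 ltW// Gamma_gt0// index_gt0. Qed.

Let coef_cvg beta : 0 < beta -> forall z, 0 <= z -> cvgn (pseries (coef beta) z).
Proof.
move=> b0 z z0.
(* With M^alpha = 2 z + 1 the lower bound on Gamma makes the terms decay like
   (z / (2 z + 1))^n <= 2^(- n). *)
pose M : R := (2 * z + 1) `^ alpha^-1.
have Ma : M `^ alpha = 2 * z + 1.
  by rewrite /M -powRrM mulVf ?gt_eqF// powRr1//; lra.
have M1 : 1 <= M.
  have -> : 1 = 1 `^ alpha^-1 :> R by rewrite powR1.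
  by apply: ge0_ler_powR; rewrite ?nnegrE ?invr_ge0//; try exact: ltW; lra.
have M0 : 0 < M by lra.
pose C := (M `^ beta * (expR (- (M + 1)) / (M + 1)))^-1.
have C0 : 0 < C.
  rewrite invr_gt0; apply: mulr_gt0; first exact: powR_gt0.
  by apply: divr_gt0; [exact: expR_gt0|lra].
have h2 : `|2^-1 : R| < 1 by rewrite ger0_norm; lra.
apply: (series_le_cvg _ _ _ (@is_cvg_geometric_series _ C _ h2)).
- by move=> n /=; rewrite mulr_ge0 ?coef_ge0// exprn_ge0.
- by move=> n /=; rewrite mulr_ge0 ?exprn_ge0// ltW.
- move=> n /=.
  have Mn : M `^ (alpha * n%:R + beta) = (2 * z + 1) ^+ n * M `^ beta.
    rewrite powRD; last by rewrite (gt_eqF M0) implybT.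
    by rewrite powRrM Ma powR_mulrn//; lra.
  have z1 : 0 < 2 * z + 1 by lra.
  have cle : coef beta n <= C * ((2 * z + 1) ^+ n)^-1.
    rewrite /coef /C -invfM lef_pV2 ?posrE ?Gamma_gt0 ?index_gt0//; last first.
      by rewrite mulr_gt0 ?exprn_gt0// -invr_gt0.
    apply: le_trans (Gamma_ge (index_gt0 n b0) M1).
    by rewrite Mn [leLHS]mulrC -[leRHS]mulrA.
  apply: (@le_trans _ _ (C * ((2 * z + 1) ^+ n)^-1 * z ^+ n)).
    by rewrite ler_wpM2r ?exprn_ge0.
  rewrite -mulrA ler_wpM2l ?(ltW C0)// -exprVn -exprMn.
  apply: lerXn2r; rewrite ?nnegrE; try lra.
    by rewrite mulr_ge0// invr_ge0 ltW.
  rewrite mulrC ler_pdivrMr//; lra.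
Qed.

Lemma mittag_lefflerE beta z : mittag_leffler alpha beta z = limn (pseries (coef beta) z).
Proof.
rewrite /mittag_leffler; congr (limn (series _)).
by apply/funext => n; rewrite mulrC.
Qed.

Lemma mittag_leffler_continuous beta : 0 < beta -> continuous (mittag_leffler alpha beta).
Proof.
move=> b0; rewrite (_ : mittag_leffler _ _ = fun z => limn (pseries (coef beta) z)).
  by apply: pseries_continuous => [n|z z0]; [exact: coef_ge0|exact: coef_cvg].
by apply/funext => z; exact: mittag_lefflerE.
Qed.

Lemma mittag_leffler0 beta : 0 < beta -> mittag_leffler alpha beta 0 = (Gamma beta)^-1.
Proof.
move=> b0; rewrite mittag_lefflerE; apply/cvg_lim => //.
rewrite -cvg_shiftS/=; apply: cvg_near_cst; apply: nearW => n.
rewrite /pseries/= /series/= big_nat_recl//= expr0 mulr1 big1 ?addr0.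
  by rewrite /coef mulr0 add0r.
by move=> i _; rewrite expr0n/= mulr0.
Qed.

(** Partial sums of t^(beta - 1) E_(alpha, beta)(- t^alpha), written with
    fractional kernels so that convolution acts on them term by term. *)
Let partial beta N t : R := \sum_(0 <= n < N) (-1) ^+ n * rl_kernel (alpha * n%:R + beta) t.

(** Extended by zero to the negative half-line, so that convolutions over the
    whole line are the causal ones.  For beta = alpha this is g; for beta = 1 it
    is E_alpha (- t^alpha), the solution of the relaxation equation
    D^alpha x = - x with x 0 = 1. *)
Definition ml_kernel beta t : R :=
  if 0 < t then t `^ (beta - 1) * mittag_leffler alpha beta (- (t `^ alpha)) else 0.

Lemma ml_kernel_le0 beta t : t <= 0 -> ml_kernel beta t = 0.
Proof. by rewrite /ml_kernel ltNge => ->. Qed.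

Let partialE beta N t : 0 < t ->
  partial beta N t = t `^ (beta - 1) * pseries (coef beta) (- (t `^ alpha)) N.
Proof.
move=> t0; rewrite /partial /pseries /series /= big_distrr /=; apply: eq_bigr => n _.
have e : t `^ (alpha * n%:R + beta - 1) = t `^ (beta - 1) * (t `^ alpha) ^+ n.
  rewrite -addrA addrC [LHS]powRD; last by rewrite (gt_eqF t0) implybT.
  by rewrite powRrM powR_mulrn ?powR_ge0.
by rewrite /rl_kernel /power_kernel t0 /coef e [in RHS]exprNn; ring.
Qed.

Let partial_le0 beta N t : t <= 0 -> partial beta N t = 0.
Proof.
move=> t0; rewrite /partial big1// => n _.
by rewrite /rl_kernel /power_kernel ltNge t0/= mul0r mulr0.
Qed.

Let partial_cvg beta t : 0 < beta -> partial beta N t @[N --> \oo] --> ml_kernel beta t.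
Proof.
move=> b0; rewrite /ml_kernel; case: ltP => t0; last first.
  by apply: cvg_near_cst; apply: nearW => N; exact: partial_le0.
rewrite mittag_lefflerE.
under eq_fun do rewrite partialE//.
apply: cvgM; first exact: cvg_cst.
have ta : 0 <= t `^ alpha by exact: powR_ge0.
have lt1 : `|- (t `^ alpha)| < `|t `^ alpha + 1|.
  by rewrite normrN !ger0_norm ?addr_ge0// ltrDl.
exact: (is_cvg_pseries_inside (coef_cvg b0 (addr_ge0 ta ler01)) lt1).
Qed.

(** The domination used to integrate the series term by term. *)
Let partial_bound beta : 0 < beta -> forall T : R, exists2 C : R, 0 <= C &
  forall N t, t <= T -> `|partial beta N t| <= C * rl_kernel beta t.
Proof.
move=> b0 T.
have cT := coef_cvg b0 (powR_ge0 T alpha).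
pose C := limn (pseries (coef beta) (T `^ alpha)).
have nd : nondecreasing_seq (pseries (coef beta) (T `^ alpha)).
  by apply/nondecreasing_seqP => n; rewrite /pseries seriesSr lerDl mulr_ge0 ?coef_ge0// exprn_ge0// powR_ge0.
have ub N : pseries (coef beta) (T `^ alpha) N <= C by apply: nondecreasing_cvgn_le.
have C0 : 0 <= C by apply: le_trans (ub 0%N); rewrite /pseries /series /= big_nil.
exists (C * Gamma beta); first by rewrite mulr_ge0// ltW// Gamma_gt0.
move=> N t tT; rewrite /rl_kernel /power_kernel; case: ltP => t0; last first.
  by rewrite partial_le0// normr0 mul0r mulr0.
rewrite partialE// normrM ger0_norm ?powR_ge0//.
rewrite -mulrA [X in C * X]mulrC divfK ?gt_eqF ?Gamma_gt0// [leRHS]mulrC.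
rewrite ler_wpM2l ?powR_ge0//.
apply: le_trans (ub N); rewrite /pseries /series /=.
apply: le_trans (ler_norm_sum _ _ _) _; apply: ler_sum => n _.
rewrite normrM (ger0_norm (coef_ge0 _ b0)) ler_wpM2l ?coef_ge0//.
rewrite normrX normrN ger0_norm ?powR_ge0// lerXn2r ?nnegrE ?powR_ge0//.
by apply: ge0_ler_powR; rewrite ?nnegrE ?(ltW alpha_gt0)//; [exact: ltW|lra].
Qed.

Let measurable_partial beta N : measurable_fun setT (partial beta N).
Proof.
apply: measurable_sum => n; apply: measurable_funM => //; exact: measurable_rl_kernel.
Qed.

Lemma measurable_ml_kernel beta : 0 < beta -> measurable_fun setT (ml_kernel beta).
Proof.
move=> b0; apply: (measurable_fun_cvg (h := partial beta)).
  by move=> n; exact: measurable_partial.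
by move=> t _; exact: partial_cvg.
Qed.

Let partialS beta N t :
  partial beta N.+1 t = partial beta N t + (-1) ^+ N * rl_kernel (alpha * N%:R + beta) t.
Proof. by rewrite /partial big_nat_recr. Qed.

Let partial_convolution beta gam N t : 0 < beta -> 0 < gam ->
  mu.-integrable setT (fun r => (partial beta N r * rl_kernel gam (t - r))%:E) /\
  (\int[mu]_r (partial beta N r * rl_kernel gam (t - r))%:E = (partial (beta + gam) N t)%:E)%E.
Proof.
move=> b0 g0; elim: N => [|N [IHi IHe]].
  have p0 (b s : R) : partial b 0 s = 0 by rewrite /partial big_nil.
  rewrite p0; split.
    apply: (eq_integrable _ (cst 0%E)) => //; last exact: integrable0.
    by move=> r _; rewrite p0 mul0r.
  by apply: integral0_eq => r _; rewrite p0 mul0r.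
have e r : ((partial beta N.+1 r * rl_kernel gam (t - r))%:E =
  (partial beta N r * rl_kernel gam (t - r))%:E +
  ((-1) ^+ N)%:E * (rl_kernel (alpha * N%:R + beta) r * rl_kernel gam (t - r))%:E)%E.
  rewrite -EFinM -EFinD; congr EFin.
  by rewrite partialS mulrDl -[X in _ + X]mulrA.
have ri := rl_kernel_convolution_integrable t (index_gt0 N b0) g0.
have i2 := @integrableZl _ _ _ mu setT measurableT ((-1) ^+ N) _ ri.
split.
  by rewrite (funext e); exact: integrableD.
under eq_integral do rewrite e.
rewrite integralD//= IHe integralZl//.
have := @rl_kernel_convolution R _ _ t (index_gt0 N b0) g0; rewrite /convolution => ->.
by rewrite -EFinM -EFinD partialS addrA.
Qed.

(** Fractional integration shifts the second parameter of the Mittag-Leffler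
    kernels: each term of the series is a fractional kernel, so this is the
    semigroup law summed up. *)
Lemma ml_kernel_convolution beta gam t : 0 < beta -> 0 < gam ->
  mu.-integrable setT (fun r => (ml_kernel beta r * rl_kernel gam (t - r))%:E) /\
  (\int[mu]_r (ml_kernel beta r * rl_kernel gam (t - r))%:E = (ml_kernel (beta + gam) t)%:E)%E.
Proof.
move=> b0 g0.
have [C C0 HC] := partial_bound b0 t.
have [] := @dominated_convergence _ _ R mu setT measurableT
  (fun N r => (partial beta N r * rl_kernel gam (t - r))%:E)
  (fun r => (ml_kernel beta r * rl_kernel gam (t - r))%:E)
  (fun r => (C%:E * (rl_kernel beta r * rl_kernel gam (t - r))%:E)%E).
- move=> N; apply/measurable_EFinP; apply: measurable_convolution_integrand; last exact: measurable_rl_kernel.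
  exact: measurable_partial.
- apply/measurable_EFinP; apply: measurable_convolution_integrand; last exact: measurable_rl_kernel.
  exact: measurable_ml_kernel.
- apply: aeW => r _; apply: cvg_EFin; first exact: nearW.
  by apply: cvgM; [exact: partial_cvg|exact: cvg_cst].
- by apply: integrableZl => //; exact: rl_kernel_convolution_integrable.
- apply: aeW => r N _; rewrite -EFinM /= lee_fin normrM mulrA.
  rewrite [`|rl_kernel _ _|]ger0_norm ?rl_kernel_ge0//.
  have [rt|tr] := leP r t; first by rewrite ler_wpM2r ?rl_kernel_ge0// HC.
  have -> : rl_kernel gam (t - r) = 0.
    by rewrite /rl_kernel /power_kernel subr_gt0 ltNge (ltW tr)/= mul0r.
  by rewrite !mulr0.
move=> ii _ lim; split => //; move: lim.
rewrite (_ : [sequence _]_n = (fun N => (partial (beta + gam) N t)%:E)); last first.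
  by apply/funext => N /=; have [_ ->] := partial_convolution N t b0 g0.
move=> lim; apply/esym/(cvg_unique _ _ lim) => //.
apply: cvg_EFin; first exact: nearW.
by apply: partial_cvg; exact: addr_gt0.
Qed.

(** Splitting off the first term of the series.  With the previous lemma this
    is the resolvent equation x = a - a * x for the kernel a of order alpha. *)
Lemma ml_kernel_rec beta t : 0 < beta ->
  ml_kernel beta t = rl_kernel beta t - ml_kernel (beta + alpha) t.
Proof.
move=> b0.
have c1 : (fun N => partial beta N.+1 t) @ \oo --> ml_kernel beta t.
  by rewrite (cvg_shiftS (fun N => partial beta N t)); exact: partial_cvg.
have c2 := partial_cvg (t := t) (addr_gt0 b0 alpha_gt0).
have e : (fun N => partial beta N.+1 t) =
    (fun N => rl_kernel beta t - partial (beta + alpha) N t).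
  apply/funext => N; rewrite /partial big_nat_recl//= expr0 mul1r mulr0 add0r.
  congr (_ + _); rewrite -sumrN; apply: eq_bigr => n _; rewrite exprS mulN1r mulNr.
  by congr (- (_ * rl_kernel _ _)); rewrite -natr1; ring.
rewrite e in c1; apply: (cvg_unique _ c1) => //.
by apply: cvgB c2; exact: cvg_cst.
Qed.

End MittagLeffler.

(** * Positivity, decay and mass of the kernel g *)

Section Relaxation.
Context {R : realType}.
Local Notation mu := (@lebesgue_measure R).
Implicit Types (gam t : R).

Lemma Gamma1 : Gamma (1 : R) = 1.
Proof.
rewrite /Gamma subrr; under eq_Rintegral do rewrite powRr0 mul1r.
rewrite /Rintegral integral_itv_obnd_cbnd; last first.
  by apply/measurable_EFinP; apply: measurable_funTS; apply: measurableT_comp.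
have dF (x : R) : is_derive x 1 (fun t : R => - expR (- t)) (expR (- x)).
  have d2 := @is_derive1_comp _ expR -%R x _ _ (is_derive_expR (- x)) (is_deriveNid x 1).
  by have := is_deriveN d2; rewrite mulrN1 opprK.
have cF (x : R) : {for x, continuous (fun t : R => - expR (- t))}.
  by apply: differentiable_continuous; apply/derivable1_diffP; have [] := dF x.
rewrite (@ge0_continuous_FTC2y _ _ (fun t => - expR (- t)) 0 0).
- by rewrite -EFinB /= oppr0 expR0 opprK add0r.
- by move=> x _; exact: expR_ge0.
- apply: continuous_subspaceT => x.
  by apply: (@continuous_comp _ _ _ -%R expR); [exact: opp_continuous|exact: continuous_expR].
- rewrite -[X in _ --> X]oppr0; apply: cvgN.
  exact: cvgr_expR.
- by move=> x _; have [] := dF x.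
- by apply: cvg_at_right_filter; exact: cF.
- by move=> x _; rewrite derive1E; have [_ ->] := dF x.
Qed.

Lemma rl_kernel1 t : rl_kernel 1 t = if 0 < t then 1 else 0.
Proof.
rewrite /rl_kernel /power_kernel Gamma1 subrr.
by case: ifP; rewrite ?powRr0 divr1.
Qed.

Lemma rl_kernelE gam t : 0 < t -> rl_kernel gam t = t `^ (gam - 1) / Gamma gam.
Proof. by rewrite /rl_kernel /power_kernel => ->. Qed.

Lemma rl_kernel_eq0 gam t : t <= 0 -> rl_kernel gam t = 0.
Proof. by rewrite /rl_kernel /power_kernel ltNge => -> /=; rewrite mul0r. Qed.

Lemma rl_kernel_gt0 gam t : 0 < gam -> 0 < t -> 0 < rl_kernel gam t.
Proof. by move=> g0 t0; rewrite rl_kernelE// divr_gt0 ?powR_gt0 ?Gamma_gt0. Qed.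

#[global] Opaque rl_kernel Gamma.

Lemma ler_powR_neg (p x y : R) : p <= 0 -> 0 < x -> x <= y -> y `^ p <= x `^ p.
Proof.
move=> p0 x0 xy; rewrite -[p]opprK !(powRN _ (- p)) lef_pV2 ?posrE ?powR_gt0//; last exact: lt_le_trans xy.
by apply: ge0_ler_powR; rewrite ?nnegrE ?oppr_ge0// ltW//; exact: lt_le_trans xy.
Qed.

Lemma ae_ne (a : R) : {ae mu, forall x, x != a}.
Proof.
exists [set a]; split => //; first exact: lebesgue_measure_set1.
by move=> x /= /negP; rewrite negbK => /eqP.
Qed.

Variable alpha : R.
Hypothesis alpha01 : 0 < alpha < 1.
Let alpha_gt0 : 0 < alpha. Proof. by case/andP: alpha01. Qed.
Let alpha_lt1 : alpha < 1. Proof. by case/andP: alpha01. Qed.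

Lemma ml_kernel_continuous beta t : 0 < beta -> 0 < t ->
  {for t, continuous (ml_kernel alpha beta)}.
Proof.
move=> b0 t0.
have h : {for t, continuous (fun s => s `^ (beta - 1) * mittag_leffler alpha beta (- (s `^ alpha)))}.
  have cp p : {for t, continuous (fun s : R => s `^ p)}.
    apply: differentiable_continuous; apply/derivable1_diffP.
    by apply: derivable_powR; rewrite in_itv/= andbT.
  apply: cvgM; first exact: cp.
  apply: (@continuous_comp _ _ _ (fun s : R => - (s `^ alpha)) (mittag_leffler alpha beta)).
    by apply: cvgN; exact: cp.
  exact: mittag_leffler_continuous.
have e : ml_kernel alpha beta t = t `^ (beta - 1) * mittag_leffler alpha beta (- (t `^ alpha)).
  by rewrite /ml_kernel t0.
suff : ml_kernel alpha beta s @[s --> t] --> ml_kernel alpha beta t by [].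
rewrite e.
apply: cvg_trans h; apply: near_eq_cvg.
near=> s; rewrite /ml_kernel ifT//.
by near: s; exact: lt_nbhsr.
Unshelve. all: by end_near. Qed.

Lemma ml_kernel_gt0_near0 : exists2 e : R, 0 < e &
  forall t, 0 < t -> t < e -> 0 < ml_kernel alpha alpha t.
Proof.
have c : mittag_leffler alpha alpha (- (t `^ alpha)) @[t --> 0^'+] --> (Gamma alpha)^-1.
  rewrite -(mittag_leffler0 alpha alpha_gt0).
  have h : - (t `^ alpha) @[t --> 0^'+] --> (0 : R).
    by rewrite -[X in _ --> X]oppr0; apply: cvgN; exact: powR_cvg0.
  by apply: cvg_comp h _; exact: mittag_leffler_continuous.
have Gp : 0 < (Gamma alpha)^-1 by rewrite invr_gt0 Gamma_gt0.
have := cvgr_gt _ c _ Gp.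
rewrite /at_right near_withinE => -[e /= e0 He].
exists e => // t t0 te; rewrite /ml_kernel t0 mulr_gt0 ?powR_gt0//.
by apply: He => //=; rewrite sub0r normrN gtr0_norm.
Qed.

(** (t - r) * s >= t * (s - r), and the kernel is a decreasing power. *)
Lemma rl_kernel_logconvex (r s t : R) : 0 < r -> r < s -> s < t ->
  rl_kernel alpha (t - r) * rl_kernel alpha s <= rl_kernel alpha t * rl_kernel alpha (s - r).
Proof.
move=> r0 rs st.
have s0 := lt_trans r0 rs; have t0 := lt_trans s0 st; have rt := lt_trans rs st.
have p1 : alpha - 1 <= 0 by rewrite subr_le0 ltW// alpha_lt1.
have Gi : 0 <= (Gamma alpha)^-1 by rewrite invr_ge0 ltW// Gamma_gt0.
rewrite !rl_kernelE ?subr_gt0// mulrACA [leRHS]mulrACA.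
apply: ler_wpM2r; first exact: mulr_ge0.
have rt0 : 0 < t - r by rewrite subr_gt0.
have rs0 : 0 < s - r by rewrite subr_gt0.
rewrite -(powRM _ (ltW rt0) (ltW s0)) -(powRM _ (ltW t0) (ltW rs0)).
apply: ler_powR_neg => //; first exact: mulr_gt0.
by clear -r0 st; nra.
Qed.

Lemma rl_kernel_double (s t : R) : 0 < t -> t / 2 <= s -> rl_kernel alpha s <= 2 * rl_kernel alpha t.
Proof.
move=> t0 ts; have t20 : 0 < t / 2 by rewrite divr_gt0.
have p1 : alpha - 1 <= 0 by rewrite subr_le0 ltW// alpha_lt1.
have Gi : 0 <= (Gamma alpha)^-1 by rewrite invr_ge0 ltW// Gamma_gt0.
rewrite (rl_kernelE _ (lt_le_trans t20 ts)) (rl_kernelE _ t0) mulrA ler_wpM2r//.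
apply: le_trans (ler_powR_neg p1 t20 ts) _.
rewrite powRM ?invr_ge0 ?(ltW t0)// mulrC ler_wpM2r ?powR_ge0//.
apply: (@le_trans _ _ (2^-1 `^ (-1))); last by rewrite powR_inv1 ?invrK// invr_ge0.
apply: ger_powR; first by rewrite invr_gt0 ltr0n invf_le1 ?ltr0n// ler1n.
by rewrite lerBrDr addNr ltW.
Qed.

Lemma rl_kernel_small (t : R) : 0 < t ->
  exists d : R, [/\ 0 < d, d <= t & forall s, 0 < s -> s <= d -> rl_kernel (1 + alpha) s < 2^-1].
Proof.
move=> t0.
have c : s `^ alpha / Gamma (1 + alpha) @[s --> 0^'+] --> (0 : R).
  rewrite -[X in _ --> X](mul0r (Gamma (1 + alpha))^-1).
  by apply: cvgM; [exact: powR_cvg0|exact: cvg_cst].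
have h2 : 0 < 2^-1 :> R by rewrite invr_gt0.
have := cvgr_lt _ c _ h2; rewrite /at_right near_withinE => -[d /= d0 Hd].
exists (Num.min (d / 2) t); split.
- by rewrite lt_min t0 divr_gt0.
- by rewrite ge_min lexx orbT.
move=> s s0; rewrite le_min => /andP[sd _].
rewrite rl_kernelE// addrAC subrr add0r; apply: Hd => //=.
rewrite sub0r normrN gtr0_norm//; apply: (le_lt_trans sd).
by rewrite ltr_pdivrMr// mulr_natr ltrDl.
Qed.

(** The kernel a = rl_kernel alpha is logarithmically convex, so that
    a (t - r) / a (s - r) <= a t / a s for 0 < r < s; this bounds the part of
    the convolution over (0, s).  Over (s, t), where f is at most f s, what is
    left is f s times the integral of a over (0, t - s). *)
Lemma convolution_le_earlier (f : R -> R) (s t : R) :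
  measurable_fun setT f -> (forall r, r <= 0 -> f r = 0) ->
  (forall r, 0 < r -> r < t -> 0 <= f r) -> 0 < s -> s < t ->
  (forall r, s <= r -> r <= t -> f r <= f s) ->
  (\int[mu]_r (f r * rl_kernel alpha (t - r))%:E <=
   (rl_kernel alpha t / rl_kernel alpha s)%:E * \int[mu]_r (f r * rl_kernel alpha (s - r))%:E +
   (f s * rl_kernel (1 + alpha) (t - s))%:E)%E.
Proof.
move=> mf f0 fpos s0 st fs.
have t0 := lt_trans s0 st.
pose a := @rl_kernel R alpha; rewrite -/a.
have a_ge0 r : 0 <= a r by exact: rl_kernel_ge0.
have as0 : 0 < a s by exact: rl_kernel_gt0.
have at0 : 0 < a t by exact: rl_kernel_gt0.
have mk (b u : R) : measurable_fun setT (fun r : R => rl_kernel b (u - r)).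
  apply: measurableT_comp; first exact: measurable_rl_kernel.
  exact: measurable_funB.
have mk1 : measurable_fun setT (fun r : R => rl_kernel 1 (r - s)).
  apply: measurableT_comp; first exact: measurable_rl_kernel.
  exact: measurable_funB.
have fs0 : 0 <= f s by exact: fpos.
have Er : (\int[mu]_r (rl_kernel 1 (r - s) * a (t - r))%:E =
    (rl_kernel (1 + alpha) (t - s))%:E)%E.
  rewrite -(rl_kernel_convolution (t - s) ltr01 alpha_gt0).
  rewrite /convolution.
  rewrite (ge0_integral_shift s); last 2 first.
  - by apply/measurable_EFinP; exact: (measurable_funM mk1 (mk _ _)).
  - move=> r. rewrite lee_fin. apply: mulr_ge0; [exact: rl_kernel_ge0 ltr01|exact: a_ge0].
  by apply: eq_integral => r _; rewrite addrK opprD addrA addrAC.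
have fa0 u r : u <= t -> 0 <= f r * a (u - r).
  move=> ut; have [r0|r0] := leP r 0; first by rewrite f0// mul0r.
  have [rt|tr] := ltP r t; first by rewrite mulr_ge0// fpos.
  by rewrite /a rl_kernel_eq0 ?mulr0// subr_le0 (le_trans ut).
have mfa u : measurable_fun setT (fun r : R => f r * a (u - r)).
  exact: (measurable_funM mf (mk _ _)).
have mB : measurable_fun setT (fun r : R => rl_kernel 1 (r - s) * a (t - r)).
  exact: (measurable_funM mk1 (mk _ _)).
have B0 r : 0 <= rl_kernel 1 (r - s) * a (t - r) by rewrite mulr_ge0 ?rl_kernel_ge0.
have rho0 : 0 <= a t / a s by rewrite divr_ge0.
rewrite [X in (_ + X)%E]EFinM -Er -(ge0_integral_EFinZl (mfa s) _ rho0); last first.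
  by move=> r; exact: fa0 (ltW st).
rewrite -(ge0_integral_EFinZl mB B0 fs0).
have A1 r : 0 <= a t / a s * (f r * a (s - r)).
  by apply: mulr_ge0 => //; exact: fa0 (ltW st).
have B1 r : 0 <= f s * (rl_kernel 1 (r - s) * a (t - r)) by exact: mulr_ge0.
have mA1 : measurable_fun setT (fun r : R => (a t / a s * (f r * a (s - r)))%:E).
  by apply/measurable_EFinP; apply: measurable_funM (mfa s); exact: measurable_cst.
have mB1 : measurable_fun setT (fun r : R => (f s * (rl_kernel 1 (r - s) * a (t - r)))%:E).
  by apply/measurable_EFinP; apply: measurable_funM mB; exact: measurable_cst.
have A1e (r : R) : [set: R] r -> (0 <= (a t / a s * (f r * a (s - r)))%:E)%E by rewrite lee_fin.
have B1e (r : R) : [set: R] r -> (0 <= (f s * (rl_kernel 1 (r - s) * a (t - r)))%:E)%E by rewrite lee_fin.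
rewrite -(ge0_integralD mu measurableT A1e mA1 B1e mB1).
apply: ae_ge0_le_integral.
- exact: measurableT.
- by move=> r _; exact: fa0.
- by apply/measurable_EFinP; exact: mfa.
- by move=> r _; rewrite -EFinD lee_fin; exact: addr_ge0.
- exact: emeasurable_funD.
have [N [mN N0 sub]] := ae_ne s; exists N; split => //.
apply: subset_trans sub => r /=; apply: contra_not => rs _; rewrite -EFinD lee_fin.
have [r0|r0] := leP r 0; first by rewrite f0// !mul0r mulr0 add0r mulr_ge0.
have [rlts|sr] := ltP r s.
  apply: (@le_trans _ _ (a t / a s * (f r * a (s - r)))); last by rewrite lerDl.
  rewrite [leRHS]mulrCA; apply: ler_wpM2l; first exact: fpos (lt_trans rlts st).
  by rewrite mulrAC ler_pdivlMr//; exact: rl_kernel_logconvex.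
have sltr : s < r by rewrite lt_neqAle eq_sym rs.
apply: (@le_trans _ _ (f s * (rl_kernel 1 (r - s) * a (t - r)))); last first.
  by rewrite lerDr.
rewrite rl_kernel1 subr_gt0 sltr mul1r.
have [rt|tr] := leP r t; last by rewrite /a rl_kernel_eq0 ?mulr0// subr_le0 ltW.
by apply: ler_wpM2r; [exact: a_ge0|exact: fs (ltW sltr) rt].
Qed.

(** The resolvent of a decreasing, logarithmically convex kernel a stays
    positive.  If f were positive before t with f t <= 0, take for m a maximum
    point of f on a short interval ending at t.  Subtracting the previous
    comparison between m and t from the resolvent equation f = a - a * f leaves
    f t >= f m * (a t / a m - A), where A, the integral of a over (0, t - m),
    is below 1 / 2 because the interval is short, while a t / a m >= 1 / 2. *)
Lemma resolvent_gt0 (f : R -> R) (t : R) :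
  measurable_fun setT f -> (forall r, r <= 0 -> f r = 0) ->
  (forall r, 0 < r -> {for r, continuous f}) ->
  (forall s, (\int[mu]_r (f r * rl_kernel alpha (s - r))%:E =
    (rl_kernel alpha s - f s)%:E)%E) ->
  0 < t -> (forall r, 0 < r -> r < t -> 0 < f r) -> 0 < f t.
Proof.
move=> mf f0 cf res t0 fpos; rewrite ltNge; apply/negP => ft.
have [d [d0 dt dsmall]] := rl_kernel_small (divr_gt0 t0 (ltr0n _ 2)).
have td : t / 2 <= t - d by rewrite lerBrDr -lerBrDl {1}(splitr t) addrK.
have t20 : 0 < t / 2 by rewrite divr_gt0.
have td0 : 0 < t - d by exact: lt_le_trans td.
have tdt : t - d < t by rewrite ltrBlDr ltrDl.
have cd : {within `[t - d, t], continuous f}.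
  apply: continuous_in_subspaceT => s; rewrite inE/= in_itv/= => /andP[s1 _].
  exact: cf (lt_le_trans td0 s1).
have [m] := EVT_max (ltW tdt) cd; rewrite in_itv/= => /andP[m1 m2] Hm.
have fm : 0 < f m.
  apply: (@lt_le_trans _ _ (f (t - d))); first exact: fpos.
  by apply: Hm; rewrite in_itv/= lexx ltW.
have m0 : 0 < m by exact: lt_le_trans td0 m1.
have mt : m < t.
  by rewrite lt_neqAle m2 andbT; apply/eqP => mE; move: fm; rewrite mE ltNge ft.
have := @convolution_le_earlier f m t mf f0 (fun r r0 rt => ltW (fpos r r0 rt)) m0 mt.
have h r : m <= r -> r <= t -> f r <= f m.
  by move=> mr rt; apply: Hm; rewrite in_itv/= rt (le_trans m1).
move=> /(_ h); rewrite !res -EFinM -EFinD lee_fin.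
have am : 0 < rl_kernel alpha m by exact: rl_kernel_gt0.
have at0 : 0 < rl_kernel alpha t by exact: rl_kernel_gt0.
have dbl := rl_kernel_double t0 (le_trans td m1).
have rho : 2^-1 <= rl_kernel alpha t / rl_kernel alpha m.
  by rewrite ler_pdivlMr// mulrC ler_pdivrMr// mulrC.
have sm : rl_kernel (1 + alpha) (t - m) < 2^-1.
  by apply: dsmall; rewrite ?subr_gt0// lerBlDr -lerBlDl.
rewrite mulrBr divfK ?gt_eqF//.
have h1 := ler_wpM2r (ltW fm) rho.
have h2 : f m * rl_kernel (1 + alpha) (t - m) < f m * 2^-1 by rewrite ltr_pM2l.
move: h1 h2 ft; set q := _ / _ * f m; set w := f m * rl_kernel _ _.
by set u := f m; set v := f t; set A := rl_kernel alpha t; clear; lra.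
Qed.

(** g is continuous on the open half-line and positive near 0, so if it failed
    to be positive there would be a first zero, which the resolvent equation
    forbids. *)
Lemma ml_kernel_gt0 t : 0 < t -> 0 < ml_kernel alpha alpha t.
Proof.
pose g := ml_kernel alpha alpha; rewrite -/g.
move=> tpos; rewrite ltNge; apply/negP => gt0.
pose S : set R := [set s | 0 < s /\ g s <= 0].
have [e e0 He] := ml_kernel_gt0_near0.
have lbS : lbound S e.
  by move=> s [s0 gs]; rewrite leNgt; apply/negP => /(He s s0); rewrite ltNge gs.
have infS : has_inf S by split; [exists t|exists e].
pose t0 := inf S.
have et0 : e <= t0 by apply: lb_le_inf => //; exists t.
have t00 : 0 < t0 by exact: lt_le_trans et0.
have gpos s : 0 < s -> s < t0 -> 0 < g s.
  move=> s0 st; rewrite ltNge; apply/negP => gs.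
  by have := ge_inf infS.2 (conj s0 gs : S s); rewrite -/t0 leNgt st.
have gt0le : g t0 <= 0.
  rewrite leNgt; apply/negP => gt0pos.
  have := cvgr_gt _ (ml_kernel_continuous alpha_gt0 t00) _ gt0pos.
  move=> [d /= d0 Hd].
  have [s [s0 gs] st] := inf_adherent d0 infS.
  have ts : t0 <= s by apply: ge_inf => //; [exact: infS.2].
  have : 0 < g s.
    by apply: Hd => /=; rewrite distrC ger0_norm ?subr_ge0// ltrBlDl.
  by rewrite ltNge gs.
suff : 0 < g t0 by rewrite ltNge gt0le.
apply: (@resolvent_gt0 g) => //.
- exact: measurable_ml_kernel.
- by move=> r; exact: ml_kernel_le0.
- by move=> r; exact: ml_kernel_continuous.
move=> s; have [_ ->] := ml_kernel_convolution alpha_gt0 s alpha_gt0 alpha_gt0.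
by rewrite /g (ml_kernel_rec alpha_gt0 s alpha_gt0) subKr.
Qed.

Lemma ml_kernel_ge0 t : 0 <= ml_kernel alpha alpha t.
Proof.
by have [t0|t0] := leP t 0; [rewrite ml_kernel_le0|exact: ltW (ml_kernel_gt0 t0)].
Qed.

Lemma gE t : 0 < t -> g alpha t = ml_kernel alpha alpha t.
Proof. by rewrite /ml_kernel => ->. Qed.

#[global] Opaque ml_kernel mittag_leffler.

(** It is the fractional integral of order 1 - alpha of g >= 0. *)
Lemma relaxation_ge0 t : 0 <= ml_kernel alpha 1 t.
Proof.
have alpha1 : 0 < 1 - alpha by rewrite subr_gt0.
have [_] := ml_kernel_convolution alpha_gt0 t alpha_gt0 alpha1.
have -> : alpha + (1 - alpha) = 1 by rewrite addrC subrK.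
move=> E; rewrite -lee_fin -E; apply: integral_ge0 => r _.
by rewrite lee_fin mulr_ge0 ?ml_kernel_ge0// rl_kernel_ge0.
Qed.

(** [ml_kernel alpha 1] is the relaxation function E_alpha(- t^alpha); it
    is the mass that g leaves beyond t. *)
Lemma ml_kernel_cdf t : (\int[mu]_r (ml_kernel alpha alpha r * rl_kernel 1 (t - r))%:E =
  (rl_kernel 1 t - ml_kernel alpha 1 t)%:E)%E.
Proof.
have [_ ->] := ml_kernel_convolution alpha_gt0 t alpha_gt0 ltr01.
by rewrite (ml_kernel_rec alpha_gt0 t ltr01) subKr [alpha + 1]addrC.
Qed.

Lemma relaxation_nonincreasing s t : 0 < s -> s <= t ->
  ml_kernel alpha 1 t <= ml_kernel alpha 1 s.
Proof.
move=> s0 st; have t0 : 0 < t by exact: lt_le_trans st.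
have : ((rl_kernel 1 s - ml_kernel alpha 1 s)%:E <= (rl_kernel 1 t - ml_kernel alpha 1 t)%:E)%E.
  rewrite -[leLHS]ml_kernel_cdf -[leRHS]ml_kernel_cdf; apply: ge0_le_integral.
  - exact: measurableT.
  - by move=> r _; rewrite lee_fin mulr_ge0 ?ml_kernel_ge0// rl_kernel_ge0.
  - apply/measurable_EFinP; apply: measurable_convolution_integrand; last exact: measurable_rl_kernel.
    exact: measurable_ml_kernel.
  - apply/measurable_EFinP; apply: measurable_convolution_integrand; last exact: measurable_rl_kernel.
    exact: measurable_ml_kernel.
  - move=> r _; rewrite lee_fin ler_wpM2l ?ml_kernel_ge0// !rl_kernel1 !subr_gt0.
    by case: (ltP r s) => rs; [rewrite (lt_le_trans rs st)|case: ifP].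
by rewrite lee_fin !rl_kernel1 s0 t0 lerD2l lerN2.
Qed.

(** Integrating the monotone relaxation function fractionally gives the
    distribution function of g, at most 1; this forces the decay. *)
Lemma relaxation_decay t : 0 < t -> ml_kernel alpha 1 t * rl_kernel (1 + alpha) t <= 1.
Proof.
move=> t0; apply: (@le_trans _ _ (ml_kernel alpha (1 + alpha) t)); last first.
  have := ml_kernel_rec alpha_gt0 t ltr01; have := relaxation_ge0 t.
  by rewrite rl_kernel1 t0 => + e; rewrite e subr_ge0.
have [_ E] := ml_kernel_convolution alpha_gt0 t ltr01 alpha_gt0.
rewrite -lee_fin -[leRHS]E EFinM -(rl_kernel_convolution t ltr01 alpha_gt0) /convolution.
rewrite -[leLHS]ge0_integral_EFinZl; last 3 first.
- by apply: measurable_convolution_integrand; exact: measurable_rl_kernel.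
- by move=> r; apply: mulr_ge0; [exact: rl_kernel_ge0 ltr01|exact: rl_kernel_ge0].
- exact: relaxation_ge0.
apply: ge0_le_integral.
- exact: measurableT.
- move=> r _; rewrite lee_fin; apply: mulr_ge0; first exact: relaxation_ge0.
  by apply: mulr_ge0; [exact: rl_kernel_ge0 ltr01|exact: rl_kernel_ge0].
- apply/measurable_EFinP; apply: measurable_funM => //.
  by apply: measurable_convolution_integrand; exact: measurable_rl_kernel.
- apply/measurable_EFinP; apply: measurable_convolution_integrand; last exact: measurable_rl_kernel.
  exact: measurable_ml_kernel.
- move=> r _; rewrite lee_fin mulrA.
  have [rt|tr] := ltP r t; last first.
    have -> : rl_kernel alpha (t - r) = 0 by rewrite rl_kernel_eq0// subr_le0.
    by rewrite !mulr0.
  apply: ler_wpM2r; first exact: rl_kernel_ge0.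
  rewrite rl_kernel1; case: ltP => r0; last by rewrite mulr0 relaxation_ge0.
  by rewrite mulr1 relaxation_nonincreasing// ltW.
Qed.

Lemma relaxation_cvg0 : ml_kernel alpha 1 t @[t --> +oo] --> (0 : R).
Proof.
have Gp : 0 < Gamma (1 + alpha) by rewrite Gamma_gt0// addr_gt0.
apply/cvgrPdist_lt => e e0.
pose B := (Gamma (1 + alpha) / e) `^ alpha^-1.
have B0 : 0 < B by rewrite powR_gt0// divr_gt0.
near=> t.
have tB : B < t by near: t; apply: nbhs_pinfty_gt; exact: num_real.
have t0 : 0 < t by exact: lt_trans tB.
rewrite sub0r normrN ger0_norm ?relaxation_ge0//.
have h : Gamma (1 + alpha) / e < t `^ alpha.
  have -> : Gamma (1 + alpha) / e = B `^ alpha.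
    by rewrite -powRrM mulVf ?gt_eqF// powRr1// ltW// divr_gt0.
  by apply: gt0_ltr_powR; rewrite ?nnegrE// ltW.
have := relaxation_decay t0.
rewrite rl_kernelE// addrAC subrr add0r.
move: h; rewrite ltr_pdivrMr// mulrA ler_pdivrMr// mul1r => h1 h2.
have := le_lt_trans h2 h1; rewrite mulrC ltr_pM2l//; exact: powR_gt0.
Unshelve. all: by end_near. Qed.

(** The distribution function of g is 1 minus the relaxation function, which
    tends to 0. *)
Lemma ml_kernel_mass : (\int[mu]_r (ml_kernel alpha alpha r)%:E = 1)%E.
Proof.
have := @cvg_monotone_convergence _ _ R mu setT measurableT
  (fun n r => (ml_kernel alpha alpha r * rl_kernel 1 (n%:R - r))%:E).
have cvgp r : (ml_kernel alpha alpha r * rl_kernel 1 (n%:R - r))%:E @[n --> \oo] -->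
    (ml_kernel alpha alpha r)%:E.
  apply: cvg_near_cst; near=> n.
  rewrite rl_kernel1 subr_gt0 ifT ?mulr1//.
  near: n; exact: nbhs_infty_gtr.
move=> H.
have L1 : (\int[mu]_r (ml_kernel alpha alpha r * rl_kernel 1 (n%:R - r))%:E)%E @[n --> \oo] -->
    (\int[mu]_r (ml_kernel alpha alpha r)%:E)%E.
  under [X in _ --> X]eq_integral => r _ do rewrite -(cvg_lim _ (cvgp r))//.
  apply: H.
  - move=> n; apply/measurable_EFinP; apply: measurable_convolution_integrand; last exact: measurable_rl_kernel.
    exact: measurable_ml_kernel.
  - by move=> n r _; rewrite lee_fin mulr_ge0 ?ml_kernel_ge0// rl_kernel_ge0.
  - move=> r _ m n mn; rewrite lee_fin ler_wpM2l ?ml_kernel_ge0// !rl_kernel1 !subr_gt0.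
    case: (ltP r m%:R) => rm; last by case: ifP.
    by rewrite (lt_le_trans rm)// ler_nat.
have L2 : (\int[mu]_r (ml_kernel alpha alpha r * rl_kernel 1 (n%:R - r))%:E)%E @[n --> \oo] --> 1%E.
  under eq_fun do rewrite ml_kernel_cdf.
  apply: cvg_EFin; first exact: nearW.
  rewrite -[X in _ --> X](subr0 1); apply: cvgB.
    apply: cvg_near_cst; near=> n; rewrite rl_kernel1 ifT//.
    near: n; exact: nbhs_infty_gtr.
  have /cvg_pinftyP := relaxation_cvg0; apply.
  exact: cvgr_idn.
exact: (cvg_unique _ L1 L2).
Unshelve. all: by end_near. Qed.

End Relaxation.

(** * The tail of K *)

Section Tail.
Context {R : realType}.
Local Notation mu := (@lebesgue_measure R).
Variable K : R -> R.
Hypothesis Kint : mu.-integrable setT (EFin \o K).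
Hypothesis Kcont : continuous K.
Hypothesis Kge0 : forall x, 0 <= K x.
Hypothesis K0 : 0 < K 0.
Hypothesis Ksym : forall x, K x = K (- x).
Implicit Types x y : R.

Lemma measurable_kernel : measurable_fun setT K.
Proof. exact: continuous_measurable_fun. Qed.

Lemma kappa_integral : (\int[mu]_y (K y)%:E = (kappa K)%:E)%E.
Proof. by rewrite /kappa /Rintegral fineK//; exact: integrable_fin_num. Qed.

Lemma kappa_ge0 : 0 <= kappa K.
Proof. by apply: Rintegral_ge0. Qed.

Let primitive x : R := \int[mu]_(t in `]-oo, x]) K t.

Lemma tail_primitive x : tail K x = kappa K - primitive x.
Proof.
have i : mu.-integrable [set` Interval (-oo%O) (+oo%O)] (EFin \o K).
  by rewrite set_itvNyy.
have := @Rintegral_itvB R K (-oo%O) (+oo%O) x i.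
rewrite !bnd_simp set_itvNyy => /(_ isT isT) e.
rewrite /kappa /primitive e /tail Rintegral_itv_obnd_cbnd//.
by apply: integrableS Kint.
Qed.

Lemma is_derive_tail x : is_derive x 1 (tail K) (- K x).
Proof.
have [d e] : derivable primitive x 1 /\ derive1 primitive x = K x.
  apply: (@continuous_FTC1 _ _ _ _ (x + 1)).
  - by rewrite ltrDl.
  - by apply: integrableS Kint.
  - by rewrite ltNyr.
  - exact: Kcont.
have dp : is_derive x 1 primitive (K x) by split; [exact: d|rewrite -e derive1E].
rewrite (_ : tail K = cst (kappa K) - primitive); last by apply/funext => y; exact: tail_primitive.
have := is_deriveB (is_derive_cst (kappa K : R^o) (x : R^o) 1) dp.
by rewrite sub0r.
Qed.

Lemma tail_continuous : continuous (tail K).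
Proof.
move=> x; apply: differentiable_continuous; apply/derivable1_diffP.
by have [] := is_derive_tail x.
Qed.

Lemma tail_ge0 x : 0 <= tail K x.
Proof. exact: Rintegral_ge0. Qed.

Lemma tail_sub_le0 x y : x <= y -> exists2 t, x <= t <= y & tail K y - tail K x = - K t * (y - x).
Proof.
move=> xy; have [] := MVT_segment xy (df := fun t => - K t) (f := tail K).
- by move=> t _; exact: is_derive_tail.
- by apply: continuous_subspaceT; exact: tail_continuous.
by move=> t; rewrite in_itv/= => ht e; exists t.
Qed.

Lemma tail_nonincreasing x y : x <= y -> tail K y <= tail K x.
Proof.
move=> xy; have [t _ e] := tail_sub_le0 xy.
by rewrite -subr_le0 e mulNr oppr_le0 mulr_ge0// subr_ge0.
Qed.

Lemma tail_le_kappa x : tail K x <= kappa K.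
Proof. by rewrite tail_primitive gerBl; exact: Rintegral_ge0. Qed.

(** K is known to be positive near 0 only, so tail K decreases strictly
    from x to y as soon as the interval from x to y meets a fixed neighbourhood
    of 0. *)
Lemma tail_lt : exists2 d : R, 0 < d &
  forall x y, x < y -> x < d -> - d < y -> tail K y < tail K x.
Proof.
have c0 : {for 0, continuous K} by exact: Kcont.
have := cvgr_gt _ c0 _ K0; move=> [d /= d0 Hd].
exists (d / 2); first by rewrite divr_gt0.
move=> x y xy xd yd.
pose x' := Num.max x (- (d / 2)); pose y' := Num.min y (d / 2).
have xx' : x <= x' by rewrite le_max lexx.
have yy' : y' <= y by rewrite ge_min lexx.
have xy' : x' < y'.
  by rewrite lt_min !gt_max xy yd xd /=; lra.
apply: (le_lt_trans (tail_nonincreasing yy')); apply: lt_le_trans (tail_nonincreasing xx').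
have [t /andP[t1 t2] e] := tail_sub_le0 (ltW xy').
rewrite -subr_lt0 e mulNr oppr_lt0 mulr_gt0 ?subr_gt0//.
apply: Hd => /=; rewrite sub0r normrN ltr_norml.
have h1 : - (d / 2) <= x' by rewrite le_max lexx orbT.
have h2 : y' <= d / 2 by rewrite ge_min lexx orbT.
by apply/andP; split; lra.
Qed.

Lemma tail_opp x : tail K (- x) = kappa K - tail K x.
Proof.
rewrite (tail_primitive x) subKr.
rewrite /primitive /tail /Rintegral; congr fine.
rewrite integral_mkcond [RHS]integral_mkcond (ge0_integral_reflect 0); last 2 first.
- apply: (measurable_restrictT (EFin \o K) _).1; first exact: measurable_itv.
  exact: measurable_funTS (measurable_int mu Kint).
- by move=> y; apply: erestrict_ge0 => t _; rewrite lee_fin.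
apply: eq_integral => y _; rewrite !patchE sub0r.
rewrite (_ : (- y \in `[- x, +oo[%classic) = (y \in `]-oo, x]%classic)).
  by case: ifP => //; rewrite /= -Ksym.
by apply/idP/idP; rewrite !inE/= !in_itv/= ?andbT lerN2.
Qed.

Lemma tail_cvg_pinfty : tail K x @[x --> +oo] --> (0 : R).
Proof.
apply/cvg_pinftyP => u uoo.
pose f (n : nat) (y : R) : \bar R := if u n <= y then (K y)%:E else 0%E.
have mf n : measurable_fun setT (f n).
  apply: measurable_fun_ifT; first exact: measurable_fun_ler.
    by apply/measurable_EFinP; exact: measurable_kernel.
  exact: measurable_cst.
have f0 : {ae mu, forall y, [set: R] y -> f n y @[n --> \oo] --> 0%E}.
  apply: aeW => y _; apply: cvg_near_cst; near=> n.
  rewrite /f ifF//; apply/negbTE; rewrite -ltNge.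
  by near: n; move/cvgryPgt: uoo; exact.
have fK : {ae mu, forall y n, [set: R] y -> (`|f n y| <= (K y)%:E)%E}.
  apply: aeW => y n _; rewrite /f; case: ifP => _.
    by rewrite /= ger0_norm.
  by rewrite abse0 lee_fin.
have [_ _] := @dominated_convergence _ _ R mu setT measurableT
  f (fun=> 0%E) (EFin \o K) mf (measurable_cst _) f0 Kint fK.
rewrite integral0 => H.
have -> : (fun n => tail K (u n)) = (fun n => fine (\int[mu]_x f n x)%E).
  apply/funext => n; rewrite /tail /Rintegral integral_mkcond; congr fine.
  apply: eq_integral => y _; rewrite patchE /f.
  rewrite (_ : (y \in `[u n, +oo[%classic) = (u n <= y))//.
  by apply/idP/idP; rewrite inE/= in_itv/= andbT.
exact: fine_cvg H.
Unshelve. all: by end_near. Qed.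

End Tail.

(** * Averages over the delays *)

Lemma continuous_cvg_seq {R : realType} (f : R -> R) (u : R^nat) (a : R) :
  {for a, continuous f} -> u n @[n --> \oo] --> a -> f (u n) @[n --> \oo] --> f a.
Proof. by move=> cf ua; exact: (cvg_comp u f ua cf). Qed.

Section Average.
Context {R : realType}.
Local Notation mu := (@lebesgue_measure R).
Variable G : R -> R.
Hypothesis mG : measurable_fun setT G.
Hypothesis Gle0 : forall r, r <= 0 -> G r = 0.
Hypothesis Ggt0 : forall r, 0 < r -> 0 < G r.
Hypothesis G1 : (\int[mu]_r (G r)%:E = 1)%E.
Implicit Types f h : R -> R.

Definition average f : R := \int[mu]_r (G r * f r).

Lemma density_ge0 r : 0 <= G r.
Proof. by have [r0|r0] := leP r 0; [rewrite Gle0|exact: ltW (Ggt0 r0)]. Qed.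

Lemma density_integrable : mu.-integrable setT (EFin \o G).
Proof.
apply/integrableP; split; first exact/measurable_EFinP.
rewrite (_ : (fun r => `|(EFin \o G) r|%E) = EFin \o G) ?G1 ?ltry//.
by apply/funext => r /=; rewrite ger0_norm// density_ge0.
Qed.

Definition bounded_delay (M : R) f := measurable_fun setT f /\ forall r, 0 < r -> `|f r| <= M.

Let prod_le M f r : bounded_delay M f -> `|G r * f r| <= `|M| * G r.
Proof.
move=> [_ fM]; have [r0|r0] := leP r 0; first by rewrite Gle0// mul0r mulr0 normr0.
rewrite normrM (ger0_norm (density_ge0 r)) mulrC; apply: ler_wpM2r; first exact: density_ge0.
exact: le_trans (fM r r0) (ler_norm _).
Qed.

Lemma average_integrable M f : bounded_delay M f ->
  mu.-integrable setT (fun r => (G r * f r)%:E).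
Proof.
move=> bf; have i := @integrableZl _ _ _ mu setT measurableT (`|M|) _ density_integrable.
apply: (le_integrable measurableT _ _ i).
  by apply/measurable_EFinP; apply: measurable_funM => //; exact: bf.1.
move=> r _ /=; rewrite lee_fin; apply: le_trans (prod_le r bf) _.
exact: ler_norm.
Qed.

Lemma average_integral M f : bounded_delay M f ->
  (\int[mu]_r (G r * f r)%:E = (average f)%:E)%E.
Proof.
move=> bf; rewrite /average /Rintegral fineK//.
exact: integrable_fin_num (average_integrable bf).
Qed.

Lemma eq_average f h : (forall r, 0 < r -> f r = h r) -> average f = average h.
Proof.
move=> fh; apply: eq_Rintegral => r _.
by have [r0|r0] := leP r 0; [rewrite Gle0// !mul0r|rewrite fh].
Qed.

Lemma average_cst (c : R) : average (fun=> c) = c.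
Proof.
apply/EFin_inj; rewrite -(@average_integral `|c|); last first.
  by split => //; exact: measurable_cst.
under eq_integral do rewrite EFinM.
by rewrite (integralZr measurableT density_integrable) /= G1 mul1e.
Qed.

Lemma averageB M N f h : bounded_delay M f -> bounded_delay N h ->
  average (fun r => f r - h r) = average f - average h.
Proof.
move=> bf bh; rewrite /average.
under eq_Rintegral do rewrite mulrBr.
by apply: RintegralB => //; [exact: average_integrable bf|exact: average_integrable bh].
Qed.

Lemma average_le M N f h : bounded_delay M f -> bounded_delay N h ->
  (forall r, 0 < r -> f r <= h r) -> average f <= average h.
Proof.
move=> bf bh fh; apply: le_Rintegral => //; [exact: average_integrable bf|exact: average_integrable bh|].
move=> r _; have [r0|r0] := leP r 0; first by rewrite Gle0// !mul0r.
by apply: ler_wpM2l; [exact: density_ge0|exact: fh].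
Qed.

Lemma average_eq0 M f : bounded_delay M f -> (forall r, 0 < r -> 0 <= f r) ->
  average f = 0 -> {ae mu, forall r, 0 < r -> f r = 0}.
Proof.
move=> bf f0 e.
have E := average_integral bf; rewrite e in E.
have mGf : measurable_fun setT (fun r => (G r * f r)%:E).
  by apply/measurable_EFinP; apply: measurable_funM => //; exact: bf.1.
have [+ _] := ae_eq_integral_abs mu measurableT mGf.
have Ea : (\int[mu]_r `|(G r * f r)%:E| = 0)%E.
  apply: etrans E; apply: eq_integral => r _ /=; congr EFin; apply: ger0_norm.
  have [r0|r0] := leP r 0; first by rewrite Gle0// mul0r.
  by apply: mulr_ge0; [exact: density_ge0|exact: f0].
move=> /(_ Ea)[N [mN N0 sub]]; exists N; split => //.
apply: subset_trans sub => r /=; apply: contra_not => h r0.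
have /eqP := h I; rewrite eqe mulf_eq0 (gt_eqF (Ggt0 r0))/= => /eqP.
by [].
Qed.

Lemma average_lt M N f h : bounded_delay M f -> bounded_delay N h ->
  (forall r, 0 < r -> f r <= h r) ->
  (exists2 d : R, 0 < d & forall r, 0 < r -> r < d -> f r < h r) ->
  average f < average h.
Proof.
move=> bf bh fh [d d0 fhd]; rewrite lt_neqAle (average_le bf bh fh) andbT.
apply/eqP => e.
have bd : bounded_delay (N + M) (fun r => h r - f r).
  split; first by apply: measurable_funB; [exact: bh.1|exact: bf.1].
  by move=> r r0; apply: le_trans (ler_normB _ _) _; apply: lerD; [exact: bh.2|exact: bf.2].
have := average_eq0 bd; rewrite (averageB bh bf) e subrr => /(_ _ erefl).
have h0 r : 0 < r -> 0 <= h r - f r by move=> r0; rewrite subr_ge0 fh.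
move=> /(_ h0)[N' [mN' N0 sub]].
have : (mu `]0%R, d[ <= mu N')%E.
  apply: le_measure; rewrite ?inE//.
  move=> r /=; rewrite in_itv/= => /andP[r0 rd]; apply: sub => /= /(_ r0) /eqP.
  by rewrite subr_eq0 gt_eqF// fhd.
by rewrite [X in (_ <= X)%E]N0 lebesgue_measure_itv/= lte_fin d0 -EFinB lee_fin subr0 leNgt d0.
Qed.

Lemma average_cvg M (f_ : (R -> R)^nat) f : (forall n, bounded_delay M (f_ n)) ->
  measurable_fun setT f ->
  (forall r, 0 < r -> f_ n r @[n --> \oo] --> f r) ->
  average (f_ n) @[n --> \oo] --> average f.
Proof.
move=> bf mf cf.
have i := @integrableZl _ _ _ mu setT measurableT (`|M|) _ density_integrable.
have c : {ae mu, forall r, [set: R] r -> (G r * f_ n r)%:E @[n --> \oo] --> (G r * f r)%:E}.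
  apply: aeW => r _; have [r0|r0] := leP r 0.
    by apply: cvg_near_cst; apply: nearW => n; rewrite Gle0// !mul0r.
  apply: cvg_EFin; first exact: nearW.
  by apply: cvgM; [exact: cvg_cst|exact: cf].
have b : {ae mu, forall r n, [set: R] r -> (`|(G r * f_ n r)%:E| <= `|M|%:E * (EFin \o G) r)%E}.
  by apply: aeW => r n _; rewrite /= lee_fin; exact: prod_le.
have m1 n : measurable_fun setT (fun r => (G r * f_ n r)%:E).
  by apply/measurable_EFinP; apply: measurable_funM => //; exact: (bf n).1.
have m2 : measurable_fun setT (fun r => (G r * f r)%:E).
  by apply/measurable_EFinP; exact: measurable_funM.
have [fi _ L] := @dominated_convergence _ _ R mu setT measurableT _ _ _ m1 m2 c i b.
apply: fine_cvg; move: L; rewrite /average /Rintegral fineK//.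
exact: integrable_fin_num fi.
Qed.

End Average.

(** * The profiles and the speed *)

Section Profile.
Context {R : realType}.
Local Notation mu := (@lebesgue_measure R).
Variables (alpha : R) (K : R -> R).
Hypothesis alpha01 : 0 < alpha < 1.
Hypothesis Kint : mu.-integrable setT (EFin \o K).
Hypothesis Kbnd : exists M : R, forall x, `|K x| <= M.
Hypothesis Kcont : continuous K.
Hypothesis Kge0 : forall x, 0 <= K x.
Hypothesis K0 : 0 < K 0.
Hypothesis Ksym : forall x, K x = K (- x).
Implicit Types (c z r : R).

Let alpha_gt0 : 0 < alpha. Proof. by case/andP: alpha01. Qed.

Let G := ml_kernel alpha alpha.
Let mG : measurable_fun setT G. Proof. exact: measurable_ml_kernel. Qed.
Let Gle0 r : r <= 0 -> G r = 0. Proof. exact: ml_kernel_le0. Qed.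
Let Ggt0 r : 0 < r -> 0 < G r. Proof. exact: ml_kernel_gt0. Qed.
Let G1 : (\int[mu]_r (G r)%:E = 1)%E. Proof. exact: ml_kernel_mass. Qed.

Lemma measurable_delay f z c : measurable_fun setT f ->
  measurable_fun setT (fun r : R => f (z + c * r) : R).
Proof.
move=> mf; apply: (measurableT_comp mf).
by apply: measurable_funD => //; exact: measurable_funM.
Qed.

Lemma tail_delay z c : bounded_delay (kappa K) (fun r => tail K (z + c * r)).
Proof.
split; first by apply: measurable_delay; apply: continuous_measurable_fun; exact: tail_continuous.
by move=> r _; rewrite ger0_norm; [exact: tail_le_kappa|exact: tail_ge0].
Qed.

Lemma profileE c z : profile alpha K c z = average G (fun r => tail K (z + c * r)).
Proof.
rewrite /profile /average Rintegral_mkcond; apply: eq_Rintegral => r _.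
rewrite patchE; case: ifPn => [|/negP]; rewrite inE/= in_itv/= andbT => r0.
  by rewrite gE.
by rewrite Gle0 ?mul0r// leNgt; apply/negP.
Qed.

Lemma speed_equationE uT c : speed_equation alpha K uT c <-> uT = profile alpha K c 0.
Proof.
by rewrite /speed_equation /profile; under [in X in _ <-> X]eq_Rintegral do rewrite add0r.
Qed.

Lemma profile_nonincreasing c x y : x <= y -> profile alpha K c y <= profile alpha K c x.
Proof.
move=> xy; rewrite !profileE; apply: (average_le mG Gle0 Ggt0 G1 (tail_delay y c) (tail_delay x c)).
by move=> r _; apply: tail_nonincreasing => //; rewrite lerD2r.
Qed.

(** The evenness of K makes tail K (- x) = kappa - tail K x, and g has mass 1. *)
Lemma profile_opp c z : profile alpha K (- c) (- z) = kappa K - profile alpha K c z.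
Proof.
have bk : bounded_delay (kappa K) (fun=> kappa K).
  by split; [exact: measurable_cst|move=> r _; rewrite ger0_norm// kappa_ge0].
rewrite !profileE -{1}(average_cst mG Gle0 Ggt0 G1 (kappa K)).
rewrite -(averageB mG Gle0 Ggt0 G1 bk (tail_delay z c)).
apply: eq_average => // r _.
by rewrite mulNr -opprD tail_opp.
Qed.

Lemma profile0_opp c : profile alpha K (- c) 0 = kappa K - profile alpha K c 0.
Proof. by rewrite -profile_opp oppr0. Qed.

Let average_tail_cvg (u v : R^nat) (f : R -> R) :
  measurable_fun setT f ->
  (forall r, 0 < r -> tail K (u n + v n * r) @[n --> \oo] --> f r) ->
  profile alpha K (v n) (u n) @[n --> \oo] --> average G f.
Proof.
move=> mf cf; under eq_fun do rewrite profileE.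
by apply: (average_cvg mG Gle0 Ggt0 G1 (M := kappa K)) => // n; exact: tail_delay.
Qed.

Lemma profile_cvg_pinfty c : profile alpha K c z @[z --> +oo] --> (0 : R).
Proof.
apply/cvg_pinftyP => u uoo.
suff : profile alpha K c (u n) @[n --> \oo] --> average G (fun=> 0).
  by rewrite (average_cst mG Gle0 Ggt0 G1).
apply: (@average_tail_cvg u (fun=> c) (fun=> 0)); first exact: measurable_cst.
move=> r r0; have /cvg_pinftyP := tail_cvg_pinfty Kint Kcont Kge0; apply.
apply/cvgryPge => A; near=> n; rewrite -lerBlDr; near: n.
by move/cvgryPge : uoo; apply.
Unshelve. all: by end_near. Qed.

Lemma profile_cvg_ninfty c : profile alpha K c z @[z --> -oo] --> kappa K.
Proof.
rewrite cvgNy_compNP.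
rewrite (_ : _ \o -%R = fun z => kappa K - profile alpha K (- c) z); last first.
  by apply/funext => z /=; rewrite -[in LHS](opprK c) profile_opp.
have : kappa K - profile alpha K (- c) z @[z --> +oo] --> kappa K - 0.
  by apply: cvgB; [exact: cvg_cst|exact: profile_cvg_pinfty].
by rewrite subr0.
Qed.

(** Strictness comes from the delays r near 0, where c * r lies in the
    neighbourhood of 0 on which tail K decreases strictly. *)
Lemma profile_lt c z : 0 < z -> profile alpha K c z < profile alpha K c 0.
Proof.
move=> z0; rewrite !profileE.
have [d d0 Hd] := tail_lt Kint Kcont Kge0 K0.
apply: (average_lt mG Gle0 Ggt0 G1 (tail_delay z c) (tail_delay 0 c)).
  by move=> r _; apply: tail_nonincreasing => //; rewrite lerD2r ltW.
have c1 : 0 < `|c| + 1 by rewrite ltr_wpDl.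
exists (d / (`|c| + 1)); first by rewrite divr_gt0.
move=> r r0; rewrite ltr_pdivlMr// => rd.
have : `|c * r| < d.
  rewrite normrM (gtr0_norm r0) mulrC; apply: le_lt_trans rd.
  by rewrite ler_pM2l// lerDl.
rewrite ltr_norml => /andP[h1 h2].
apply: Hd; rewrite ?add0r ?ltrDr//.
by apply: (lt_trans h1); rewrite ltrDr.
Qed.

Lemma profile_gt c z : z < 0 -> profile alpha K c 0 < profile alpha K c z.
Proof.
rewrite -oppr_gt0 => /(profile_lt (- c)).
by rewrite profile0_opp profile_opp ltrD2l ltrN2.
Qed.

Lemma profile0_lt c c' : c < c' -> profile alpha K c' 0 < profile alpha K c 0.
Proof.
move=> cc; rewrite !profileE.
have [d d0 Hd] := tail_lt Kint Kcont Kge0 K0.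
apply: (average_lt mG Gle0 Ggt0 G1 (tail_delay 0 c') (tail_delay 0 c)).
  by move=> r r0; apply: tail_nonincreasing => //; rewrite lerD2l ler_pM2r// ltW.
have c1 : 0 < `|c| + `|c'| + 1 by rewrite ltr_wpDl// addr_ge0.
exists (d / (`|c| + `|c'| + 1)); first by rewrite divr_gt0.
move=> r r0; rewrite ltr_pdivlMr// => rd.
have h b : `|b| <= `|c| + `|c'| + 1 -> `|b * r| < d.
  move=> bl; rewrite normrM (gtr0_norm r0) mulrC; apply: le_lt_trans rd.
  by rewrite ler_pM2l.
have /h : `|c| <= `|c| + `|c'| + 1 by rewrite -addrA lerDl addr_ge0.
have /h : `|c'| <= `|c| + `|c'| + 1 by rewrite addrAC lerDr addr_ge0.
rewrite !ltr_norml => /andP[h1 _] /andP[_ h2].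
by apply: Hd; rewrite !add0r// ltr_pM2r.
Qed.

Lemma profile0_continuous : continuous (fun c => profile alpha K c 0).
Proof.
move=> c; apply/(@cvg_nbhsP _ R^o) => w wc.
rewrite profileE; apply: (@average_tail_cvg (fun=> 0)); first exact: (tail_delay 0 c).1.
move=> r r0.
have h : 0 + w n * r @[n --> \oo] --> 0 + c * r.
  by apply: cvgD; [exact: cvg_cst|apply: cvgM => //; exact: cvg_cst].
by apply: continuous_cvg_seq h; exact: tail_continuous.
Qed.

Lemma profile0_cvg_pinfty : profile alpha K c 0 @[c --> +oo] --> (0 : R).
Proof.
apply/cvg_pinftyP => u uoo.
suff : profile alpha K (u n) 0 @[n --> \oo] --> average G (fun=> 0).
  by rewrite (average_cst mG Gle0 Ggt0 G1).
apply: (@average_tail_cvg (fun=> 0) u (fun=> 0)); first exact: measurable_cst.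
move=> r r0; have /cvg_pinftyP := tail_cvg_pinfty Kint Kcont Kge0; apply.
apply/cvgryPge => A; near=> n; rewrite add0r -ler_pdivrMr//; near: n.
by move/cvgryPge : uoo; apply.
Unshelve. all: by end_near. Qed.

(** Intermediate values: the average at c tends to 0 as c grows, and by
    reflection to kappa as c tends to minus infinity. *)
Lemma speed_exists uT : 0 < uT < kappa K -> exists c, uT = profile alpha K c 0.
Proof.
move=> /andP[u0 uk].
have small (e : R) : 0 < e -> exists2 c, 0 <= c & profile alpha K c 0 < e.
  move=> e0; have := cvgr_lt _ profile0_cvg_pinfty _ e0.
  move=> [B [_ HB]]; exists (Num.max 0 (B + 1)); first by rewrite le_max lexx.
  by apply: HB; rewrite /= lt_max ltrDl ltr01 orbT.
have [c1 c10 h1] := small _ u0.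
have [c2 c20 h2] : exists2 c, 0 <= c & profile alpha K c 0 < kappa K - uT.
  by apply: small; rewrite subr_gt0.
have h3 : uT < profile alpha K (- c2) 0.
  by rewrite profile0_opp ltrBrDr addrC -ltrBrDr.
have cc : - c2 <= c1 by apply: le_trans c10; rewrite oppr_le0.
have := @IVT R (fun c => profile alpha K c 0) (- c2) c1 uT cc.
case.
- by apply: continuous_subspaceT; exact: profile0_continuous.
- apply/andP; split; first by rewrite ge_min; apply/orP; right; exact: ltW h1.
  by rewrite le_max; apply/orP; left; exact: ltW h3.
by move=> c _ e; exists c.
Qed.

Lemma speed_unique c c' : profile alpha K c 0 = profile alpha K c' 0 -> c = c'.
Proof.
move=> e; case: (ltgtP c c') => [h|h|->//]; have := profile0_lt h.
  by rewrite e ltxx.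
by rewrite -e ltxx.
Qed.

Lemma profile0 z : profile alpha K 0 z = tail K z.
Proof.
rewrite profileE -[RHS](average_cst mG Gle0 Ggt0 G1); apply: eq_average => // r _.
by rewrite mul0r addr0.
Qed.

(** At c = 0 the profile is tail K, which is kappa / 2 at the origin; hence c = 0
    is the speed of the threshold kappa / 2 alone. *)
Lemma profile00 : 2 * profile alpha K 0 0 = kappa K.
Proof.
have := profile_opp 0 0; rewrite oppr0 => e.
by rewrite mulr_natl mulr2n {1}e subrK.
Qed.

Let dprofile c z : R := - average G (fun r => K (z + c * r)).

Lemma kernel_delay M z c : (forall x, `|K x| <= M) -> bounded_delay M (fun r => K (z + c * r)).
Proof.
move=> KM; split; last by move=> r _; exact: KM.
by apply: measurable_delay; exact: continuous_measurable_fun.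
Qed.

Lemma dprofile_continuous c : continuous (dprofile c).
Proof.
have [M KM] := Kbnd.
move=> z; apply: cvgN; apply/(@cvg_nbhsP _ R^o) => w wz.
apply: (average_cvg mG Gle0 Ggt0 G1 (M := M)).
- by move=> n; exact: kernel_delay.
- exact: (kernel_delay z c KM).1.
move=> r r0.
have h : w n + c * r @[n --> \oo] --> z + c * r by apply: cvgD => //; exact: cvg_cst.
by apply: continuous_cvg_seq h; exact: Kcont.
Qed.

Lemma is_derive_profile c z : is_derive z 1 (profile alpha K c) (dprofile c z).
Proof.
have [M KM] := Kbnd.
rewrite (_ : profile alpha K c = fun z => \int[mu]_r (G r * tail K (z + c * r))); last first.
  by apply/funext => x; exact: profileE.
have dt r (x : R) : is_derive x 1 (fun x : R => G r * tail K (x + c * r)) (G r * - K (x + c * r)).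
  have h1 := is_derive_tail Kint Kcont (x + c * r).
  have h2 : is_derive x 1 (fun x : R => x + c * r) 1.
    by have := is_deriveD (is_derive_id (x : R^o) 1) (is_derive_cst (c * r : R^o) (x : R^o) 1); rewrite addr0.
  have h3 := @is_derive1_comp _ (tail K) (fun x => x + c * r) _ _ _ h1 h2.
  have := is_deriveZ (G r) h3.
  by rewrite mulr1.
have d1 r x : partial1of2 (fun x r : R => G r * tail K (x + c * r)) x r = - (G r * K (x + c * r)).
  by rewrite partial1of2E; have [_ ->] := dt r x; rewrite mulrN.
have zI : `]z - 1, z + 1[%classic z by rewrite /= in_itv/= ltrBlDr ltrDl ltr01.
have i1 x : `]z - 1, z + 1[%classic x -> mu.-integrable setT (EFin \o (fun r => G r * tail K (x + c * r))).
  by move=> _; exact: (average_integrable mG Gle0 Ggt0 G1 (tail_delay x c)).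
have i2 : mu.-integrable setT (EFin \o (fun r => `|M| * G r)).
  exact: (@integrableZl _ _ _ mu setT measurableT (`|M|) _ (density_integrable mG Gle0 Ggt0 G1)).
have G0 r : 0 <= G r by exact: (density_ge0 Gle0 Ggt0).
have b0 r : 0 <= `|M| * G r by rewrite mulr_ge0.
have ub x r : `]z - 1, z + 1[%classic x -> setT r ->
    `|partial1of2 (fun x r : R => G r * tail K (x + c * r)) x r| <= `|M| * G r.
  move=> _ _; rewrite d1 normrN normrM (ger0_norm (G0 r)) mulrC.
  by apply: ler_wpM2r => //; exact: le_trans (KM _) (ler_norm _).
have de x r : `]z - 1, z + 1[%classic x -> setT r ->
    derivable (fun x : R => G r * tail K (x + c * r)) x 1.
  by move=> _ _; have [] := dt r x.
split.
  exact: (@derivable_under_integral R _ _ mu (fun x r : R => G r * tail K (x + c * r))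
    setT measurableT z (z - 1) (z + 1) zI i1 de (fun r => `|M| * G r) b0 i2 ub).
rewrite -derive1E.
rewrite (@differentiation_under_integral R _ _ mu (fun x r : R => G r * tail K (x + c * r))
    setT measurableT z (z - 1) (z + 1) zI i1 de (fun r => `|M| * G r) b0 i2 ub).
under eq_Rintegral do rewrite d1 -mulN1r.
rewrite (RintegralZl _ measurableT (average_integrable mG Gle0 Ggt0 G1 (kernel_delay z c KM))).
by rewrite mulN1r.
Qed.

Lemma derive1_profile c : derive1 (profile alpha K c) = dprofile c.
Proof.
by apply/funext => z; rewrite derive1E; have [_ ->] := is_derive_profile c z.
Qed.

Lemma profile_BC1 c : BC1 (profile alpha K c).
Proof.
have [M KM] := Kbnd.
split.
- by move=> z; have [] := is_derive_profile c z.
- by rewrite derive1_profile; exact: dprofile_continuous.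
- exists (kappa K) => z.
  have bk d : `|d| <= kappa K -> bounded_delay (kappa K) (fun=> d).
    by move=> dk; split => //; exact: measurable_cst.
  have k0 := kappa_ge0 Kge0.
  rewrite ger0_norm profileE.
    rewrite -[leRHS](average_cst mG Gle0 Ggt0 G1).
    apply: (average_le mG Gle0 Ggt0 G1 (tail_delay z c) (bk (kappa K) _)).
      by rewrite ger0_norm.
    by move=> r _; exact: tail_le_kappa.
  rewrite -[leLHS](average_cst mG Gle0 Ggt0 G1).
  apply: (average_le mG Gle0 Ggt0 G1 (bk 0 _) (tail_delay z c)).
    by rewrite normr0.
  by move=> r _; exact: tail_ge0.
- exists M => z; rewrite derive1_profile normrN.
  have M0 : 0 <= M by exact: le_trans (normr_ge0 _) (KM 0).
  have bk d : `|d| <= M -> bounded_delay M (fun=> d).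
    by move=> dk; split => //; exact: measurable_cst.
  rewrite ger0_norm.
    rewrite -[leRHS](average_cst mG Gle0 Ggt0 G1).
    apply: (average_le mG Gle0 Ggt0 G1 (kernel_delay z c KM) (bk M _)).
      by rewrite ger0_norm.
    by move=> r _; exact: le_trans (ler_norm _) (KM _).
  rewrite -[leLHS](average_cst mG Gle0 Ggt0 G1).
  apply: (average_le mG Gle0 Ggt0 G1 (bk 0 _) (kernel_delay z c KM)) => //.
  by rewrite normr0.
Qed.

End Profile.

(** * Firing patterns and their input *)

Section Firing.
Context {R : realType}.
Local Notation mu := (@lebesgue_measure R).
Variable K : R -> R.
Hypothesis Kint : mu.-integrable setT (EFin \o K).
Hypothesis Kcont : continuous K.
Hypothesis Kge0 : forall x, 0 <= K x.
Implicit Types (w : R -> R) (x y z : R).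

(** The nonlocal term of the wave equation, as a function of the firing pattern
    w = H (phi - u_T): the equation sees phi only through w, and w can be
    compared with step functions. *)
Definition input w z : R := \int[mu]_y (K (z - y) * w y).

Definition firing w := measurable_fun setT w /\ forall y, 0 <= w y <= 1.

Let measurable_shifted z : measurable_fun setT (fun y : R => K (z - y)).
Proof.
apply: measurableT_comp; first exact: continuous_measurable_fun.
exact: measurable_funB.
Qed.

Lemma shifted_kernel_integral z : (\int[mu]_y (K (z - y))%:E = (kappa K)%:E)%E.
Proof.
rewrite -(kappa_integral Kint); apply/esym; apply: (@ge0_integral_reflect R z (EFin \o K)).
  exact: measurable_int Kint.
by move=> x; rewrite lee_fin.
Qed.

Lemma shifted_kernel_integrable z : mu.-integrable setT (fun y => (K (z - y))%:E).
Proof.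
apply/integrableP; split; first by apply/measurable_EFinP; exact: measurable_shifted.
rewrite (_ : (fun y => `|(K (z - y))%:E|%E) = (fun y => (K (z - y))%:E)).
  by rewrite shifted_kernel_integral ltry.
by apply/funext => y /=; rewrite ger0_norm.
Qed.

Lemma input_integrable w z : firing w -> mu.-integrable setT (fun y => (K (z - y) * w y)%:E).
Proof.
move=> [mw w01]; apply: (le_integrable measurableT _ _ (shifted_kernel_integrable z)).
  by apply/measurable_EFinP; exact: measurable_funM (measurable_shifted z) mw.
move=> y _ /=; rewrite lee_fin; have /andP[w0 w1] := w01 y.
by rewrite normrM (ger0_norm w0) ler_piMr.
Qed.

Lemma input_integral w z : firing w ->
  (\int[mu]_y (K (z - y) * w y)%:E = (input w z)%:E)%E.
Proof.
by move=> fw; rewrite /input /Rintegral fineK//; exact: integrable_fin_num (input_integrable z fw).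
Qed.

Lemma input_le w w' z : firing w -> firing w' -> (forall y, w y <= w' y) ->
  input w z <= input w' z.
Proof.
move=> fw fw' ww; apply: le_Rintegral; first exact: measurableT.
- exact: input_integrable.
- exact: input_integrable.
- by move=> y _; apply: ler_wpM2l.
Qed.

Lemma input_ge0 w z : firing w -> 0 <= input w z.
Proof.
move=> [_ fw]; apply: Rintegral_ge0 => y _; apply: mulr_ge0 => //.
by case/andP: (fw y).
Qed.

Lemma firingN w : firing w -> firing (fun y => 1 - w y).
Proof.
move=> [mw w01]; split; first exact: measurable_funB.
by move=> y; have /andP[w0 w1] := w01 y; rewrite subr_ge0 w1 gerBl.
Qed.

Lemma inputN w z : firing w -> input (fun y => 1 - w y) z = kappa K - input w z.
Proof.
move=> fw; apply/EFin_inj; rewrite EFinB -(input_integral z fw) -(shifted_kernel_integral z).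
rewrite -(input_integral z (firingN fw)) -integralB//; first last.
- exact: input_integrable.
- exact: shifted_kernel_integrable.
by apply: eq_integral => y _ /=; rewrite -EFinB mulrBr mulr1.
Qed.

Lemma input_le_kappa w z : firing w -> input w z <= kappa K.
Proof.
move=> fw; have := input_ge0 z (firingN fw).
by rewrite (inputN z fw) subr_ge0.
Qed.

Lemma measurable_input w : firing w -> measurable_fun setT (input w).
Proof.
move=> fw.
have mF : measurable_fun setT (fun p : R * R => (K (p.1 - p.2) * w p.2)%:E).
  apply/measurable_EFinP; apply: measurable_funM.
    apply: measurableT_comp; first exact: continuous_measurable_fun.
    exact: measurable_funB.
  by apply: measurableT_comp measurable_snd; exact: fw.1.
have F0 p : (0 <= (fun p : R * R => (K (p.1 - p.2) * w p.2)%:E) p)%E.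
  by rewrite lee_fin; apply: mulr_ge0 => //; case/andP: (fw.2 p.2).
have := measurable_fun_fubini_tonelli_F (m2 := mu) _ mF F0.
rewrite /fubini_F /=.
rewrite (_ : (fun x => _) = EFin \o input w).
  by move=> /measurable_EFinP.
by apply/funext => x; exact: (input_integral x fw).
Qed.

Definition step (b : R) y : R := if y < b then 1 else 0.

Lemma firing_step b : firing (step b).
Proof.
split; last by move=> y; rewrite /step; case: ifP; rewrite lexx ler01.
by apply: measurable_fun_ifT => //; exact: measurable_fun_ltr.
Qed.

Lemma input_step b z : input (step b) z = tail K (z - b).
Proof.
rewrite /input /tail /Rintegral; congr fine.
rewrite -integral_itv_obnd_cbnd; last first.
  exact: measurable_funTS (measurable_int mu Kint).
rewrite [RHS]integral_mkcond (ge0_integral_reflect z); last 2 first.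
- apply/measurable_EFinP; apply: measurable_funM (measurable_shifted z) _.
  exact: (firing_step b).1.
- by move=> y; rewrite lee_fin; apply: mulr_ge0 => //; case/andP: ((firing_step b).2 y).
apply: eq_integral => y _; rewrite patchE subKr /step ltrBlDr -ltrBlDl.
rewrite (_ : (y \in `]z - b, +oo[%classic) = (z - b < y)).
  by case: ifP => _; rewrite ?mulr1 ?mulr0.
by apply/idP/idP; rewrite inE/= in_itv/= andbT.
Qed.

Lemma input_ae w w' z : firing w -> firing w' -> {ae mu, forall y, w y = w' y} ->
  input w z = input w' z.
Proof.
move=> fw fw' [N [mN N0 sub]]; rewrite /input /Rintegral; congr fine.
apply: ae_eq_integral => //.
- exact: measurable_int (input_integrable z fw).
- exact: measurable_int (input_integrable z fw').
- exists N; split => //; apply: subset_trans sub => y /=; apply: contra_not => e _.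
  by rewrite e.
Qed.

(** A sharp front meets the threshold at one point only, so its pattern is
    almost everywhere a step. *)
Lemma input_sharp w b z : firing w -> (forall y, y < b -> w y = 1) ->
  (forall y, b < y -> w y = 0) -> input w z = tail K (z - b).
Proof.
move=> fw w1 w0; rewrite -input_step; apply: input_ae => //; first exact: firing_step.
have [N [mN N0 sub]] := ae_ne b; exists N; split => //.
apply: subset_trans sub => y /=; apply: contra_not => yb.
by rewrite /step; case: ltgtP yb => // yb _; [exact: w1|exact: w0].
Qed.

Lemma Heaviside01 (h v : R) : 0 <= h <= 1 -> 0 <= Heaviside h v <= 1.
Proof.
move=> h01; rewrite /Heaviside; case: ifP => _; first by rewrite ler01 lexx.
by case: ifP => _ //; rewrite lexx ler01.
Qed.

Lemma Heaviside_gt0 (h v : R) : 0 < v -> Heaviside h v = 1.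
Proof. by rewrite /Heaviside => ->. Qed.

Lemma Heaviside_lt0 (h v : R) : v < 0 -> Heaviside h v = 0.
Proof. by rewrite /Heaviside ltNge => /negbTE h0; rewrite lt_neqAle; case: ltgtP h0. Qed.

Lemma HeavisideN (h v : R) : Heaviside (1 - h) (- v) = 1 - Heaviside h v.
Proof. by rewrite /Heaviside oppr_gt0 oppr_lt0; case: ltgtP; rewrite ?subrr ?subr0. Qed.

Lemma firing_Heaviside (h uT : R) (psi : R -> R) : 0 <= h <= 1 -> continuous psi ->
  firing (fun y => Heaviside h (psi y - uT)).
Proof.
move=> h01 cpsi; split; last by move=> y; exact: Heaviside01.
have mp : measurable_fun setT (fun y => psi y - uT).
  by apply: measurable_funB => //; exact: continuous_measurable_fun.
apply: measurable_fun_ifT; [exact: measurable_fun_ltr|exact: measurable_cst|].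
by apply: measurable_fun_ifT; [exact: measurable_fun_ltr|exact: measurable_cst|exact: measurable_cst].
Qed.

Lemma BC1_continuous (psi : R -> R) : BC1 psi -> continuous psi.
Proof.
by move=> [d _ _ _] x; apply: differentiable_continuous; apply/derivable1_diffP; exact: d.
Qed.

Hypothesis Ksym : forall x, K x = K (- x).

Lemma input_reflect w z : firing w -> input (w \o -%R) z = input w (- z).
Proof.
move=> fw; rewrite /input /Rintegral; congr fine.
rewrite (ge0_integral_reflect 0).
- by apply: eq_integral => y _ /=; rewrite sub0r !opprK -[in RHS]opprD -Ksym.
- apply/measurable_EFinP; apply: measurable_funM (measurable_shifted z) _.
  by apply: measurableT_comp => //; exact: fw.1.
- by move=> y; rewrite lee_fin; apply: mulr_ge0 => //=; case/andP: (fw.2 (- y)).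
Qed.

(** The equation is invariant under the exchange of the excited and the resting
    state together with a change of direction, because K is even and
    1 - H (v) = H (- v).  The value of H at 0 becomes 1 - h. *)
Lemma traveling_wave_reflect (alpha uT h c : R) (psi : R -> R) : 0 <= h <= 1 ->
  asymptotic_traveling_wave alpha K uT h c psi ->
  asymptotic_traveling_wave alpha K (kappa K - uT) (1 - h) (- c) (fun z => kappa K - psi (- z)).
Proof.
move=> h01 [bc eq].
have cpsi := BC1_continuous bc.
have [dpsi cdpsi [M HM] [M' HM']] := bc.
have d1 z : is_derive z 1 (fun z : R => kappa K - psi (- z)) (derive1 psi (- z)).
  have h1 : is_derive (- z) 1 psi (derive1 psi (- z)).
    by rewrite derive1E; split; first exact: dpsi.
  have h2 := @is_derive1_comp _ psi -%R z _ _ h1 (is_deriveNid z 1).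
  have := is_deriveB (is_derive_cst (kappa K : R^o) (z : R^o) 1) h2.
  by rewrite mulrN1 sub0r opprK.
have D : derive1 (fun z : R => kappa K - psi (- z)) = (fun z => derive1 psi (- z)).
  by apply/funext => z; rewrite derive1E; have [_ ->] := d1 z.
split.
  split.
  - by move=> z; have [] := d1 z.
  - rewrite D => z; apply: (@continuous_comp _ _ _ -%R (derive1 psi)); first exact: opp_continuous.
    exact: cdpsi.
  - exists (`|kappa K| + M) => z; apply: le_trans (ler_normB _ _) _.
    by rewrite lerD2l.
  - by exists M' => z; rewrite D.
move=> z.
have [[e1 e2] E] := eq (- z); split.
  rewrite /frac_deriv_exists D; split; rewrite ?oppr_gt0 ?oppr_lt0 => c0.
  - have := e2 c0; congr (improper_cvg _).
    by apply/funext => s; rewrite opprD.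
  - have := e1 c0; congr (improper_cvg _).
    by apply/funext => s; rewrite opprB addrC.
transitivity (- frac_deriv alpha c psi (- z)).
  rewrite /frac_deriv D oppr_gt0 oppr_lt0 normrN.
  case: (ltgtP c 0) => c0.
  - rewrite (ltr0_norm c0) mulNr; congr (- (_ * improper_integral _)).
    by apply/funext => s; rewrite opprD.
  - rewrite (gtr0_norm c0) -mulNr opprK; congr (_ * improper_integral _).
    by apply/funext => s; rewrite opprB addrC.
  - by rewrite oppr0.
rewrite E -/(input _ _).
have fw := firing_Heaviside uT h01 cpsi.
rewrite -(input_reflect z fw) /=.
have -> : (\int[mu]_y (K (z - y) * Heaviside (1 - h) (kappa K - psi (- y) - (kappa K - uT))))
    = input (fun y => 1 - Heaviside h (psi (- y) - uT)) z.
  apply: eq_Rintegral => y _; congr (_ * _); rewrite -HeavisideN; congr Heaviside.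
  by ring.
have fw' : firing ((fun y => Heaviside h (psi y - uT)) \o -%R).
  by split; [apply: measurableT_comp => //; exact: fw.1|move=> y; exact: fw.2].
rewrite (inputN z fw') /comp; set a := input _ _.
by ring.
Qed.

End Firing.

(** * The profile solves the equation *)

Section Existence.
Context {R : realType}.
Local Notation mu := (@lebesgue_measure R).

(** For an absolutely convergent integral the improper one agrees with
    Lebesgue's. *)
Lemma improper_integral_cvg (f : R -> R) : mu.-integrable `]0, +oo[ (EFin \o f) ->
  (\int[mu]_(s in `]0, b]) f s) @[b --> +oo] --> \int[mu]_(s in `]0, +oo[) f s.
Proof.
move=> fi; apply/cvg_pinftyP => u uoo.
pose D : set R := `]0, +oo[%classic.
pose f_ (n : nat) (s : R) : \bar R := if s <= u n then (f s)%:E else 0%E.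
have mf : measurable_fun D (EFin \o f) by exact: measurable_int fi.
have m1 n : measurable_fun D (f_ n).
  apply: measurable_fun_if => //.
  - exact: measurable_itv.
  - exact: measurable_fun_ler.
  - by apply: measurable_funS mf; [exact: measurable_itv|exact: subIsetl].
have c : {ae mu, forall s, D s -> f_ n s @[n --> \oo] --> (EFin \o f) s}.
  apply: aeW => s _; apply: cvg_near_cst; near=> n.
  rewrite /f_ ifT//; near: n.
  by move/cvgryPge : uoo; exact.
have b : {ae mu, forall s n, D s -> (`|f_ n s| <= (abse \o (EFin \o f)) s)%E}.
  by apply: aeW => s n _; rewrite /f_; case: ifP => _ //=; rewrite normr0 lee_fin.
have [_ _ L] := @dominated_convergence _ _ R mu D (measurable_itv _) f_ (EFin \o f)
  (abse \o (EFin \o f)) m1 mf c (integrable_abse fi) b.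
rewrite /Rintegral.
have E n : (\int[mu]_(s in D) f_ n s = \int[mu]_(s in `]0%R, u n]) (f s)%:E)%E.
  rewrite integral_mkcond [RHS]integral_mkcond; apply: eq_integral => s _.
  rewrite !patchE.
  rewrite (_ : (s \in D) = (0 < s)); last first.
    by apply/idP/idP; rewrite inE /D/= in_itv/= andbT.
  rewrite (_ : (s \in `]0, u n]%classic) = (0 < s) && (s <= u n)); last first.
    by apply/idP/idP; rewrite inE/= in_itv/=.
  by rewrite /f_; case: ifP.
apply: fine_cvg.
rewrite fineK; last exact: integrable_fin_num fi.
by move: L; under eq_fun do rewrite E.
Unshelve. all: by end_near. Qed.

Variables (alpha : R) (K : R -> R).
Hypothesis alpha01 : 0 < alpha < 1.
Let alpha_gt0 : 0 < alpha. Proof. by case/andP: alpha01. Qed.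
Let alpha1_gt0 : 0 < 1 - alpha. Proof. by rewrite subr_gt0; case/andP: alpha01. Qed.
Let G := ml_kernel alpha alpha.
Let mG : measurable_fun setT G. Proof. exact: measurable_ml_kernel. Qed.
Let G0 r : 0 <= G r. Proof. exact: ml_kernel_ge0. Qed.
Let Gle0 r : r <= 0 -> G r = 0. Proof. exact: ml_kernel_le0. Qed.
Let Ggt0 r : 0 < r -> 0 < G r. Proof. exact: ml_kernel_gt0. Qed.
Let G1 : (\int[mu]_r (G r)%:E = 1)%E. Proof. exact: ml_kernel_mass. Qed.

Lemma relaxation_convolution t : convolution G (rl_kernel (1 - alpha)) t = (ml_kernel alpha 1 t)%:E.
Proof.
have [_] := ml_kernel_convolution alpha_gt0 t alpha_gt0 alpha1_gt0.
by have -> : alpha + (1 - alpha) = 1 by rewrite addrC subrK.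
Qed.

(** The relaxation equation, integrated against an arbitrary future chi:
    (1 - alpha)-fractional integration of g and the distribution function of g
    add up to 1. *)
Lemma caputo_balance (chi : R -> R) : measurable_fun setT chi -> (forall t, 0 <= chi t) ->
  (\int[mu]_s ((rl_kernel (1 - alpha) s)%:E * \int[mu]_r (G r * chi (s + r)%R)%:E) +
   \int[mu]_r ((G r)%:E * \int[mu]_s (rl_kernel 1 s * chi (r + s)%R)%:E) =
   \int[mu]_t (chi t * rl_kernel 1 t)%:E)%E.
Proof.
move=> mchi chi0.
have mq := @measurable_rl_kernel R (1 - alpha).
have m1 := @measurable_rl_kernel R 1.
have q0 s : 0 <= rl_kernel (1 - alpha) s by exact: rl_kernel_ge0.
have j0 s : 0 <= rl_kernel 1 s :> R by exact: rl_kernel_ge0 ltr01.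
rewrite (tonelli_convolution mq mG mchi q0 G0 chi0) (tonelli_convolution mG m1 mchi G0 j0 chi0).
have e1 t : (\int[mu]_r (rl_kernel (1 - alpha) r * G (t - r)%R)%:E = (ml_kernel alpha 1 t)%:E)%E.
  by rewrite -relaxation_convolution -(convolutionC t mq mG q0 G0).
have e2 t : (\int[mu]_r (G r * rl_kernel 1 (t - r)%R)%:E = (rl_kernel 1 t - ml_kernel alpha 1 t)%:E)%E.
  exact: ml_kernel_cdf.
have l0 t : 0 <= rl_kernel 1 t - ml_kernel alpha 1 t.
  by rewrite -lee_fin -e2; apply: integral_ge0 => r _; rewrite lee_fin; exact: mulr_ge0.
under eq_integral => t _ do rewrite e1.
under [X in (_ + X)%E]eq_integral => t _ do rewrite e2.
have mm : measurable_fun setT (ml_kernel alpha 1) by exact: measurable_ml_kernel.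
rewrite -ge0_integralD//.
- by apply: eq_integral => t _; rewrite -!EFinM -EFinD -mulrDr addrC subrK.
- by move=> t _; rewrite -EFinM lee_fin; apply: mulr_ge0; [exact: chi0|exact: relaxation_ge0].
- by apply/measurable_EFinP; exact: measurable_funM.
- by move=> t _; rewrite -EFinM lee_fin; apply: mulr_ge0; [exact: chi0|exact: l0].
- by apply/measurable_EFinP; apply: measurable_funM => //; exact: measurable_funB.
Qed.

Hypothesis Kint : mu.-integrable setT (EFin \o K).
Hypothesis Kbnd : exists M : R, forall x, `|K x| <= M.
Hypothesis Kcont : continuous K.
Hypothesis Kge0 : forall x, 0 <= K x.

Lemma ray_integral (c z : R) : 0 < c ->
  (\int[mu]_s (rl_kernel 1 s * K (z + c * s))%:E = (tail K z / c)%:E)%E.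
Proof.
move=> c0.
have E : (\int[mu]_y (if (z < y)%R then (K y)%:E else 0) = (tail K z)%:E)%E.
  rewrite /tail /Rintegral -integral_itv_obnd_cbnd; last first.
    exact: measurable_funTS (measurable_int mu Kint).
  rewrite fineK; last first.
    apply: integrable_fin_num => //.
    by apply: integrableS Kint.
  rewrite [RHS]integral_mkcond; apply: eq_integral => y _; rewrite patchE.
  rewrite (_ : (y \in `]z, +oo[%classic) = (z < y))//.
  by apply/idP/idP; rewrite inE/= in_itv/= andbT.
have mh : measurable_fun setT (fun y : R => if z < y then (K y)%:E else 0%E).
  apply: measurable_fun_ifT; [exact: measurable_fun_ltr| |exact: measurable_cst].
  exact: measurable_int Kint.
have h0 y : (0 <= if (z < y)%R then (K y)%:E else 0)%E by case: ifP => _; rewrite ?lee_fin.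
rewrite (ge0_integral_affine z _ mh h0 (a := c)) ?gt_eqF// (gtr0_norm c0) in E.
have {}E : (c%:E * \int[mu]_s (rl_kernel 1 s * K (z + c * s))%:E = (tail K z)%:E)%E.
  rewrite -E; congr (_ * _)%E; apply: eq_integral => s _.
  rewrite rl_kernel1 ltrDr pmulr_rgt0// [c * s + z]addrC.
  by case: ifP => _; rewrite ?mul1r ?mul0r.
rewrite -[LHS]mul1e -[X in (X%:E * _)%E](mulVf (x := c)) ?gt_eqF// EFinM -muleA E -EFinM.
by rewrite mulrC.
Qed.

(** The kernel is homogeneous; this passes from the space variable to the
    time variable of a wave of speed c. *)
Lemma frac_integral_scale (f : R -> R) (c z : R) : 0 < c -> measurable_fun setT f ->
  (forall x, 0 <= f x) ->
  (\int[mu]_s (rl_kernel (1 - alpha) s * f (z + s))%:E =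
   (c * c `^ (- alpha))%:E * \int[mu]_s (rl_kernel (1 - alpha) s * f (z + c * s))%:E)%E.
Proof.
move=> c0 mf f0.
have q0 s : 0 <= rl_kernel (1 - alpha) s by exact: rl_kernel_ge0.
have mq := @measurable_rl_kernel R (1 - alpha).
have m1 : measurable_fun setT (fun s : R => (rl_kernel (1 - alpha) s * f (z + s))%:E).
  apply/measurable_EFinP; apply: measurable_funM mq _.
  by apply: (measurableT_comp mf); exact: measurable_funD.
have m2 : measurable_fun setT (fun s : R => rl_kernel (1 - alpha) s * f (z + c * s)).
  by apply: measurable_funM mq _; exact: measurable_delay mf.
have cn : c != 0 by rewrite gt_eqF.
have p1 s : (0 <= (rl_kernel (1 - alpha) s * f (z + s))%:E)%E.
  by rewrite lee_fin; apply: mulr_ge0; [exact: q0|exact: f0].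
have p2 s : 0 <= rl_kernel (1 - alpha) s * f (z + c * s).
  by apply: mulr_ge0; [exact: q0|exact: f0].
rewrite (ge0_integral_affine 0 cn m1 p1) (gtr0_norm c0) EFinM -muleA.
rewrite -(ge0_integral_EFinZl m2 p2 (powR_ge0 c (- alpha))); congr (_ * _)%E.
apply: eq_integral => s _; rewrite addr0 (rl_kernel_scale _ s c0) -mulrA.
by rewrite [1 - alpha - 1]addrAC subrr add0r.
Qed.

(** Minus the derivative of the profile is the average of K over the delays.
    Applied to chi t = K (z + c t), the balance above has the fractional integral
    of that average in its first term, the profile in the second, where
    the inner integral is a tail of K, and tail K z on the right. *)
Lemma profile_frac_integral (c z : R) : 0 < c ->
  (\int[mu]_s (rl_kernel (1 - alpha) s * - derive1 (profile alpha K c) (z + s))%:E =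
   (c `^ (- alpha) * (tail K z - profile alpha K c z))%:E)%E.
Proof.
move=> c0.
have [M KM] := Kbnd.
pose chi t := K (z + c * t).
have mchi : measurable_fun setT chi by exact: measurable_delay (continuous_measurable_fun Kcont).
have chi0 t : 0 <= chi t by exact: Kge0.
have kd x := kernel_delay Kcont x c KM.
have dE x : - derive1 (profile alpha K c) x = average G (fun r => K (x + c * r)).
  by rewrite derive1_profile// opprK.
have d0 x : 0 <= average G (fun r => K (x + c * r)).
  by apply: Rintegral_ge0 => r _; apply: mulr_ge0; [exact: G0|exact: Kge0].
have md : measurable_fun setT (fun x : R => average G (fun r => K (x + c * r))).
  rewrite (_ : (fun x => _) = \- derive1 (profile alpha K c)).
    apply: measurable_funN; apply: continuous_measurable_fun.
    by have [_ + _ _] := profile_BC1 alpha01 Kint Kbnd Kcont Kge0 c.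
  by apply/funext => x; rewrite -dE.
under eq_integral => s _ do rewrite dE.
rewrite (frac_integral_scale z c0 md d0).
have inE s : (\int[mu]_r (G r * chi (s + r)%R)%:E = (average G (fun r => K (z + c * s + c * r)))%:E)%E.
  rewrite -(average_integral mG Gle0 Ggt0 G1 (kd (z + c * s))).
  by apply: eq_integral => r _; rewrite /chi mulrDr addrA.
have tE r : (\int[mu]_s (rl_kernel 1 s * chi (r + s)%R)%:E = (tail K (z + c * r) / c)%:E)%E.
  rewrite -(ray_integral _ c0); apply: eq_integral => s _.
  by rewrite /chi mulrDr addrA.
have tb := tail_delay Kint Kcont Kge0 z c.
have pE : (\int[mu]_r (G r * tail K (z + c * r))%:E = (profile alpha K c z)%:E)%E.
  by rewrite profileE// (average_integral mG Gle0 Ggt0 G1 tb).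
have rE : (\int[mu]_t (chi t * rl_kernel 1 t)%:E = (tail K z / c)%:E)%E.
  by rewrite -(ray_integral _ c0); apply: eq_integral => t _; rewrite mulrC.
have mt : measurable_fun setT (fun r => G r * tail K (z + c * r)) by exact: measurable_funM mG tb.1.
have t0 r : 0 <= G r * tail K (z + c * r).
  by apply: mulr_ge0; [exact: G0|exact: tail_ge0].
have ci0 : 0 <= c^-1 by rewrite invr_ge0 ltW.
have := caputo_balance mchi chi0; rewrite rE.
under eq_integral => s _ do rewrite inE -EFinM.
under [X in (_ + X)%E]eq_integral => r _ do rewrite tE -EFinM mulrA mulrC.
rewrite (ge0_integral_EFinZl mt t0 ci0) pE -EFinM.
set I := (\int[mu]_s _)%E => B.
have -> : I = ((tail K z - profile alpha K c z) / c)%:E.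
  move: B; case: (I) => [i| |] //= [] B; congr EFin.
  by rewrite mulrBl -B [c^-1 * _]mulrC addrK.
rewrite -EFinM; congr EFin.
by field; rewrite gt_eqF.
Qed.

Lemma profile_frac_deriv (c z : R) : 0 < c ->
  frac_deriv_exists alpha c (profile alpha K c) z /\
  frac_deriv alpha c (profile alpha K c) z = tail K z - profile alpha K c z.
Proof.
move=> c0.
pose d (s : R) := derive1 (profile alpha K c) (z + s).
have Gp : 0 < Gamma (1 - alpha) by exact: Gamma_gt0.
have I := profile_frac_integral z c0.
have dle (s : R) : 0 <= - d s.
  rewrite /d derive1_profile// opprK; apply: Rintegral_ge0 => r _.
  by apply: mulr_ge0; [exact: G0|exact: Kge0].
have md : measurable_fun setT d.
  apply: (measurableT_comp (f := derive1 (profile alpha K c))).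
    apply: continuous_measurable_fun.
    by have [_ + _ _] := profile_BC1 alpha01 Kint Kbnd Kcont Kge0 c.
  exact: measurable_funD.
have mn : measurable_fun setT (fun s : R => rl_kernel (1 - alpha) s * - d s).
  by apply: measurable_funM; [exact: measurable_rl_kernel|exact: measurable_funN].
have n0 (s : R) : 0 <= rl_kernel (1 - alpha) s * - d s.
  by apply: mulr_ge0; [exact: rl_kernel_ge0|exact: dle].
have ri : mu.-integrable setT (fun s => (rl_kernel (1 - alpha) s * - d s)%:E).
  apply/integrableP; split; first exact/measurable_EFinP.
  rewrite (_ : (fun s => _) = (fun s => (rl_kernel (1 - alpha) s * - d s)%:E)).
    by rewrite I ltry.
  by apply/funext => s; rewrite /= (ger0_norm (n0 s)).
have e (s : R) : 0 < s -> d s / s `^ alpha = - Gamma (1 - alpha) * (rl_kernel (1 - alpha) s * - d s).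
  move=> s0; rewrite rl_kernelE// addrAC subrr add0r powRN.
  by field; rewrite !gt_eqF// powR_gt0.
have fi : mu.-integrable `]0, +oo[ (EFin \o (fun s => d s / s `^ alpha)).
  apply: (@eq_integrable _ _ _ mu _ (measurable_itv _)
    (fun s => (- Gamma (1 - alpha))%:E * (rl_kernel (1 - alpha) s * - d s)%:E)%E).
    move=> s; rewrite inE/= in_itv/= andbT => s0.
    by rewrite /= e// EFinM.
  apply: integrableZl => //.
  by apply: integrableS ri.
have L := improper_integral_cvg fi.
have Ie : \int[mu]_(s in `]0, +oo[) (d s / s `^ alpha) =
    - Gamma (1 - alpha) * (c `^ (- alpha) * (tail K z - profile alpha K c z)).
  rewrite Rintegral_mkcond.
  rewrite (@eq_Rintegral _ _ _ mu _ (fun s => - Gamma (1 - alpha) * (rl_kernel (1 - alpha) s * - d s))).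
    rewrite (RintegralZl _ measurableT ri); congr (_ * _).
    by rewrite /Rintegral I.
  move=> s _; rewrite patchE.
  rewrite (_ : (s \in `]0, +oo[%classic) = (0 < s)); last first.
    by apply/idP/idP; rewrite inE/= in_itv/= andbT.
  case: ltP => s0; first exact: e.
  by rewrite rl_kernel_eq0// mul0r mulr0.
split.
  split => [_|]; last by rewrite ltNge ltW.
  by apply/cvg_ex; eexists; exact: L.
rewrite /frac_deriv c0 /improper_integral.
have -> : lim ((\int[mu]_(s in `]0, b]) (d s / s `^ alpha)) @[b --> +oo]) =
    \int[mu]_(s in `]0, +oo[) (d s / s `^ alpha) by exact/cvg_lim.
rewrite Ie powRN.
by field; rewrite !gt_eqF// powR_gt0.
Qed.

End Existence.

(** * Substitutions in signed integrals *)

Section SignedSubstitution.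
Context {R : realType}.
Local Notation mu := (@lebesgue_measure R).

Lemma integral_shift (b : R) (f : R -> \bar R) : measurable_fun setT f ->
  (\int[mu]_x f x = \int[mu]_x f (x + b)%R)%E.
Proof.
move=> mf.
rewrite integralE [in RHS]integralE.
rewrite (ge0_integral_shift b (measurable_funepos mf) (funepos_ge0 f)).
rewrite (ge0_integral_shift b (measurable_funeneg mf) (funeneg_ge0 f)).
by congr (_ - _)%E; apply: eq_integral => x _; rewrite ?funeposE ?funenegE.
Qed.

Lemma Rintegral_scale (a : R) (f : R -> R) : 0 < a -> mu.-integrable setT (EFin \o f) ->
  \int[mu]_x f x = a * \int[mu]_x f (a * x).
Proof.
move=> a0 fi; have an : a != 0 by rewrite gt_eqF.
have mf := measurable_int _ fi.
have P := ge0_integral_affine 0 an (measurable_funepos mf) (funepos_ge0 _).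
have N := ge0_integral_affine 0 an (measurable_funeneg mf) (funeneg_ge0 _).
have Pf := integrable_pos_fin_num measurableT fi.
have Nf := integrable_neg_fin_num measurableT fi.
rewrite (gtr0_norm a0) in P N.
have E : (\int[mu]_x f (a * x))%R = fine (\int[mu]_x (EFin \o f) (a * x + 0)%R)%E.
  by congr fine; apply: eq_integral => x _; rewrite addr0.
rewrite E /Rintegral integralE [in RHS]integralE.
move: Pf Nf; rewrite P N.
set p := (X in (_ * X)%E \is a fin_num); set q := (X in _ -> (_ * X)%E \is a fin_num -> _).
have fin x : (a%:E * x)%E \is a fin_num -> x \is a fin_num.
  by case: x => //=; rewrite ?gt0_muley ?gt0_muleNy ?lte_fin.
move=> /fin pf /fin qf.
rewrite [X in _ = a * fine (X - _)](_ : _ = p); last first.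
  by apply: eq_integral => x _; rewrite !funeposE.
rewrite [X in _ = a * fine (_ - X)](_ : _ = q); last first.
  by apply: eq_integral => x _; rewrite !funenegE.
by rewrite -muleBr ?fin_num_adde_defr// fineM// fin_numB pf.
Qed.

End SignedSubstitution.

(** * Forward fractional integrals on a window *)

Section Window.
Context {R : realType}.
Local Notation mu := (@lebesgue_measure R).
Variable alpha : R.
Hypothesis alpha01 : 0 < alpha < 1.
Let alpha_gt0 : 0 < alpha. Proof. by case/andP: alpha01. Qed.
Let G := ml_kernel alpha alpha.
Let mG : measurable_fun setT G. Proof. exact: measurable_ml_kernel. Qed.
Let G0 r : 0 <= G r. Proof. exact: ml_kernel_ge0. Qed.
Implicit Types (gam N T r t : R) (X : R -> R).

(** A fractional integral looking forward from r, in the direction in which D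
    differentiates when c > 0. *)
Definition frac_int gam X r : R := \int[mu]_s (rl_kernel gam s * X (r + s)).

(** The factor rl_kernel 1 (T - t) is the indicator of t < T; written so, the
    bound convolves with the fractional kernels by the semigroup law. *)
Definition window N T X := measurable_fun setT X /\ forall t, `|X t| <= N * rl_kernel 1 (T - t).

Lemma frac_int_integrable gam N T X r : 0 < gam -> 0 <= N -> window N T X ->
  mu.-integrable setT (fun s => (rl_kernel gam s * X (r + s))%:E).
Proof.
move=> g0 N0 [mX XN].
have i := @integrableZl _ _ _ mu setT measurableT N _
  (rl_kernel_convolution_integrable (T - r) g0 ltr01).
apply: (le_integrable measurableT _ _ i).
  apply/measurable_EFinP; apply: measurable_funM; first exact: measurable_rl_kernel.
  by apply: (measurableT_comp mX); exact: measurable_funD.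
move=> s _; rewrite -EFinM !abse_EFin lee_fin.
have q0 : 0 <= rl_kernel gam s by exact: rl_kernel_ge0.
rewrite [leLHS]normrM [leRHS]normrM (ger0_norm N0).
rewrite [X in _ <= _ * X]normrM (ger0_norm q0) [leRHS]mulrCA.
apply: ler_wpM2l => //; apply: le_trans (XN (r + s)) _.
apply: ler_wpM2l => //; rewrite opprD addrA; exact: ler_norm.
Qed.

(** Exchanging the integrations moves the fractional integral from X to g,
    where it only shifts the parameter of the Mittag-Leffler kernel. *)
Lemma window_fubini gam N T X : 0 < gam -> 0 <= N -> window N T X ->
  [/\ mu.-integrable setT (fun r => (G r * frac_int gam X r)%:E),
      mu.-integrable setT (fun t => (X t * ml_kernel alpha (alpha + gam) t)%:E)
    & \int[mu]_r (G r * frac_int gam X r) = \int[mu]_t (X t * ml_kernel alpha (alpha + gam) t)].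
Proof.
move=> g0 N0 wX; have [mX XN] := wX.
have mq := @measurable_rl_kernel R gam.
have q0 s : 0 <= rl_kernel gam s by exact: rl_kernel_ge0.
have j0 s : 0 <= rl_kernel 1 s :> R by exact: rl_kernel_ge0 ltr01.
pose F (p : R * R) : \bar R := (G p.1 * rl_kernel gam (p.2 - p.1) * X p.2)%:E.
have mF : measurable_fun setT F.
  apply/measurable_EFinP; apply: measurable_funM; last exact: (measurableT_comp mX measurable_snd).
  apply: measurable_funM; first exact: (measurableT_comp mG measurable_fst).
  apply: (measurableT_comp mq); exact: measurable_funB.
have mqt r : measurable_fun setT (fun t : R => rl_kernel gam (t - r)).
  by apply: (measurableT_comp mq); exact: measurable_funB.
have mjt : measurable_fun setT (fun t : R => rl_kernel 1 (T - t)).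
  by apply: measurableT_comp; [exact: measurable_rl_kernel|exact: measurable_funB].
have mqj r : measurable_fun setT (fun t : R => rl_kernel gam (t - r) * rl_kernel 1 (T - t)).
  exact: (measurable_funM (mqt r) mjt).
have qj0 r t : 0 <= rl_kernel gam (t - r) * rl_kernel 1 (T - t) by apply: mulr_ge0.
have inner r : (\int[mu]_t (rl_kernel gam (t - r) * rl_kernel 1 (T - t))%:E =
    (rl_kernel (gam + 1) (T - r))%:E)%E.
  rewrite -(rl_kernel_convolution (T - r) g0 ltr01) /convolution (ge0_integral_shift r).
  - by apply: eq_integral => s _; rewrite addrK opprD addrA addrAC.
  - by apply/measurable_EFinP; exact: mqj.
  - by move=> t; rewrite lee_fin; exact: qj0.
have NG0 r : 0 <= N * G r by apply: mulr_ge0.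
have inner_le r : (\int[mu]_t `|F (r, t)| <= (N * (G r * rl_kernel (gam + 1) (T - r)))%:E)%E.
  rewrite mulrA EFinM -inner -(ge0_integral_EFinZl (mqj r) (qj0 r) (NG0 r)).
  apply: ge0_le_integral.
  - exact: measurableT.
  - by move=> t _; exact: abse_ge0.
  - apply: measurableT_comp; first exact: abse_measurable.
    exact: (measurableT_comp mF (measurable_pair1 r)).
  - by apply/measurable_EFinP; apply: measurable_funM (mqj r); exact: measurable_cst.
  - move=> t _; rewrite /F /= lee_fin normrM normrM (ger0_norm (G0 r)) (ger0_norm (q0 _)).
    have aux (a b c d n : R) : 0 <= a -> 0 <= b -> c <= n * d -> a * b * c <= n * a * (b * d).
      move=> a0 b0 cd; rewrite [leRHS](_ : _ = a * b * (n * d)); last by ring.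
      by apply: ler_wpM2l => //; exact: mulr_ge0.
    exact: aux (G0 r) (q0 (t - r)) (XN t).
have ga0 : 0 < gam + 1 by exact: addr_gt0.
have [ii Ei] := ml_kernel_convolution alpha_gt0 T alpha_gt0 ga0.
have mGr : measurable_fun setT (fun r => G r * rl_kernel (gam + 1) (T - r)).
  exact: measurable_convolution_integrand mG (measurable_rl_kernel (gam + 1)).
have Gr0 r : 0 <= G r * rl_kernel (gam + 1) (T - r).
  by apply: mulr_ge0; [exact: G0|exact: rl_kernel_ge0].
have iF : (mu \x mu)%E.-integrable setT F.
  apply/(integrable12ltyP mu mu mF).
  apply: (@le_lt_trans _ _ (\int[mu]_r (N * (G r * rl_kernel (gam + 1) (T - r)))%:E)%E).
    apply: ge0_le_integral.
    - exact: measurableT.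
    - by move=> r _; apply: integral_ge0 => t _; exact: abse_ge0.
    - have ma : measurable_fun setT (abse \o F) by apply: measurableT_comp mF; exact: abse_measurable.
      exact: (measurable_fun_fubini_tonelli_F (m2 := mu) _ ma (fun p => abse_ge0 _)).
    - by apply/measurable_EFinP; apply: measurable_funM mGr; exact: measurable_cst.
    - by move=> r _; exact: inner_le.
  by rewrite (ge0_integral_EFinZl mGr Gr0 N0) Ei -EFinM ltry.
have E1 r : (\int[mu]_t F (r, t) = (G r * frac_int gam X r)%:E)%E.
  have fi := frac_int_integrable r g0 N0 wX.
  rewrite (integral_shift r); last exact: (measurableT_comp mF (measurable_pair1 r)).
  rewrite EFinM /frac_int /Rintegral fineK; last exact: integrable_fin_num fi.
  rewrite -(integralZl measurableT fi); apply: eq_integral => s _.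
  rewrite /F /= addrK [s + r]addrC -EFinM; congr EFin; exact: (esym (mulrA (G r) _ _)).
have E2 t : (\int[mu]_r F (r, t) = (X t * ml_kernel alpha (alpha + gam) t)%:E)%E.
  have [it Et] := ml_kernel_convolution alpha_gt0 t alpha_gt0 g0.
  rewrite EFinM -Et -(integralZl measurableT it); apply: eq_integral => r _.
  rewrite /F /= -EFinM; congr EFin; exact: mulrC.
split.
  by have := integrable_fubini_F iF; rewrite /fubini_F; under eq_fun do rewrite E1.
  have mt : measurable_fun setT (fun t => (X t * ml_kernel alpha (alpha + gam) t)%:E).
    by apply/measurable_EFinP; apply: (measurable_funM mX); exact: (measurable_ml_kernel alpha_gt0 (addr_gt0 alpha_gt0 g0)).
  have ma : measurable_fun setT (abse \o F) by apply: measurableT_comp mF; exact: abse_measurable.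
  apply/integrableP; split; first exact: mt.
  apply: le_lt_trans ((integrable21ltyP mu mu mF).1 iF).
  apply: ge0_le_integral.
  - exact: measurableT.
  - by move=> t _; exact: abse_ge0.
  - by apply: measurableT_comp mt; exact: abse_measurable.
  - exact: (measurable_fun_fubini_tonelli_G (m1 := mu) _ ma (fun p => abse_ge0 _)).
  - move=> t _; rewrite -E2; apply: le_abse_integral; first exact: measurableT.
    exact: (measurableT_comp mF (measurable_pair2 t)).
rewrite /Rintegral; congr fine.
under eq_integral => r _ do rewrite -E1.
under [RHS]eq_integral => t _ do rewrite -E2.
exact: Fubini iF.
Qed.

Lemma frac_int1_derive (chi : R -> R) T r : (forall x, derivable chi x 1) ->
  continuous (derive1 chi) ->
  frac_int 1 (fun t => derive1 chi t * rl_kernel 1 (T - t)) r = if r < T then chi T - chi r else 0.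
Proof.
move=> dchi cd.
have md : measurable_fun setT (derive1 chi) by exact: continuous_measurable_fun.
rewrite /frac_int /Rintegral.
have mh : measurable_fun setT (fun t : R => (rl_kernel 1 (t - r) * (derive1 chi t * rl_kernel 1 (T - t)))%:E).
  apply/measurable_EFinP; apply: measurable_funM.
    by apply: measurableT_comp; [exact: measurable_rl_kernel|exact: measurable_funB].
  apply: measurable_funM => //.
  by apply: measurableT_comp; [exact: measurable_rl_kernel|exact: measurable_funB].
transitivity (fine (\int[mu]_(t in `]r, T[) (derive1 chi t)%:E)%E).
  congr fine; rewrite [RHS]integral_mkcond.
  rewrite (_ : (\int[mu]_s _)%E = (\int[mu]_t (rl_kernel 1 (t - r) * (derive1 chi t * rl_kernel 1 (T - t)))%:E)%E); last first.
    rewrite (integral_shift r mh); apply: eq_integral => s _.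
    by rewrite addrK [s + r]addrC.
  apply: eq_integral => t _; rewrite patchE.
  rewrite (_ : (t \in `]r, T[%classic) = (r < t) && (t < T)); last first.
    by apply/idP/idP; rewrite inE/= in_itv/=.
  rewrite !rl_kernel1 !subr_gt0.
  by case: (r < t); case: (t < T) => /=; rewrite ?mul0r ?mul1r ?mulr1 ?mulr0.
case: ltP => rT; last by rewrite set_itv_ge ?integral_set0// bnd_simp -leNgt.
rewrite -(@integral_itv_bndoo R r T _ true false); last first.
  by apply/measurable_EFinP; exact: measurable_funTS.
have cchi x : {for x, continuous chi}.
  by apply: differentiable_continuous; apply/derivable1_diffP; exact: dchi.
rewrite (@continuous_FTC2 R (derive1 chi) chi r T rT).
- by [].
- by apply: continuous_subspaceT; exact: cd.
- split; first by move=> x _; exact: dchi.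
    by apply: cvg_at_right_filter; exact: cchi.
  by apply: cvg_at_left_filter; exact: cchi.
- by [].
Qed.

(** The function u s * s^(- alpha) has a derivative below the integrand, since
    u >= 0 and the weight decreases; so the integral is at least its increment,
    which is at least minus its value at B. *)
Lemma power_weight_ge (u : R -> R) (B b : R) : (forall x, derivable u x 1) ->
  continuous (derive1 u) -> (forall x, 0 <= u x) -> 0 < B -> B < b ->
  - (u B / B `^ alpha) <= \int[mu]_(s in `]B, b]) (derive1 u s / s `^ alpha).
Proof.
move=> du cdu u0 B0 Bb.
pose Phi (s : R) := u s * s `^ (- alpha).
pose phi (s : R) := derive1 u s * s `^ (- alpha) + u s * (- alpha * s `^ (- alpha - 1)).
have cu x : {for x, continuous u}.
  by apply: differentiable_continuous; apply/derivable1_diffP; exact: du.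
have cp (p x : R) : 0 < x -> {for x, continuous (fun t : R => t `^ p)}.
  move=> x0; apply: differentiable_continuous; apply/derivable1_diffP.
  by apply: derivable_powR; rewrite in_itv/= andbT.
have dPhi (x : R) : 0 < x -> is_derive x 1 Phi (phi x).
  move=> x0; have d1 : is_derive x 1 u (derive1 u x) by rewrite derive1E; split; first exact: du.
  have d2 := is_derive1_powR (- alpha) x0.
  have d3 := is_deriveM d1 d2.
  apply: is_derive_eq d3 _.
  by rewrite /GRing.scale/= /phi; ring.
have cphi x : 0 < x -> {for x, continuous phi}.
  move=> x0; apply: cvgD; apply: cvgM; [exact: cdu|exact: cp|exact: cu|].
  by apply: cvgM; [exact: cvg_cst|exact: cp].
have pos x : x \in `[B, b]%classic -> 0 < x.
  by rewrite inE/= in_itv/= => /andP[+ _]; exact: lt_le_trans.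
have wphi : {within `[B, b], continuous phi}.
  by apply: continuous_in_subspaceT => x /pos; exact: cphi.
have F : (\int[mu]_(x in `[B, b]) (phi x)%:E = (Phi b)%:E - (Phi B)%:E)%E.
  apply: continuous_FTC2 => //.
    have cPhi x : 0 < x -> {for x, continuous Phi}.
      move=> x0; apply: differentiable_continuous; apply/derivable1_diffP.
      by have [] := dPhi x x0.
    split.
    + move=> x; rewrite in_itv/= => /andP[Bx _].
      by have [] := dPhi x (lt_trans B0 Bx).
    + by apply: cvg_at_right_filter; exact: cPhi.
    + by apply: cvg_at_left_filter; apply: cPhi; exact: lt_trans Bb.
  move=> x; rewrite in_itv/= => /andP[Bx _].
  by rewrite derive1E; have [_ ->] := dPhi x (lt_trans B0 Bx).
have wf : {within `[B, b], continuous (fun s => derive1 u s / s `^ alpha)}.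
  apply: continuous_in_subspaceT => x /pos x0; apply: cvgM; first exact: cdu.
  by apply: cvgV; [rewrite gt_eqF// powR_gt0|exact: cp].
have i1 : mu.-integrable `[B, b] (EFin \o phi).
  by apply: continuous_compact_integrable => //; exact: segment_compact.
have i2 : mu.-integrable `[B, b] (EFin \o (fun s => derive1 u s / s `^ alpha)).
  by apply: continuous_compact_integrable => //; exact: segment_compact.
rewrite Rintegral_itv_obnd_cbnd; last first.
  by apply: integrableS i2 => //; exact: subset_itv_oc_cc.
apply: (@le_trans _ _ (\int[mu]_(s in `[B, b]) phi s)).
  have -> : \int[mu]_(s in `[B, b]) phi s = Phi b - Phi B by rewrite /Rintegral F.
  rewrite /Phi !powRN addrC lerDl; apply: mulr_ge0; first exact: u0.
  by rewrite invr_ge0 powR_ge0.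
apply: le_Rintegral => // x xB.
have x0 : 0 < x by apply: pos; rewrite inE.
rewrite /phi powRN gerDl; apply: mulr_ge0_le0 => //.
by rewrite mulNr oppr_le0 mulr_ge0 ?powR_ge0// ltW.
Qed.

End Window.

(** * The equation up to a finite horizon *)

Section Representation.
Context {R : realType}.
Local Notation mu := (@lebesgue_measure R).
Variable alpha : R.
Hypothesis alpha01 : 0 < alpha < 1.
Let alpha_gt0 : 0 < alpha. Proof. by case/andP: alpha01. Qed.
Let alpha1_gt0 : 0 < 1 - alpha. Proof. by rewrite subr_gt0; case/andP: alpha01. Qed.
Variables (psi : R -> R) (M M' : R).
Hypothesis dpsi : forall x, derivable psi x 1.
Hypothesis cdpsi : continuous (derive1 psi).
Hypothesis psiM : forall x, `|psi x| <= M.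
Hypothesis dpsiM : forall x, `|derive1 psi x| <= M'.
Implicit Types (x z c r s T B L : R).

Let weighted x s := derive1 psi (x + s) / s `^ alpha.

Lemma is_derive_shift x s : is_derive s 1 (fun s : R => psi (x + s)) (derive1 psi (x + s)).
Proof.
have h1 : is_derive (x + s) 1 psi (derive1 psi (x + s)).
  by rewrite derive1E; split; first exact: dpsi.
have h2 : is_derive s 1 (fun s : R => x + s) 1.
  by have := is_deriveD (is_derive_cst (x : R^o) (s : R^o) 1) (is_derive_id (s : R^o) 1); rewrite add0r.
by have := @is_derive1_comp _ psi (fun s => x + s) _ _ _ h1 h2; rewrite mulr1.
Qed.

Let measurable_dpsi : measurable_fun setT (derive1 psi).
Proof. exact: continuous_measurable_fun. Qed.

Lemma weighted_integrable x b : mu.-integrable `]0, b] (EFin \o weighted x).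
Proof.
have M'0 : 0 <= M' by exact: le_trans (normr_ge0 _) (dpsiM 0).
have Gp : 0 < Gamma (1 - alpha) by exact: Gamma_gt0.
have i := @integrableZl _ _ _ mu setT measurableT (M' * Gamma (1 - alpha)) _
  (rl_kernel_convolution_integrable (b + 1) alpha1_gt0 ltr01).
have {}i : mu.-integrable `]0, b] (fun s => ((M' * Gamma (1 - alpha)) * (rl_kernel (1 - alpha) s * rl_kernel 1 (b + 1 - s)))%:E).
  by apply: integrableS i.
have mD : measurable (`]0, b]%classic : set R) by exact: measurable_itv.
apply: (@le_integrable _ _ _ mu _ mD _ _ _ _ i).
  apply/measurable_EFinP; apply: measurable_funTS; apply: measurable_funM.
    by apply: (measurableT_comp measurable_dpsi); exact: measurable_funD.
  rewrite (_ : (fun s : R => (s `^ alpha)^-1) = (fun s : R => s `^ (- alpha))).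
    exact: measurable_powR.
  by apply/funext => s; rewrite powRN.
move=> s /=; rewrite in_itv/= => /andP[s0 sb].
rewrite lee_fin /weighted rl_kernelE// rl_kernel1 subr_gt0.
rewrite (le_lt_trans sb) ?ltrDl// mulr1 addrAC subrr add0r powRN.
have sp : 0 < s `^ alpha by exact: powR_gt0.
rewrite [X in _ <= `|X|](_ : _ = M' / s `^ alpha); last by field; rewrite !gt_eqF.
rewrite !normrM normfV (ger0_norm M'0); apply: ler_wpM2r; first by rewrite invr_ge0.
exact: dpsiM.
Qed.

(** The tails of the improper integral are controlled by the bound on psi alone,
    without any decay of its derivative: integrate by parts, in the form of the
    previous inequality for M + psi and for M - psi. *)
Lemma weighted_tail x B b : 0 < B -> B < b ->
  `|\int[mu]_(s in `]B, b]) weighted x s| <= 2 * M / B `^ alpha.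
Proof.
move=> B0 Bb.
have i : mu.-integrable `]B, b] (EFin \o weighted x).
  apply: (integrableS _ _ _ (weighted_integrable x b)) => //.
  by apply: subset_itvr; rewrite bnd_simp ltW.
have Bp : 0 < B `^ alpha by exact: powR_gt0.
have d1 s : is_derive s 1 (fun s : R => psi (x + s) + M) (derive1 psi (x + s)).
  by have := is_deriveD (is_derive_shift x s) (is_derive_cst (M : R^o) (s : R^o) 1); rewrite addr0.
have d2 s : is_derive s 1 (fun s : R => M - psi (x + s)) (- derive1 psi (x + s)).
  by have := is_deriveB (is_derive_cst (M : R^o) (s : R^o) 1) (is_derive_shift x s); rewrite sub0r.
have D1 : derive1 (fun s : R => psi (x + s) + M) = (fun s => derive1 psi (x + s)).
  by apply/funext => s; rewrite derive1E; have [_ ->] := d1 s.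
have D2 : derive1 (fun s : R => M - psi (x + s)) = (fun s => - derive1 psi (x + s)).
  by apply/funext => s; rewrite derive1E; have [_ ->] := d2 s.
have cs : continuous (fun s => derive1 psi (x + s)).
  move=> s; apply: (@continuous_comp _ _ _ (fun s => x + s) (derive1 psi)).
    by apply: cvgD; [exact: cvg_cst|exact: cvg_id].
  exact: cdpsi.
have ub s : - M <= psi (x + s) <= M by rewrite -ler_norml.
have k1 : - (2 * M / B `^ alpha) <= \int[mu]_(s in `]B, b]) weighted x s.
  have := @power_weight_ge R alpha alpha01 (fun s => psi (x + s) + M) B b.
  rewrite D1 => h; apply: le_trans (h _ cs _ B0 Bb).
  - rewrite lerN2 ler_wpM2r ?invr_ge0 ?(ltW Bp)//.
    by have /andP[_ h2] := ub B; rewrite mulr_natl mulr2n lerD2r.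
  - by move=> s; have [] := d1 s.
  - by move=> s; have /andP[h1 _] := ub s; rewrite -lerBlDr sub0r.
have k2 : \int[mu]_(s in `]B, b]) weighted x s <= 2 * M / B `^ alpha.
  have := @power_weight_ge R alpha alpha01 (fun s => M - psi (x + s)) B b.
  rewrite D2 => h.
  have {}h : - ((M - psi (x + B)) / B `^ alpha) <= \int[mu]_(s in `]B, b]) (-1 * weighted x s).
    rewrite [leRHS](_ : _ = \int[mu]_(s in `]B, b]) (- derive1 psi (x + s) / s `^ alpha)); last first.
      by apply: eq_Rintegral => s _; rewrite /weighted mulN1r mulNr.
    apply: h B0 Bb.
    - by move=> s; have [] := d2 s.
    - by move=> s; apply: cvgN; exact: cs.
    - by move=> s; have /andP[_ h1] := ub s; rewrite subr_ge0.
  move: h; rewrite RintegralZl//; try exact: i.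
  rewrite mulN1r lerN2 => h.
  apply: le_trans h _; rewrite ler_wpM2r ?invr_ge0 ?(ltW Bp)//.
  by have /andP[h1 _] := ub B; rewrite mulr_natl mulr2n lerD2l lerNl.
by rewrite ler_norml k1.
Qed.

Lemma improper_tail x B L : 0 < B ->
  (\int[mu]_(s in `]0, b]) weighted x s) @[b --> +oo] --> L ->
  `|L - \int[mu]_(s in `]0, B]) weighted x s| <= 2 * M / B `^ alpha.
Proof.
move=> B0 cL; set I := \int[mu]_(s in _) _.
have c : `|(\int[mu]_(s in `]0, b]) weighted x s) - I| @[b --> +oo] --> `|L - I|.
  by apply: cvg_norm; apply: cvgB => //; exact: cvg_cst.
apply: (cvgr_to_le c); near=> b.
have Bb : B < b by near: b; apply: nbhs_pinfty_gt; exact: num_real.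
rewrite /I (Rintegral_itvB (weighted_integrable x b)) ?bnd_simp//; try exact: ltW.
exact: weighted_tail.
Unshelve. all: by end_near. Qed.

Variables (c z : R).
Hypothesis c0 : 0 < c.
Let chi t := psi (z + c * t).

Lemma is_derive_chi t : is_derive (t : R) 1 chi (c * derive1 psi (z + c * t)).
Proof.
have h1 : is_derive (z + c * t) 1 psi (derive1 psi (z + c * t)).
  by rewrite derive1E; split; first exact: dpsi.
have h2 : is_derive t 1 (fun t : R => z + c * t) c.
  have := is_deriveD (is_derive_cst (z : R^o) (t : R^o) 1) (is_deriveZ c (is_derive_id (t : R^o) 1)).
  by rewrite add0r /GRing.scale/= mulr1.
by have := @is_derive1_comp _ psi (fun t => z + c * t) _ _ _ h1 h2; rewrite mulrC.
Qed.

Lemma derive1_chi : derive1 chi = (fun t => c * derive1 psi (z + c * t)).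
Proof. by apply/funext => t; rewrite derive1E; have [_ ->] := is_derive_chi t. Qed.

Let X T t := derive1 chi t * rl_kernel 1 (T - t).

Lemma window_X T : window (c * M') T (X T).
Proof.
split.
  apply: measurable_funM.
    rewrite derive1_chi; apply: measurable_funM => //.
    exact: measurable_delay measurable_dpsi.
  by apply: measurableT_comp; [exact: measurable_rl_kernel|exact: measurable_funB].
move=> t; rewrite /X normrM derive1_chi normrM (gtr0_norm c0).
rewrite [`|rl_kernel _ _|]ger0_norm; last exact: rl_kernel_ge0 ltr01.
apply: ler_wpM2r; first exact: rl_kernel_ge0 ltr01.
by apply: ler_wpM2l; [exact: ltW|exact: dpsiM].
Qed.

(** The substitution of c * s for the variable of integration. *)
Lemma frac_int_time_change T r : r < T ->
  frac_int (1 - alpha) (X T) r =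
  c `^ alpha / Gamma (1 - alpha) * \int[mu]_(s in `]0, c * (T - r)]) weighted (z + c * r) s.
Proof.
move=> rT.
have Gp : 0 < Gamma (1 - alpha) by exact: Gamma_gt0.
have cp : 0 < c `^ alpha by exact: powR_gt0.
pose D : set R := `]0, c * (T - r)[%classic.
have i0 : mu.-integrable D (EFin \o weighted (z + c * r)).
  apply: (integrableS _ _ _ (weighted_integrable (z + c * r) (c * (T - r)))).
  - exact: measurable_itv.
  - exact: measurable_itv.
  by move=> s; rewrite /D /= !in_itv/= => /andP[-> /ltW ->].
rewrite -Rintegral_itv_bndo_bndc// Rintegral_mkcond.
have i1 : mu.-integrable setT (EFin \o (weighted (z + c * r) \_ D)).
  have mD : measurable D by exact: measurable_itv.
  rewrite -restrict_EFin.
  exact: (integrable_mkcond (mu := mu) (EFin \o weighted (z + c * r)) mD).1 i0.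
rewrite (Rintegral_scale c0 i1).
have fi : mu.-integrable setT (fun s => (rl_kernel (1 - alpha) s * X T (r + s))%:E).
  apply: frac_int_integrable alpha1_gt0 _ (window_X T).
  by apply: mulr_ge0; [exact: ltW|exact: le_trans (normr_ge0 _) (dpsiM 0)].
rewrite mulrA.
have -> : (fun x : R => (weighted (z + c * r) \_ D) (c * x)) =
    (fun s => (Gamma (1 - alpha) / (c * c `^ alpha)) * (rl_kernel (1 - alpha) s * X T (r + s))).
  apply/funext => s; rewrite patchE.
  rewrite (_ : (c * s \in D) = (0 < s) && (s < T - r)); last first.
    by apply/idP/idP; rewrite inE /D/= in_itv/= pmulr_rgt0// ltr_pM2l.
  rewrite /X rl_kernel1 opprD addrA subr_gt0 derive1_chi.
  case: ltP => s0 /=; last by rewrite rl_kernel_eq0// !(mul0r, mulr0).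
  case: ltP => sT; last by rewrite !mulr0.
  have sp : 0 < s `^ alpha by exact: powR_gt0.
  rewrite mulr1 /weighted rl_kernelE// [1 - alpha - 1]addrAC subrr add0r powRN.
  rewrite powRM ?(ltW c0) ?(ltW s0)// mulrDr addrA.
  by field; rewrite !gt_eqF.
rewrite (RintegralZl _ measurableT fi) -/(frac_int _ _ _).
by field; rewrite !gt_eqF.
Qed.

Variable f : R -> R.
Hypothesis wave : forall x, frac_deriv_exists alpha c psi x /\
  frac_deriv alpha c psi x = f x - psi x.

(** The equation of the wave cut off at the horizon T.  Here frac_int of X is
    the part of - D psi that comes from the times between r and T; the rest is
    O ((T - r)^(- alpha)). *)
Lemma wave_local T r : r < T ->
  `|f (z + c * r) - chi r + frac_int (1 - alpha) (X T) r| <= 2 * M * rl_kernel (1 - alpha) (T - r).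
Proof.
move=> rT; have [[e _] E] := wave (z + c * r).
have B0 : 0 < c * (T - r) by rewrite mulr_gt0// subr_gt0.
have Gp : 0 < Gamma (1 - alpha) by exact: Gamma_gt0.
have cp : 0 < c `^ alpha by exact: powR_gt0.
have Tr : 0 < T - r by rewrite subr_gt0.
have := improper_tail B0 (e c0).
move: E; rewrite /frac_deriv c0 /improper_integral -/(weighted (z + c * r)) -/(chi r) => <-.
set L := lim _; set I := \int[mu]_(s in _) _ => h.
rewrite (frac_int_time_change rT) -/I.
rewrite mulNr addrC -mulrBr normrM distrC ger0_norm; last by rewrite divr_ge0// ltW.
have k0 : 0 <= c `^ alpha / Gamma (1 - alpha) by rewrite divr_ge0// ltW.
apply: le_trans (ler_wpM2l k0 h) _.
rewrite rl_kernelE// [1 - alpha - 1]addrAC subrr add0r powRN powRM ?(ltW c0) ?(ltW Tr)//.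
have tp : 0 < (T - r) `^ alpha by exact: powR_gt0.
rewrite le_eqVlt; apply/orP; left; apply/eqP.
by field; rewrite !gt_eqF.
Qed.

End Representation.

(** * Balance at a finite horizon *)

Section Horizon.
Context {R : realType}.
Local Notation mu := (@lebesgue_measure R).
Variable alpha : R.
Hypothesis alpha01 : 0 < alpha < 1.
Let alpha_gt0 : 0 < alpha. Proof. by case/andP: alpha01. Qed.
Let alpha1_gt0 : 0 < 1 - alpha. Proof. by rewrite subr_gt0; case/andP: alpha01. Qed.
Let G := ml_kernel alpha alpha.
Let mG : measurable_fun setT G. Proof. exact: measurable_ml_kernel. Qed.
Let G0 r : 0 <= G r. Proof. exact: ml_kernel_ge0. Qed.

(* The derivative of psi is only bounded, so the fractional derivative cannot be
   integrated against g over all times.  It is integrated up to the horizon T,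
   with an error that g turns into a multiple of the relaxation function. *)
Variables (chi F : R -> R) (M M' N T : R).
Hypothesis dchi : forall x, derivable chi x 1.
Hypothesis cdchi : continuous (derive1 chi).
Hypothesis chiM : forall x, `|chi x| <= M.
Hypothesis dchiM : forall x, `|derive1 chi x| <= M'.
Hypothesis mF : measurable_fun setT F.
Hypothesis FN : forall x, `|F x| <= N.
Hypothesis T0 : 0 < T.
Let X t := derive1 chi t * rl_kernel 1 (T - t).
Hypothesis local : forall r, r < T ->
  `|F r - chi r + frac_int (1 - alpha) X r| <= 2 * M * rl_kernel (1 - alpha) (T - r).
Let j r : R := rl_kernel 1 (T - r).
Let m := ml_kernel alpha 1 T.

Let jr0 r : 0 <= j r. Proof. exact: rl_kernel_ge0 ltr01. Qed.

Let mj : measurable_fun setT j.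
Proof. by apply: measurableT_comp; [exact: measurable_rl_kernel|exact: measurable_funB]. Qed.

Let wX : window M' T X.
Proof.
split.
  apply: measurable_funM; last exact: mj.
  exact: continuous_measurable_fun.
move=> t; rewrite /X normrM [`|rl_kernel _ _|]ger0_norm; last exact: jr0.
by apply: ler_wpM2r; [exact: jr0|exact: dchiM].
Qed.

Let M'0 : 0 <= M'. Proof. exact: le_trans (normr_ge0 _) (dchiM 0). Qed.

Let integrable_Gj : mu.-integrable setT (fun r => (G r * j r)%:E).
Proof. by have [] := ml_kernel_convolution alpha_gt0 T alpha_gt0 ltr01. Qed.

Let integral_Gj : \int[mu]_r (G r * j r) = 1 - m.
Proof.
have := ml_kernel_cdf alpha01 T; rewrite rl_kernel1 T0 => E.
by rewrite /Rintegral E.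
Qed.

Let damped_integrable (f : R -> R) (B : R) : measurable_fun setT f -> (forall x, `|f x| <= B) ->
  mu.-integrable setT (fun r => (G r * (f r * j r))%:E).
Proof.
move=> mf fB; have i := @integrableZl _ _ _ mu setT measurableT B _ integrable_Gj.
apply: (le_integrable measurableT _ _ i).
  by apply/measurable_EFinP; apply: measurable_funM => //; exact: measurable_funM.
move=> r _; rewrite -EFinM !abse_EFin lee_fin.
have B0 : 0 <= B by exact: le_trans (normr_ge0 _) (fB 0).
rewrite [leLHS]normrM [leRHS]normrM (ger0_norm B0).
rewrite [X in _ * X <= _]normrM [X in _ <= _ * X]normrM (ger0_norm (G0 r)) (ger0_norm (jr0 r)).
rewrite [leRHS]mulrCA; apply: ler_wpM2l; first exact: G0.
by apply: ler_wpM2r; [exact: jr0|exact: fB].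
Qed.

Let mchi : measurable_fun setT chi.
Proof.
apply: continuous_measurable_fun => x.
by apply: differentiable_continuous; apply/derivable1_diffP; exact: dchi.
Qed.

Let u r := G r * (F r * j r).
Let v r := G r * (chi r * j r).
Let p r := G r * frac_int (1 - alpha) X r.
Let q r := G r * frac_int 1 X r.
Let iu : mu.-integrable setT (EFin \o u). Proof. exact: damped_integrable mF FN. Qed.
Let iv : mu.-integrable setT (EFin \o v). Proof. exact: (damped_integrable mchi chiM). Qed.
Let ip : mu.-integrable setT (EFin \o p).
Proof. by have [i _ _] := window_fubini alpha01 alpha1_gt0 M'0 wX. Qed.

(** Integrating the derivative of chi up to T gives chi T - chi r. *)
Let integral_q : \int[mu]_r q r = chi T * (1 - m) - \int[mu]_r v r.
Proof.
rewrite -integral_Gj -(RintegralZl _ measurableT integrable_Gj).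
have ii := @integrableZl _ _ _ mu setT measurableT (chi T) _ integrable_Gj.
rewrite -(RintegralB measurableT ii iv); apply: eq_Rintegral => r _.
rewrite /q /X (frac_int1_derive T r dchi cdchi) /v /j rl_kernel1 subr_gt0.
by case: ifP => _; ring.
Qed.

(** Convolving with the resolvent turns frac_int (1 - alpha) + frac_int 1 into
    the plain integral of X, since the kernels of orders 1 and 1 + alpha add up
    to the constant 1. *)
Let integral_p : \int[mu]_r p r = chi T - chi 0 - \int[mu]_r q r.
Proof.
have [_ i1 Ep] := window_fubini alpha01 alpha1_gt0 M'0 wX.
have [_ i2 Eq] := window_fubini alpha01 ltr01 M'0 wX.
have a1 : alpha + (1 - alpha) = 1 by rewrite addrC subrK.
rewrite a1 in i1 Ep.
have -> : chi T - chi 0 = frac_int 1 X 0 by rewrite /X (frac_int1_derive T 0 dchi cdchi) T0.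
have EP : \int[mu]_r p r = _ := Ep.
have EQ : \int[mu]_r q r = _ := Eq.
have E : frac_int 1 X 0 = \int[mu]_t (X t * ml_kernel alpha 1 t + X t * ml_kernel alpha (alpha + 1) t).
  rewrite /frac_int; apply: eq_Rintegral => t _.
  rewrite add0r (ml_kernel_rec alpha_gt0 t ltr01) [alpha + 1]addrC.
  by rewrite -mulrDr subrK; exact: mulrC.
have aux (a b d e s : R) : a = d -> b = e -> s = d + e -> a = s - b.
  by move=> -> -> ->; rewrite addrK.
exact: aux EP EQ (etrans E (RintegralD measurableT i1 i2)).
Qed.

(** The local equation integrated against g.  Its error term integrates to
    2 M m, since the fractional integral of order 1 - alpha of g is the relaxation
    function; the remaining boundary term chi T * m is at most M m. *)
Lemma horizon_balance : `|\int[mu]_r u r - chi 0| <= 3 * M * m.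
Proof.
have m0 : 0 <= m by exact: relaxation_ge0.
pose w r := u r - v r + p r.
have iw1 : mu.-integrable setT (EFin \o (fun r => u r - v r)) by exact: (integrableB measurableT iu iv).
have iw : mu.-integrable setT (EFin \o w) by exact: (integrableD measurableT iw1 ip).
have Ew : \int[mu]_r w r = \int[mu]_r u r - chi 0 + chi T * m.
  rewrite /w (RintegralD measurableT iw1 ip) (RintegralB measurableT iu iv).
  by rewrite integral_p integral_q; ring.
have [ik Ek] := ml_kernel_convolution alpha_gt0 T alpha_gt0 alpha1_gt0.
have a1 : alpha + (1 - alpha) = 1 by rewrite addrC subrK.
rewrite a1 in Ek.
have wle r : `|w r| <= 2 * M * (G r * rl_kernel (1 - alpha) (T - r)).
  have -> : w r = G r * ((F r - chi r) * j r + frac_int (1 - alpha) X r) by rewrite /w /u /v /p; ring.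
  rewrite normrM (ger0_norm (G0 r)) [leRHS]mulrCA; apply: ler_wpM2l; first exact: G0.
  have [rT|Tr] := ltP r T.
    by rewrite /j rl_kernel1 subr_gt0 rT mulr1; exact: local.
  rewrite /j [rl_kernel 1 _]rl_kernel_eq0 ?subr_le0// mulr0 add0r.
  rewrite [rl_kernel _ _]rl_kernel_eq0 ?subr_le0// mulr0.
  rewrite [X in `|X|](_ : _ = 0) ?normr0//.
  rewrite /frac_int; under eq_Rintegral => s _.
    rewrite (_ : _ * _ = 0); first over.
    have [s0|s0] := leP s 0; first by rewrite rl_kernel_eq0// mul0r.
    by rewrite /X [rl_kernel 1 _]rl_kernel_eq0 ?mulr0// subr_le0 (le_trans Tr)// lerDl ltW.
  by rewrite Rintegral_cst// mul0r.
have M0 : 0 <= 2 * M by rewrite mulr_ge0// (le_trans (normr_ge0 _) (chiM 0)).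
have w_le : `|\int[mu]_r w r| <= 2 * M * m.
  apply: le_trans (le_normr_Rintegral measurableT iw) _.
  have ikM := @integrableZl _ _ _ mu setT measurableT (2 * M) _ ik.
  rewrite (_ : 2 * M * m = \int[mu]_r (2 * M * (G r * rl_kernel (1 - alpha) (T - r)))); last first.
    by rewrite (RintegralZl _ measurableT ik) /Rintegral Ek.
  by apply: (le_Rintegral measurableT _ ikM) => [|r _]; [exact: integrable_norm iw|exact: wle].
have cm : `|chi T * m| <= M * m by rewrite normrM (ger0_norm m0) ler_wpM2r.
rewrite (_ : _ - _ = \int[mu]_r w r - chi T * m); last by rewrite Ew addrK.
apply: le_trans (ler_normB _ _) _; apply: le_trans (lerD w_le cm) _.
by rewrite -mulrDl; apply: ler_wpM2r => //; lra.
Qed.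

End Horizon.

(** * Waves are averages of their input *)

Section WaveAverage.
Context {R : realType}.
Local Notation mu := (@lebesgue_measure R).
Variable alpha : R.
Hypothesis alpha01 : 0 < alpha < 1.
Let alpha_gt0 : 0 < alpha. Proof. by case/andP: alpha01. Qed.
Let G := ml_kernel alpha alpha.
Let mG : measurable_fun setT G. Proof. exact: measurable_ml_kernel. Qed.
Let Gle0 (r : R) : r <= 0 -> G r = 0. Proof. exact: ml_kernel_le0. Qed.
Let Ggt0 (r : R) : 0 < r -> 0 < G r. Proof. exact: ml_kernel_gt0. Qed.
Let G1 : (\int[mu]_r (G r)%:E = 1)%E. Proof. exact: ml_kernel_mass. Qed.

(** Every bounded wave is the average of its own input along the delays.  The
    horizon of the previous balance goes to infinity, where the relaxation
    function vanishes.  For c = 0 the equation says psi = f, and g has mass 1. *)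
Lemma wave_average (psi f : R -> R) (c N z : R) : 0 <= c -> BC1 psi ->
  measurable_fun setT f -> (forall x, `|f x| <= N) ->
  (forall x, frac_deriv_exists alpha c psi x /\ frac_deriv alpha c psi x = f x - psi x) ->
  psi z = average G (fun r => f (z + c * r)).
Proof.
rewrite le_eqVlt => /predU1P[<- _ mf fN wave|c0].
  have [_] := wave z; rewrite /frac_deriv ltxx => E.
  rewrite (@eq_average _ G Gle0 _ (fun=> psi z)) ?(average_cst mG Gle0 Ggt0 G1)//.
  by move=> r _; rewrite mul0r addr0; apply/eqP; rewrite -subr_eq0 -E.
move=> [dpsi cdpsi [M psiM] [M' dpsiM]] mf fN wave.
pose chi (t : R) := psi (z + c * t).
pose F (r : R) := f (z + c * r).
have dchi t : is_derive (t : R) 1 chi (c * derive1 psi (z + c * t)).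
  exact: is_derive_chi.
have Dchi : derive1 chi = (fun t => c * derive1 psi (z + c * t)).
  by apply: derive1_chi.
have cdchi : continuous (derive1 chi).
  rewrite Dchi => t; apply: cvgM; first exact: cvg_cst.
  apply: (@continuous_comp _ _ _ (fun t => z + c * t) (derive1 psi)); last exact: cdpsi.
  by apply: cvgD; [exact: cvg_cst|apply: cvgM; [exact: cvg_cst|exact: cvg_id]].
have dchiM x : `|derive1 chi x| <= c * M'.
  by rewrite Dchi normrM (gtr0_norm c0); apply: ler_wpM2l; [exact: ltW|exact: dpsiM].
have mF : measurable_fun setT F by exact: measurable_delay mf.
have FN x : `|F x| <= N by exact: fN.
pose u (n : nat) := average G (fun r => F r * rl_kernel 1 (n.+1%:R - r)).
have bal n : `|u n - psi z| <= 3 * M * ml_kernel alpha 1 n.+1%:R.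
  rewrite (_ : psi z = chi 0); last by rewrite /chi mulr0 addr0.
  apply: (horizon_balance alpha01 _ cdchi _ dchiM mF FN).
  - by move=> t; have [] := dchi t.
  - by move=> t; exact: psiM.
  - by rewrite ltr0n.
  - by move=> r rT; exact: (wave_local alpha01 dpsi cdpsi psiM dpsiM).
have c1 : u n @[n --> \oo] --> average G F.
  apply: (average_cvg mG Gle0 Ggt0 G1 (M := N)).
  - move=> n; split.
      apply: measurable_funM mF _; apply: measurableT_comp; first exact: measurable_rl_kernel.
      exact: measurable_funB.
    move=> r _; rewrite normrM; apply: le_trans (FN r).
    rewrite -[leRHS]mulr1; apply: ler_wpM2l; first exact: normr_ge0.
    by rewrite rl_kernel1; case: ifP; rewrite ?normr1 ?normr0 ?ler01.
  - exact: mF.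
  - move=> r r0; apply: cvg_near_cst; near=> n.
    rewrite rl_kernel1 subr_gt0 (_ : r < n.+1%:R) ?mulr1//.
    apply: (@lt_trans _ _ n%:R); last by rewrite ltr_nat.
    near: n; exact: nbhs_infty_gtr.
have c2 : u n @[n --> \oo] --> psi z.
  have m0 : 3 * M * ml_kernel alpha 1 n.+1%:R @[n --> \oo] --> 0.
    rewrite -[X in _ --> X](mulr0 (3 * M)); apply: cvgM; first exact: cvg_cst.
    have /cvg_pinftyP := relaxation_cvg0 alpha01; apply.
    apply/cvgryPge => A; near=> n; apply: (@le_trans _ _ n%:R); last by rewrite ler_nat.
    near: n; exact: nbhs_infty_ger.
  apply: (@squeeze_cvgr _ _ _ _ (fun n => psi z - 3 * M * ml_kernel alpha 1 n.+1%:R)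
    (fun n => psi z + 3 * M * ml_kernel alpha 1 n.+1%:R)).
  - apply: nearW => n; have := bal n; rewrite ler_norml => /andP[h1 h2].
    by apply/andP; split; [rewrite addrC -lerBrDr|rewrite -lerBlDl].
  - by rewrite -[X in _ --> X](subr0 (psi z)); apply: cvgB m0; exact: cvg_cst.
  - by rewrite -[X in _ --> X](addr0 (psi z)); apply: cvgD m0; exact: cvg_cst.
exact: (cvg_unique _ c2 c1).
Unshelve. all: by end_near. Qed.

End WaveAverage.

(** * First and last crossing *)

Section Crossing.
Context {R : realType}.
Implicit Types (psi : R -> R) (u l : R).

(** The supremum of the points where psi is at least u. *)
Lemma last_crossing psi u l1 l2 : continuous psi ->
  psi z @[z --> -oo] --> l1 -> psi z @[z --> +oo] --> l2 -> l2 < u -> u < l1 ->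
  exists2 z, psi z = u & forall y, z < y -> psi y < u.
Proof.
move=> cpsi c1 c2 l2u ul1.
have [B [_ HB]] := cvgr_lt _ c2 _ l2u.
have [A [_ HA]] := cvgr_gt _ c1 _ ul1.
pose S := [set x | u <= psi x].
have hS : has_sup S.
  split; first by exists (A - 1); apply/ltW/HA; rewrite ltrBlDr ltrDl.
  by exists B => x Sx; rewrite leNgt; apply/negP => /HB; rewrite ltNge Sx.
have gt y : sup S < y -> psi y < u.
  by rewrite !ltNge; apply: contra => uy; exact: sup_upper_bound.
exists (sup S) => //; apply/eqP; rewrite eq_le; apply/andP; split.
  rewrite leNgt; apply/negP => h.
  have [e /= e0 He] := cvgr_gt _ (cpsi (sup S)) _ h.
  have := He (sup S + e / 2); rewrite /= opprD addNKr normrN gtr0_norm ?divr_gt0//.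
  rewrite gtr_pMr// invf_lt1// ltr1n => /(_ isT).
  by rewrite ltNge (ltW (gt _ _))// ltrDl divr_gt0.
rewrite leNgt; apply/negP => h.
have [e /= e0 He] := cvgr_lt _ (cpsi (sup S)) _ h.
have [a Sa ae] := sup_adherent e0 hS.
have /He : `|sup S - a| < e.
  by rewrite ger0_norm ?subr_ge0; [rewrite ltrBlDr -ltrBlDl|exact: sup_upper_bound].
by rewrite ltNge Sa.
Qed.

Lemma first_crossing psi u l1 l2 : continuous psi ->
  psi z @[z --> -oo] --> l1 -> psi z @[z --> +oo] --> l2 -> l2 < u -> u < l1 ->
  exists2 z, psi z = u & forall y, y < z -> u < psi y.
Proof.
move=> cpsi c1 c2 l2u ul1.
have [|||||z e h] := @last_crossing (fun y => - psi (- y)) (- u) (- l2) (- l1).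
- move=> x; apply: cvgN; apply: (@continuous_comp _ _ _ -%R psi); last exact: cpsi.
  exact: opp_continuous.
- by apply: cvgN; apply/cvgNy_compNP; rewrite (_ : _ \o _ = psi)//; apply/funext => x /=; rewrite opprK.
- by apply: cvgN; apply/cvgy_compNP; rewrite (_ : _ \o _ = psi)//; apply/funext => x /=; rewrite opprK.
- by rewrite ltrN2.
- by rewrite ltrN2.
exists (- z); first by apply: oppr_inj.
by move=> y yz; rewrite -ltrN2; have := h (- y); rewrite opprK; apply; rewrite ltrNr.
Qed.

End Crossing.

(** * Existence and rigidity of waves *)

Section Waves.
Context {R : realType}.
Local Notation mu := (@lebesgue_measure R).
Variables (alpha : R) (K : R -> R).
Hypothesis alpha01 : 0 < alpha < 1.
Hypothesis Kint : mu.-integrable setT (EFin \o K).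
Hypothesis Kbnd : exists M : R, forall x, `|K x| <= M.
Hypothesis Kcont : continuous K.
Hypothesis Kge0 : forall x, 0 <= K x.
Hypothesis K0 : 0 < K 0.
Hypothesis Ksym : forall x, K x = K (- x).
Implicit Types (c z r h uT : R) (psi : R -> R).

Let alpha_gt0 : 0 < alpha. Proof. by case/andP: alpha01. Qed.
Let G := ml_kernel alpha alpha.
Let mG : measurable_fun setT G. Proof. exact: measurable_ml_kernel. Qed.
Let Gle0 r : r <= 0 -> G r = 0. Proof. exact: ml_kernel_le0. Qed.
Let Ggt0 r : 0 < r -> 0 < G r. Proof. exact: ml_kernel_gt0. Qed.
Let G1 : (\int[mu]_r (G r)%:E = 1)%E. Proof. exact: ml_kernel_mass. Qed.

Lemma reflected_profile c : (fun z => kappa K - profile alpha K (- c) (- z)) = profile alpha K c.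
Proof. by apply/funext => z; rewrite profile_opp// subKr. Qed.

(** The profile crosses u_T exactly once, at the origin, so its firing pattern
    is a step. *)
Lemma profile_input uT h c z : 0 <= h <= 1 -> uT = profile alpha K c 0 ->
  \int[mu]_y (K (z - y) * Heaviside h (profile alpha K c y - uT)) = tail K z.
Proof.
move=> h01 ->.
have cp := BC1_continuous (profile_BC1 alpha01 Kint Kbnd Kcont Kge0 c).
have fw := firing_Heaviside (profile alpha K c 0) h01 cp.
have := @input_sharp _ K Kint Kcont Kge0 _ 0 z fw; rewrite subr0; apply=> y y0.
  by apply: Heaviside_gt0; rewrite subr_gt0; exact: profile_gt.
by apply: Heaviside_lt0; rewrite subr_lt0; exact: profile_lt.
Qed.

Let profile_wave_ge0 uT h c : 0 <= c -> 0 <= h <= 1 -> uT = profile alpha K c 0 ->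
  asymptotic_traveling_wave alpha K uT h c (profile alpha K c).
Proof.
move=> c0 h01 e; split; first exact: profile_BC1.
move=> z; rewrite (profile_input z h01 e).
move: c0; rewrite le_eqVlt => /predU1P[<-|c0]; last exact: profile_frac_deriv.
rewrite /frac_deriv ltxx profile0// subrr; split => //.
by split; rewrite ltxx.
Qed.

Lemma profile_wave uT h c : 0 <= h <= 1 -> uT = profile alpha K c 0 ->
  asymptotic_traveling_wave alpha K uT h c (profile alpha K c).
Proof.
have [c0|c0] := leP 0 c; first exact: profile_wave_ge0.
move=> /andP[h0 h1] e.
have w : asymptotic_traveling_wave alpha K (kappa K - uT) (1 - h) (- c) (profile alpha K (- c)).
  apply: profile_wave_ge0; first by rewrite oppr_ge0 ltW.
    by rewrite subr_ge0 h1 gerBl.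
  by rewrite profile0_opp// e.
have h01' : 0 <= 1 - h <= 1 by rewrite subr_ge0 h1 gerBl.
have := traveling_wave_reflect Kint Kcont Kge0 Ksym h01' w.
by rewrite !subKr opprK reflected_profile.
Qed.

(** Translating the integral moves the shift onto the density, which vanishes
    for negative delays; hence f is seen on the open half-line only. *)
Lemma average_shift_eq0 (f : R -> R) (d : R) : 0 <= d -> measurable_fun setT f ->
  {ae mu, forall r, 0 < r -> f r = 0} -> average G (fun r => f (r + d)) = 0.
Proof.
move=> d0 mf [N [mN N0 sub]].
have mF : measurable_fun setT (fun r : R => (G (r - d) * f r)%:E).
  apply/measurable_EFinP; apply: measurable_funM mf.
  by apply: (measurableT_comp mG); exact: measurable_funB.
have E : (\int[mu]_r (G (r - d) * f r)%:E = \int[mu]_r (G r * f (r + d))%:E)%E.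
  by rewrite (integral_shift d mF); apply: eq_integral => r _; rewrite addrK.
suff Z : (\int[mu]_r (G (r - d) * f r)%:E = 0)%E by exact: (congr1 fine (etrans (esym E) Z)).
rewrite -[RHS](integral0 mu setT).
apply: ae_eq_integral; [exact: measurableT|exact: mF|exact: measurable_cst|].
exists N; split => //; apply: subset_trans sub => r /=; apply: contra_not => fr _.
have [rd|dr] := leP r d; first by rewrite Gle0 ?subr_le0// mul0r.
by rewrite fr ?mulr0// (le_lt_trans d0).
Qed.

(** Let a be the first and b the last point where psi = u_T.  The firing pattern
    of psi lies between the steps at a and at b, so its input f lies
    between tail K (x - a) and tail K (x - b).  Averaging along the delays from a
    and from b gives u_T >= profile c 0 and u_T <= profile c 0, and profile c 0
    determines c.  Equality in the first average forces
    f (a + c r) = tail K (c r) for almost every r > 0.  If a < b, the delays that start at b are later delays from a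
    as c > 0, so psi b = profile c (b - a) < profile c 0 = u_T, a contradiction.
    Hence a = b, the pattern is a step, and psi is a translate of the profile.
    For c = 0 the equality reads u_T = kappa / 2, the excluded case. *)
Let rigidity uT h c psi : 0 <= c -> 0 <= h <= 1 -> 0 < uT < kappa K -> kappa K != 2 * uT ->
  asymptotic_traveling_wave alpha K uT h c psi ->
  psi z @[z --> -oo] --> kappa K -> psi z @[z --> +oo] --> 0 ->
  uT = profile alpha K c 0 /\ exists b, forall z, psi z = profile alpha K c (z - b).
Proof.
move=> c0 h01 /andP[u0 uk] kne [bc wave] cN cP.
have cpsi := BC1_continuous bc.
pose w y := Heaviside h (psi y - uT).
have fw : firing w by exact: firing_Heaviside.
pose f := input K w.
have mf : measurable_fun setT f by exact: measurable_input.
have fk x : `|f x| <= kappa K by rewrite ger0_norm; [exact: input_le_kappa|exact: input_ge0].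
have avg z : psi z = average G (fun r => f (z + c * r)).
  exact: (wave_average alpha01 z c0 bc mf fk wave).
have bf z : bounded_delay (kappa K) (fun r => f (z + c * r)).
  by split; [exact: measurable_delay mf|move=> r _; exact: fk].
have [b eb gtb] := last_crossing cpsi cN cP u0 uk.
have [a ea lta] := first_crossing cpsi cN cP u0 uk.
have w1 y : y < a -> w y = 1 by move=> ya; apply: Heaviside_gt0; rewrite subr_gt0; exact: lta.
have w0 y : b < y -> w y = 0. by move=> yb; apply: Heaviside_lt0; rewrite subr_lt0; exact: gtb.
have w01 y : 0 <= w y <= 1 by exact: fw.2.
have f_ge x : tail K (x - a) <= f x.
  rewrite -input_step//; apply: input_le => //; first exact: firing_step.
  move=> y; rewrite /step; case: ltP => ya; first by rewrite w1.
  by case/andP: (w01 y).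
have f_le x : f x <= tail K (x - b).
  pose v y : R := if y <= b then 1 else 0.
  have fv : firing v.
    split; last by move=> y; rewrite /v; case: ifP; rewrite lexx ler01.
    by apply: measurable_fun_ifT => //; exact: measurable_fun_ler.
  rewrite -(@input_sharp _ K Kint Kcont Kge0 v b x fv).
  - apply: (@input_le _ K Kint Kcont Kge0 w v x fw fv) => y; rewrite /v; case: (leP y b) => yb; last by rewrite w0.
    by case/andP: (w01 y).
  - by move=> y yb; rewrite /v (ltW yb).
  - by move=> y yb; rewrite /v leNgt yb.
have le1 : uT <= profile alpha K c 0.
  rewrite -eb avg profileE; apply: (average_le mG Gle0 Ggt0 G1 (bf b) (tail_delay Kint Kcont Kge0 0 c)).
  by move=> r _; have := f_le (b + c * r); rewrite addrAC subrr.
have le2 : profile alpha K c 0 <= uT.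
  rewrite -[leRHS]ea avg profileE; apply: (average_le mG Gle0 Ggt0 G1 (tail_delay Kint Kcont Kge0 0 c) (bf a)).
  by move=> r _; have := f_ge (a + c * r); rewrite addrAC subrr.
have eu : uT = profile alpha K c 0 by apply/eqP; rewrite eq_le le1.
have cpos : 0 < c.
  rewrite lt_neqAle c0 andbT; apply/eqP => ec.
  by move: kne; rewrite -(profile00 alpha01 Kint Kcont Kge0 Ksym) eu -ec eqxx.
have ab : a <= b by rewrite leNgt; apply/negP => /lta; rewrite eb ltxx.
have {ab} ab : a = b.
  apply/eqP; rewrite eq_le ab /= leNgt; apply/negP => ltab.
  pose e s := f (a + c * s) - tail K (0 + c * s).
  have be : bounded_delay (kappa K + kappa K) e.
    split; first by apply: measurable_funB; [exact: (bf a).1|exact: (tail_delay Kint Kcont Kge0 0 c).1].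
    move=> r r0; apply: le_trans (ler_normB _ _) _; apply: lerD; first exact: fk.
    exact: (tail_delay Kint Kcont Kge0 0 c).2.
  have e0 : average G e = 0.
    rewrite (averageB mG Gle0 Ggt0 G1 (bf a) (tail_delay Kint Kcont Kge0 0 c)).
    by rewrite -avg -profileE ea -eu subrr.
  have ege s : 0 < s -> 0 <= e s.
    by move=> _; rewrite subr_ge0; have := f_ge (a + c * s); rewrite addrAC subrr.
  have ae := average_eq0 mG Gle0 Ggt0 G1 be ege e0.
  have d0 : 0 <= (b - a) / c by rewrite divr_ge0// subr_ge0 ltW.
  have := average_shift_eq0 d0 be.1 ae.
  have cd r : c * (r + (b - a) / c) = c * r + (b - a) by field; rewrite gt_eqF.
  rewrite (_ : (fun r => e (r + (b - a) / c)) = (fun r => f (b + c * r) - tail K (b - a + c * r))); last first.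
    apply/funext => r; rewrite /e cd; congr (f _ - tail K _); by ring.
  rewrite (averageB mG Gle0 Ggt0 G1 (bf b) (tail_delay Kint Kcont Kge0 (b - a) c)).
  rewrite -avg -profileE eb => /eqP; rewrite subr_eq0 eu => /eqP E.
  have := profile_lt alpha01 Kint Kcont Kge0 K0 c (z := b - a).
  by rewrite subr_gt0 -E ltxx => /(_ ltab).
split => //; exists b => z; rewrite avg profileE; apply: eq_average => // r _.
apply/eqP; rewrite eq_le addrAC f_le /=.
by have := f_ge (z + c * r); rewrite ab.
Qed.

(** A wave of negative speed is reflected into one of positive speed. *)
Lemma wave_rigidity uT h c psi : 0 <= h <= 1 -> 0 < uT < kappa K -> kappa K != 2 * uT ->
  asymptotic_traveling_wave alpha K uT h c psi ->
  psi z @[z --> -oo] --> kappa K -> psi z @[z --> +oo] --> 0 ->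
  uT = profile alpha K c 0 /\ exists b, forall z, psi z = profile alpha K c (z - b).
Proof.
have [c0|c0] := leP 0 c; first exact: rigidity.
move=> h01 /andP[u0 uk] kne wave cN cP.
have := traveling_wave_reflect Kint Kcont Kge0 Ksym h01 wave.
move=> /rigidity [].
- by rewrite oppr_ge0 ltW.
- by case/andP: h01 => h0 h1; rewrite subr_ge0 h1 gerBl.
- by rewrite subr_gt0 uk gtrBl.
- apply: contra kne => /eqP e; apply/eqP; move: e; lra.
- rewrite -[X in _ --> X](subr0 (kappa K)); apply: cvgB; first exact: cvg_cst.
  by apply/cvgNy_compNP; rewrite (_ : _ \o _ = psi)//; apply/funext => x /=; rewrite opprK.
- rewrite -[X in _ --> X](subrr (kappa K)); apply: cvgB; first exact: cvg_cst.
  by apply/cvgy_compNP; rewrite (_ : _ \o _ = psi)//; apply/funext => x /=; rewrite opprK.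
move=> e [b Hb]; split.
  by move: e; rewrite profile0_opp// => /(congr1 (fun x => kappa K - x)); rewrite !subKr.
exists (- b) => z.
have e1 : - z - b = - (z - - b) by rewrite opprK opprD.
have := Hb (- z); rewrite e1 (profile_opp alpha01 Kint Kcont Kge0 Ksym c (z - - b)) (opprK z).
by move=> /addrI/oppr_inj.
Qed.

End Waves.

(** * The theorem *)
Theorem theorem2p4 (R : realType) (alpha uT h : R) (K : R -> R)
  (halpha : 0 < alpha < 1)
  (hh : 0 <= h <= 1)
  (Kint : (@lebesgue_measure R).-integrable setT (EFin \o K))
  (Kbnd : exists M : R, forall x, `|K x| <= M)
  (Kcont : continuous K)
  (Kge0 : forall x, 0 <= K x)
  (K0 : 0 < K 0)
  (Ksym : forall x, K x = K (- x))
  (huT : 0 < uT < kappa K) :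
  (exists! c, speed_equation alpha K uT c) /\
  forall cstar, speed_equation alpha K uT cstar ->
    [/\ asymptotic_traveling_wave alpha K uT h cstar (profile alpha K cstar),
        forall x y : R, x <= y -> profile alpha K cstar y <= profile alpha K cstar x,
        profile alpha K cstar z @[z --> -oo] --> kappa K
      & profile alpha K cstar z @[z --> +oo] --> 0] /\
    (kappa K != 2 * uT ->
      forall (c : R) (psi : R -> R),
        asymptotic_traveling_wave alpha K uT h c psi ->
        psi z @[z --> -oo] --> kappa K ->
        psi z @[z --> +oo] --> 0 ->
        c = cstar /\
        exists z0 : R, forall z, psi z = profile alpha K cstar (z - z0)).
Proof.
split.
  have [c e] := speed_exists halpha Kint Kcont Kge0 Ksym huT.
  exists c; split; first exact/speed_equationE.
  move=> c' /speed_equationE e'; apply: (speed_unique halpha Kint Kcont Kge0 K0).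
  by rewrite -e -e'.
move=> c /speed_equationE e; split; first split.
- exact: profile_wave.
- by move=> x y; exact: profile_nonincreasing.
- exact: profile_cvg_ninfty.
- exact: profile_cvg_pinfty.
move=> kne c' psi wave cN cP.
have [e' [b Hb]] := wave_rigidity halpha Kint Kcont Kge0 K0 Ksym hh huT kne wave cN cP.
have cc : c' = c by apply: (speed_unique halpha Kint Kcont Kge0 K0); rewrite -e -e'.
by split; [exact: cc|exists b => z; rewrite -cc; exact: Hb].
Qed.
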